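(* Let $n,m\ge1$ be integers, let $0<\alpha_k<n$ for $k=1,\dots,m$, put $\alpha=\sum_{k=1}^m\alpha_k$, and assume $mn-\alpha<n$. Let $2\le q\le 2n/(mn-\alpha)$ and $\frac1p+\frac1q=1$. Then there is a finite constant $C_{\alpha,q}$ (depending only on $n,m,\alpha_1,\dots,\alpha_m,q$) such that for every $f\in\mathcal S(\mathbb R^{mn})$ $$\left[\int_{\mathbb R^n}|f(\underbrace{x,\dots,x}_{m\text{ slots}})|^q\,dx\right]^{2/q}\le C_{\alpha,q}\,\Lambda_*(f;\alpha_1,\dots,\alpha_m),$$ and, with the same constant, for every real-valued $h\in L^p(\mathbb R^n)$ $$\int_{\mathbb R^n\times\mathbb R^n}h(x)\prod_{k=1}^mG_{\alpha_k}(x-w)\,h(w)\,dx\,dw\le C_{\alpha,q}\,\big(\|h\|_{L^p(\mathbb R^n)}\big)^2 .$$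
   Context: $\mathcal S(\mathbb R^{mn})$ is the Schwartz class on $\mathbb R^{mn}=\mathbb R^n\times\cdots\times\mathbb R^n$ ($m$ copies), with points written $(x_1,\dots,x_m)$, $x_k\in\mathbb R^n$. The Fourier transform is $\widehat f(\xi)=\int e^{2\pi i\xi\cdot y}f(y)\,dy$. $\Delta_k$ is the standard Laplacian in the variable $x_k$, and $(1-\Delta_k)^{\alpha_k/4}$ is the Fourier multiplier operator with symbol $(1+4\pi^2|\xi_k|^2)^{\alpha_k/4}$. Define $$\Lambda_*(f;\alpha_1,\dots,\alpha_m)=\int_{\mathbb R^{mn}}\Big|\prod_{k=1}^m(1-\Delta_k)^{\alpha_k/4}f\Big|^2dx_1\cdots dx_m=\int_{\mathbb R^{mn}}\prod_{k=1}^m(1+4\pi^2|\xi_k|^2)^{\alpha_k/2}\,|\widehat f|^2\,d\xi_1\cdots d\xi_m .$$ The Bessel potential $G_a$ ($a>0$) on $\mathbb R^n$ is $$G_a(x)=\frac{1}{(4\pi)^{a/2}\Gamma(a/2)}\int_0^\infty e^{-\pi|x|^2/\delta}\,e^{-\delta/4\pi}\,\delta^{-(n-a)/2}\,\frac{d\delta}{\delta},$$ equivalently the non-negative integrable function that is the Fourier transform of $(1+4\pi^2|\xi|^2)^{-a/2}$. *)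

(* Defs.v *)
From HB Require Import structures.
From mathcomp Require Import all_boot all_order all_algebra.
From mathcomp Require Import all_classical all_reals all_analysis.
From mathcomp Require Import complex.

Set Implicit Arguments.
Unset Strict Implicit.
Unset Printing Implicit Defensive.

Import Order.TTheory GRing.Theory Num.Theory.
Import numFieldNormedType.Exports.

Local Open Scope classical_set_scope.
Local Open Scope ring_scope.
Local Open Scope complex_scope.

Section MatrixBorel.
Context (R : realType) (m n : nat).

(* The coordinate preimages generate the Borel sigma-algebra of R^(m n), since R
   is second countable. *)
Definition mx_coord_sets : set (set 'M[R]_(m, n)) :=
  [set A | exists i j (B : set (measurableTypeR R)),
     measurable B /\ A = (fun M : 'M[R]_(m, n) => M i j) @^-1` B].

Definition mx_display : measure_display.
Proof. exact: (sigma_display mx_coord_sets). Qed.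

HB.instance Definition _ := @isMeasurable.Build mx_display 'M[R]_(m, n)
  <<s mx_coord_sets >> (@sigma_algebra0 _ _ _) (@sigma_algebraC _ _)
  (@sigma_algebra_bigcup _ _ _).

Lemma measurable_mx_coord i j :
  measurable_fun [set: 'M[R]_(m, n)]
    (fun M : 'M[R]_(m, n) => M i j : measurableTypeR R).
Proof.
move=> _ B mB; rewrite setTI; apply: sub_sigma_algebra.
by exists i, j, B.
Qed.

Lemma measurable_fun_mx d (T : measurableType d) (F : T -> 'M[R]_(m, n)) :
  (forall i j, measurable_fun [set: T] (fun x => F x i j : measurableTypeR R)) ->
  measurable_fun [set: T] F.
Proof.
move=> mF; apply: (measurability mx_coord_sets) => //.
move=> _ [_ [i [j [B [mB ->]]]] <-].
exact: mF.
Qed.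

End MatrixBorel.

Lemma sigma_finite_product d1 d2 (T1 : measurableType d1)
    (T2 : measurableType d2) (R : realType)
    (mu1 : {sigma_finite_measure set T1 -> \bar R})
    (mu2 : {sigma_finite_measure set T2 -> \bar R}) :
  sigma_finite [set: T1 * T2] (mu1 \x mu2)%E.
Proof.
have /sigma_finiteP[F [TF ndF Foo]] := sigma_finiteT mu1.
have /sigma_finiteP[G [TG ndG Goo]] := sigma_finiteT mu2.
exists (fun k => F k `*` G k).
  rewrite -setXTT TF TG predeqE => -[x y]; split.
    move=> [/= [i _ Fx] [k _ Gy]]; exists (maxn i k) => //; split.
    - by move: x Fx; exact/subsetPset/ndF/leq_maxl.
    - by move: y Gy; exact/subsetPset/ndG/leq_maxr.
  by move=> [i _ []/= ? ?]; split; exists i.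
move=> k; have [? ?] := Foo k; have [? ?] := Goo k.
split; first exact: measurableX.
by rewrite product_measure1E// lte_mul_pinfty// ge0_fin_numE.
Qed.

Section GlueMeasure.
Context (R : realType) (m n : nat).
Context d1 d2 (T1 : measurableType d1) (T2 : measurableType d2).
Variables (mu1 : {sigma_finite_measure set T1 -> \bar R})
          (mu2 : {sigma_finite_measure set T2 -> \bar R}).
Variables (glue : T1 * T2 -> 'M[R]_(m, n)) (split : 'M[R]_(m, n) -> T1 * T2).

(* The proof arguments only serve to make the canonical measure structure
   inferable. *)
Definition glue_measure (_ : measurable_fun [set: T1 * T2] glue)
    (_ : measurable_fun [set: 'M[R]_(m, n)] split) (_ : cancel glue split) :
    set 'M[R]_(m, n) -> \bar R :=
  pushforward (mu1 \x mu2)%E glue.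

Hypotheses (mglue : measurable_fun [set: T1 * T2] glue)
           (msplit : measurable_fun [set: 'M[R]_(m, n)] split)
           (glueK : cancel glue split).

Let mu := glue_measure mglue msplit glueK.

Let mu0 : mu set0 = 0%E.
Proof. by rewrite /mu /glue_measure /pushforward preimage_set0 measure0. Qed.

Let mu_ge0 A : (0 <= mu A)%E.
Proof. exact: measure_ge0. Qed.

Let mu_sigma_additive : semi_sigma_additive mu.
Proof.
move=> F mF tF mUF; rewrite /mu /glue_measure /pushforward preimage_bigcup.
apply: measure_semi_sigma_additive.
- by move=> k; rewrite -[X in measurable X]setTI; exact: mglue.
- apply/trivIsetP => /= i j _ _ ij; rewrite -preimage_setI.
  by move/trivIsetP : tF => /(_ _ _ _ _ ij) ->//; rewrite preimage_set0.
- by rewrite -preimage_bigcup -[X in measurable X]setTI; exact: mglue.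
Qed.

HB.instance Definition _ := isMeasure.Build _ _ _ mu mu0 mu_ge0 mu_sigma_additive.

Let mu_sigma_finite : sigma_finite [set: 'M[R]_(m, n)] mu.
Proof.
have [F FT Ffin] := sigma_finite_product mu1 mu2.
exists (fun k => split @^-1` F k).
  by rewrite -preimage_bigcup -FT preimage_setT.
move=> k; have [mF Foo] := Ffin k; split.
  by rewrite -[X in measurable X]setTI; exact: msplit.
rewrite /mu /glue_measure /pushforward.
suff -> : glue @^-1` (split @^-1` F k) = F k by [].
by apply/seteqP; split => x /=; rewrite glueK.
Qed.

HB.instance Definition _ :=
  Measure_isSigmaFinite.Build _ _ _ mu mu_sigma_finite.

End GlueMeasure.

Section Lebesgue.
Context (R : realType).

Definition rV_cons n (p : measurableTypeR R * 'rV[R]_n) : 'rV[R]_n.+1 :=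
  \row_j (if unlift 0 j is Some j' then p.2 0 j' else p.1).

Definition rV_uncons n (v : 'rV[R]_n.+1) : measurableTypeR R * 'rV[R]_n :=
  (v 0 0, \row_j v 0 (lift 0 j)).

Lemma measurable_rV_cons n : measurable_fun setT (@rV_cons n).
Proof.
apply: measurable_fun_mx => i j; case: (unliftP 0 j) => [j' ->|->].
  under eq_fun do rewrite mxE liftK.
  exact: measurableT_comp (measurable_mx_coord 0 j') measurable_snd.
under eq_fun do rewrite mxE unlift_none.
exact: measurable_fst.
Qed.

Lemma measurable_rV_uncons n : measurable_fun setT (@rV_uncons n).
Proof.
apply: measurable_fun_pair; first exact: measurable_mx_coord.
apply: measurable_fun_mx => i j; under eq_fun do rewrite mxE.
exact: measurable_mx_coord.
Qed.

Lemma rV_consK n : cancel (@rV_cons n) (@rV_uncons n).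
Proof.
move=> [t v]; rewrite /rV_uncons mxE unlift_none; congr pair.
by apply/rowP => j; rewrite !mxE liftK.
Qed.

Definition mx_cons m n (p : 'rV[R]_n * 'M[R]_(m, n)) : 'M[R]_(m.+1, n) :=
  \matrix_(i, j) (if unlift 0 i is Some i' then p.2 i' j else p.1 0 j).

Definition mx_uncons m n (M : 'M[R]_(m.+1, n)) : 'rV[R]_n * 'M[R]_(m, n) :=
  (row 0 M, \matrix_(i, j) M (lift 0 i) j).

Lemma measurable_mx_cons m n : measurable_fun setT (@mx_cons m n).
Proof.
apply: measurable_fun_mx => i j; case: (unliftP 0 i) => [i' ->|->].
  under eq_fun do rewrite mxE liftK.
  exact: measurableT_comp (measurable_mx_coord i' j) measurable_snd.
under eq_fun do rewrite mxE unlift_none.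
exact: measurableT_comp (measurable_mx_coord 0 j) measurable_fst.
Qed.

Lemma measurable_mx_uncons m n : measurable_fun setT (@mx_uncons m n).
Proof.
apply: measurable_fun_pair; apply: measurable_fun_mx => i j.
  under eq_fun do rewrite mxE.
  exact: measurable_mx_coord.
under eq_fun do rewrite mxE.
exact: measurable_mx_coord.
Qed.

Lemma mx_consK m n : cancel (@mx_cons m n) (@mx_uncons m n).
Proof.
move=> [v M]; rewrite /mx_uncons; congr pair.
  by apply/rowP => j; rewrite !mxE unlift_none.
by apply/matrixP => i j; rewrite !mxE liftK.
Qed.

Fixpoint lebesgue_rV (n : nat) : {sigma_finite_measure set 'rV[R]_n -> \bar R} :=
  match n with
  | 0 => \d_(0 : 'rV[R]_0)
  | n'.+1 => glue_measure lebesgue_measure (lebesgue_rV n')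
      (@measurable_rV_cons n') (@measurable_rV_uncons n') (@rV_consK n')
  end.

Fixpoint lebesgue_mx (m n : nat) :
    {sigma_finite_measure set 'M[R]_(m, n) -> \bar R} :=
  match m with
  | 0 => \d_(0 : 'M[R]_(0, n))
  | m'.+1 => glue_measure (lebesgue_rV n) (lebesgue_mx m' n)
      (@measurable_mx_cons m' n) (@measurable_mx_uncons m' n) (@mx_consK m' n)
  end.

End Lebesgue.

Lemma measurable_rV_box (R : realType) n (A : 'I_n -> set (measurableTypeR R)) :
  (forall j, measurable (A j)) ->
  measurable [set v : 'rV[R]_n | forall j, A j (v 0 j)].
Proof.
move=> mA.
have -> : [set v : 'rV[R]_n | forall j, A j (v 0 j)] =
    \bigcap_(j in [set: 'I_n]) ((fun v : 'rV[R]_n => v 0 j) @^-1` A j).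
  by apply/seteqP; split => v /= H j; [move=> _; exact: H|exact: (H j Logic.I)].
apply: fin_bigcap_measurable => // j _.
rewrite -[X in measurable X]setTI.
exact: (@measurable_mx_coord R 1 n 0 j).
Qed.

Lemma lebesgue_rV_box (R : realType) n (A : 'I_n -> set (measurableTypeR R)) :
  (forall j, measurable (A j)) ->
  lebesgue_rV R n [set v | forall j, A j (v 0 j)] =
  (\prod_(j < n) lebesgue_measure (A j))%E.
Proof.
elim: n A => [|n IH] A mA.
  by rewrite big_ord0 /= diracE mem_set// => -[].
rewrite big_ord_recl -IH; last by move=> j; exact: mA.
rewrite /= /glue_measure /pushforward.
rewrite -product_measure1E//; last exact: (measurable_rV_box (fun j => mA (lift ord0 j))).
congr (product_measure1 _ _ _); apply/seteqP; split => -[t v] /= H.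
  split; first by have := H ord0; rewrite mxE unlift_none.
  by move=> j; have := H (lift ord0 j); rewrite mxE liftK.
case: H => Ht Hv j; rewrite mxE; case: (unliftP 0 j) => [j' ->|->] //; exact: Hv.
Qed.

Section Schwartz.
Context (R : realType) (m n : nat).
Implicit Types f : 'M[R]_(m, n) -> R[i].

(* R[i] carries no normed R-module structure in the library, so that
   complex-valued functions are differentiated and integrated through their
   real and imaginary parts. *)
Definition cdifferentiable f (x : 'M[R]_(m, n)) :=
  differentiable (fun y => complex.Re (f y)) x /\
  differentiable (fun y => complex.Im (f y)) x.

Definition pderiv (ij : 'I_m * 'I_n) f : 'M[R]_(m, n) -> R[i] :=
  fun x => 'D_(delta_mx ij.1 ij.2) (fun y => complex.Re (f y)) x +i*
           'D_(delta_mx ij.1 ij.2) (fun y => complex.Im (f y)) x.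

Definition pderivs (s : seq ('I_m * 'I_n)) f := foldr pderiv f s.

Definition monomial (b : 'M[nat]_(m, n)) (x : 'M[R]_(m, n)) : R :=
  \prod_(i < m) \prod_(j < n) x i j ^+ b i j.

Definition schwartz f :=
  (forall s x, cdifferentiable (pderivs s f) x) /\
  (forall b s, exists M : R, forall x,
     `|monomial b x| * Normc.normc (pderivs s f x) <= M).

End Schwartz.

Definition cintegral d (T : measurableType d) (R : realType)
    (mu : {measure set T -> \bar R}) (f : T -> R[i]) : R[i] :=
  (\int[mu]_x complex.Re (f x)) +i* (\int[mu]_x complex.Im (f x)).

Section Fourier.
Context (R : realType) (m n : nat).
Implicit Types (f : 'M[R]_(m, n) -> R[i]) (x y xi : 'M[R]_(m, n)).

Definition expi (t : R) : R[i] := cos t +i* sin t.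

(* The library norm of a matrix is the sup norm, hence the explicit dot product
   and Euclidean norm. *)
Definition mxdot x y : R := \sum_(i < m) \sum_(j < n) x i j * y i j.

Definition fourier f xi : R[i] :=
  cintegral (lebesgue_mx R m n) (fun y => expi (2 * pi * mxdot xi y) * f y).

Definition inv_fourier f x : R[i] :=
  cintegral (lebesgue_mx R m n) (fun xi => expi (- (2 * pi * mxdot x xi)) * f xi).

End Fourier.

Definition sqr_norm2 (R : realType) (n : nat) (v : 'rV[R]_n) : R :=
  \sum_(j < n) v 0 j ^+ 2.

Section BesselOperators.
Context (R : realType) (m n : nat).
Implicit Types f : 'M[R]_(m, n) -> R[i].

(* (1 - Delta_k)^s as a Fourier multiplier, where x_k is the k-th row of x. *)
Definition bessel_op (k : 'I_m) (s : R) f : 'M[R]_(m, n) -> R[i] :=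
  inv_fourier (fun xi =>
    ((1 + 4 * pi ^+ 2 * sqr_norm2 (row k xi)) `^ s)%:C * fourier f xi).

Definition bessel_ops (alpha : 'I_m -> R) f : 'M[R]_(m, n) -> R[i] :=
  foldr (fun k => bessel_op k (alpha k / 4)) f (enum 'I_m).

Definition Lambda_star f (alpha : 'I_m -> R) : \bar R :=
  (\int[lebesgue_mx R m n]_x (Normc.normc (bessel_ops alpha f x) ^+ 2)%:E)%E.

Definition repeat_point (x : 'rV[R]_n) : 'M[R]_(m, n) := \matrix_(k, j) x 0 j.

End BesselOperators.

Definition Gamma (R : realType) (z : R) : R :=
  \int[lebesgue_measure]_(t in `]0, +oo[) (t `^ (z - 1) * expR (- t)).

(* Extended-real valued: for a <= n the integral is +oo at x = 0. *)
Definition bessel_potential (R : realType) (n : nat) (a : R) (x : 'rV[R]_n) :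
    \bar R :=
  (((4 * pi) `^ (a / 2) * Gamma (a / 2))^-1%:E *
   \int[lebesgue_measure]_(delta in `]0%R, +oo[)
     (expR (- (pi * sqr_norm2 x / delta)) * expR (- (delta / (4 * pi))) *
      delta `^ (- ((n%:R - a) / 2)) / delta)%:E)%E.

(* Main.v *)
Require Import Defs.
From mathcomp Require Import all_boot all_order all_algebra.
From mathcomp Require Import all_classical all_reals all_analysis.
From mathcomp Require Import measurable_realfun complex.
From mathcomp Require Import ring lra.
Set Implicit Arguments.
Unset Strict Implicit.
Unset Printing Implicit Defensive.
Import Order.TTheory GRing.Theory Num.Theory.
Import numFieldNormedType.Exports.
Local Open Scope classical_set_scope.
Local Open Scope ring_scope.

(** Both inequalities are forms of one Hardy-Littlewood-Sobolev inequality. Let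
    lam = mn - alpha, so that 0 < lam < n, and let K be a symmetric kernel on R^n of
    size |z|^(-lam) near 0 and |z|^(-2n) at infinity. Then the integral of
    h(x) K(x - w) h(w) is at most C |h|_p^2 as soon as 2 <= q <= 2n / lam
    (riesz_form_le). To see this, normalize |h|_p = 1 and restrict to h(w) <= h(x). At
    distances |x - w| up to rho = h(x)^(-p/n), bound h(w) by h(x); beyond, use Young's
    inequality h(w) K <= h(x)^(p-1) h(w)^p + h(x)^(-1) K^q. For this rho, integrating
    in w bounds the form at x by a multiple of h(x)^p.

    The Bessel potential is a mixture of Gaussians (bessel_potentialE), from which
    G_a(x) = O(|x|^(-mu)) for all mu >= n - a, mu > 0 (bessel_potential_le). Taking
    mu = n - alpha_k near 0 and larger exponents at infinity, the product of the
    G_(alpha_k) is dominated by a kernel K as above (prod_le_riesz), and the second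
    inequality follows (bessel_product_form_le).

    For the first one, let g be the product of the (1 - Delta_k)^(alpha_k / 4) applied
    to f, so that Lambda_star f is the integral of |g|^2, and let B be the tensor
    product of the G_(alpha_k / 2), so that f = B * g (bessel_ops_conv). With
    phi(x) = |f(x, ..., x)| and h = phi^(q-1), the integral of phi^q is at most twice
    that of |g| Psi, where Psi(y) is the integral in x of h(x) B((x, ..., x) - y)
    (trace_duality; the factor 2 comes from the treatment of complex integrals). The
    integral of Psi^2 is a quadratic form in h (integral_diag_adjoint_sqr), with kernel
    the product of the self-convolutions of the G_(alpha_k / 2). These have the same
    singularity and decay as the G_(alpha_k) (bessel_selfconv_le), so the integral of
    Psi^2 is again O(|h|_p^2). The arithmetic-geometric inequality with a well-chosen
    parameter then bounds |phi|_q^2 by a multiple of the integral of |g|^2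
    (trace_inequality).

    The identity f = B * g takes Fourier analysis, because g is defined by m successive
    Fourier multipliers, each of which ends with a Fourier inversion integral. For all
    exponents t_k, the function with Fourier transform the product of the
    (1 + 4 pi^2 |xi_k|^2)^(t_k) times that of f exists as an integrable bounded function,
    continuous along rays: apply an integer power r > t_k of each 1 - Delta_k to f and
    convolve the result, a Schwartz function, with Bessel kernels of orders 2 (r - t_k)
    (has_symbol_exists). Its Fourier transform is integrable, so Fourier inversion
    recovers it at every point (fourier_inversion), and each multiplier maps one of these
    functions to another (bessel_op_has_symbol). Finally f and B * g have the same
    Fourier transform, hence are equal by inversion again. *)

(** * Integration over spaces of matrices *)

Section Products.
Context {R : realType}.

Lemma emeasurable_prod d (T : measurableType d) D (I : Type) (s : seq I)
    (h : I -> T -> \bar R) :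
  (forall i, measurable_fun D (h i)) ->
  measurable_fun D (fun x => \prod_(i <- s) h i x)%E.
Proof.
move=> mh; elim: s => [|x y ih].
  by under eq_fun do rewrite big_nil; exact: measurable_cst.
by under eq_fun do rewrite big_cons; exact: emeasurable_funM.
Qed.

Lemma prod_cst_mx m n (c : R) : (\prod_(i < m) \prod_(j < n) c = c ^+ (m * n))%R.
Proof. by rewrite big_const big_const !card_ord !iter_mulr_1 -exprM mulnC. Qed.

End Products.

Section Affine1.
Context {R : realType}.
Local Open Scope ereal_scope.
Notation mu := (@lebesgue_measure R).

Lemma measurable_affine1 (c v : R) :
  measurable_fun setT (fun t : measurableTypeR R => (c * t + v)%R : measurableTypeR R).
Proof. by apply: measurable_funD => //; apply: measurable_funM. Qed.

(* The image of the Lebesgue measure under t |-> c t + v; the measurability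
   proof has to be given explicitly for the measure structure to be found. *)
Let affine_image (c v : R) : {measure set (measurableTypeR R) -> \bar R} :=
  measure_function_pushforward__canonical__measure_function_Measure
    mu (measurable_affine1 c v).

Let scaled_affine_image (c v : R) (A : set R) : c != 0%R -> measurable A ->
  mu A = mscale (NngNum (normr_ge0 c)) (affine_image c v) A.
Proof.
move=> c0 mA; apply: (lebesgue_measure_unique _ mA) => _ [[a b] /= _ <-].
rewrite /mscale /= /pushforward lebesgue_measure_itv /= lte_fin.
have [cp|cn] := ltP 0%R c.
  have -> : (fun t : R => (c * t + v)%R) @^-1` `]a, b] =
      `]((a - v) / c)%R, ((b - v) / c)%R]%classic.
    apply/seteqP; split => t /=; rewrite !in_itv/= ltr_pdivrMr// ler_pdivlMr//;
      by rewrite ltrBlDr lerBrDr [(t * c)%R]mulrC.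
  rewrite lebesgue_measure_itv/= lte_fin ltr_pM2r ?invr_gt0// ltrD2r.
  case: ifPn => ab; last by rewrite mule0.
  rewrite -!EFinD -EFinM; congr EFin.
  by rewrite gtr0_norm//; field.
have {}cn : (c < 0)%R by rewrite lt_neqAle c0.
have -> : (fun t : R => (c * t + v)%R) @^-1` `]a, b] =
      `[((b - v) / c)%R, ((a - v) / c)%R[%classic.
  apply/seteqP; split => t /=; rewrite !in_itv/= ltr_ndivlMr// ler_ndivrMr//;
    by rewrite andbC ltrBlDr lerBrDr [(t * c)%R]mulrC.
rewrite lebesgue_measure_itv/= lte_fin ltr_nM2r ?invr_lt0// ltrD2r.
case: ifPn => ab; last by rewrite mule0.
rewrite -!EFinD -EFinM; congr EFin.
by rewrite ltr0_norm//; field.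
Qed.

(** Up to the factor |c|, the image of the Lebesgue measure under t |-> c t + v
    gives intervals their length, and this determines a measure on the line. *)
Lemma ge0_integral_affine1 (c v : R) (f : measurableTypeR R -> \bar R) :
  c != 0%R -> measurable_fun setT f -> (forall x, 0 <= f x) ->
  \int[mu]_x f x = `|c|%:E * \int[mu]_x f (c * x + v)%R.
Proof.
move=> c0 mf f0.
rewrite (eq_measure_integral (mscale (NngNum (normr_ge0 c)) (affine_image c v)));
  last by move=> A mA _; exact: scaled_affine_image.
rewrite ge0_integral_mscale// (ge0_integral_pushforward (measurable_affine1 c v))//.
Qed.

End Affine1.

Section Glue.
Context (R : realType) (m n : nat).
Context d1 d2 (T1 : measurableType d1) (T2 : measurableType d2).
Variables (mu1 : {sigma_finite_measure set T1 -> \bar R})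
          (mu2 : {sigma_finite_measure set T2 -> \bar R}).
Variables (glue : T1 * T2 -> 'M[R]_(m, n)) (split : 'M[R]_(m, n) -> T1 * T2).
Hypotheses (mglue : measurable_fun [set: T1 * T2] glue)
           (msplit : measurable_fun [set: 'M[R]_(m, n)] split)
           (glueK : cancel glue split).
Local Open Scope ereal_scope.

(** The glued measures are images of product measures, so Tonelli's theorem turns
    one more coordinate (or row) into one more iterated integral. *)
Lemma ge0_integral_glue (f : 'M[R]_(m, n) -> \bar R) :
  measurable_fun setT f -> (forall x, 0 <= f x) ->
  \int[glue_measure mu1 mu2 mglue msplit glueK]_x f x =
  \int[mu1]_x \int[mu2]_y f (glue (x, y)).
Proof.
move=> mf f0.
rewrite (eq_measure_integral (measure_function_pushforward__canonical__measure_function_Measure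
  (mu1 \x mu2) mglue)); last by [].
rewrite (ge0_integral_pushforward mglue)// preimage_setT.
rewrite fubini_tonelli1; [by []|exact: measurableT_comp mf mglue|by move=> x /=].
Qed.

End Glue.

Section Lebesgue_rV_mx.
Context {R : realType}.
Local Open Scope ereal_scope.
Implicit Types m n : nat.

Lemma ge0_integral_rVS n (f : 'rV[R]_n.+1 -> \bar R) :
  measurable_fun setT f -> (forall x, 0 <= f x) ->
  \int[lebesgue_rV R n.+1]_x f x =
  \int[lebesgue_measure]_t \int[lebesgue_rV R n]_v f (rV_cons (t, v)).
Proof. by move=> mf f0; rewrite [LHS]ge0_integral_glue. Qed.

Lemma ge0_integral_mxS m n (f : 'M[R]_(m.+1, n) -> \bar R) :
  measurable_fun setT f -> (forall x, 0 <= f x) ->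
  \int[lebesgue_mx R m.+1 n]_x f x =
  \int[lebesgue_rV R n]_t \int[lebesgue_mx R m n]_v f (mx_cons (t, v)).
Proof. by move=> mf f0; rewrite [LHS]ge0_integral_glue. Qed.

Lemma integral_rV0 (f : 'rV[R]_0 -> \bar R) :
  \int[lebesgue_rV R 0]_x f x = f 0%R.
Proof.
have mf : measurable_fun setT f.
  by rewrite (_ : f = cst (f 0%R)) //; apply/funext => x; rewrite (thinmx0 x).
by rewrite /= integral_dirac// diracT mul1e.
Qed.

Lemma integral_mx0 n (f : 'M[R]_(0, n) -> \bar R) :
  \int[lebesgue_mx R 0 n]_x f x = f 0%R.
Proof.
have mf : measurable_fun setT f.
  by rewrite (_ : f = cst (f 0%R)) //; apply/funext => x; rewrite (flatmx0 x).
by rewrite /= integral_dirac// diracT mul1e.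
Qed.

Lemma measurable_affine_mx m n (c : R) (v : 'M[R]_(m, n)) :
  measurable_fun setT (fun x : 'M[R]_(m, n) => c *: x + v)%R.
Proof.
apply: measurable_fun_mx => i j; under eq_fun do rewrite !mxE.
apply: (measurable_funD _ (measurable_cst _)) => //.
apply: measurable_funM => //; exact: measurable_mx_coord.
Qed.

Lemma measurable_funB_mx m n d (T : measurableType d) (f g : T -> 'M[R]_(m, n)) :
  measurable_fun setT f -> measurable_fun setT g ->
  measurable_fun setT (fun z => f z - g z)%R.
Proof.
move=> mf mg; apply: measurable_fun_mx => i j; under eq_fun do rewrite !mxE.
by apply: measurable_funB; exact: (measurableT_comp (measurable_mx_coord _ _)).
Qed.

Lemma measurable_row m n (i : 'I_m) : measurable_fun setT (@row R m n i).
Proof.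
apply: measurable_fun_mx => i' j; under eq_fun do rewrite mxE.
exact: measurable_mx_coord.
Qed.

Lemma rV_cons_affine n (c : R) (v : 'rV[R]_n.+1) t (x : 'rV[R]_n) :
  (c *: rV_cons (t, x) + v = rV_cons (c * t + (rV_uncons v).1, c *: x + (rV_uncons v).2))%R.
Proof.
apply/rowP => j; rewrite !mxE /=; case: (unliftP ord0 j) => [j' ->|->].
  by rewrite !mxE.
by [].
Qed.

Lemma mx_cons_affine m n (c : R) (v : 'M[R]_(m.+1, n)) t (x : 'M[R]_(m, n)) :
  (c *: mx_cons (t, x) + v = mx_cons (c *: t + (mx_uncons v).1, c *: x + (mx_uncons v).2))%R.
Proof.
apply/matrixP => i j; rewrite !mxE /=; case: (unliftP ord0 i) => [i' ->|->].
  by rewrite !mxE.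
by [].
Qed.

Lemma ge0_integral_affine_rV n (c : R) (v : 'rV[R]_n) (f : 'rV[R]_n -> \bar R) :
  c != 0%R -> measurable_fun setT f -> (forall x, 0 <= f x) ->
  \int[lebesgue_rV R n]_x f x =
  (`|c| ^+ n)%:E * \int[lebesgue_rV R n]_x f (c *: x + v)%R.
Proof.
move=> c0; elim: n v f => [|n IH] v f mf f0.
  by rewrite !integral_rV0 expr0 mul1e; congr f; rewrite [RHS]thinmx0.
have mfc : measurable_fun setT (f \o @rV_cons R n).
  exact: measurableT_comp mf (@measurable_rV_cons R n).
have mg : measurable_fun setT (fun x : 'M[R]_(_, _) => f (c *: x + v)%R).
  exact: measurableT_comp mf (@measurable_affine_mx _ _ c v).
rewrite !ge0_integral_rVS//.
rewrite (ge0_integral_affine1 (rV_uncons v).1 c0); last 2 first.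
- by apply: (measurable_fun_fubini_tonelli_F _ mfc) => x; exact: f0.
- by move=> x; apply: integral_ge0.
rewrite exprS EFinM -muleA; congr (_ * _).
under eq_integral => t _.
  rewrite (IH (rV_uncons v).2); [|exact: measurableT_comp mfc _|by []].
  under [X in _ * X]eq_integral do rewrite -rV_cons_affine.
  over.
rewrite /= ge0_integralZl ?lee_fin ?exprn_ge0//.
- by apply: (measurable_fun_fubini_tonelli_F _ 
    (measurableT_comp mg (@measurable_rV_cons R n))) => x; exact: f0.
- by move=> *; apply: integral_ge0.
Qed.

(** Translation, reflection and dilation of the variable are all instances; the
    proof changes one row at a time. *)
Lemma ge0_integral_affine_mx m n (c : R) (v : 'M[R]_(m, n)) (f : 'M[R]_(m, n) -> \bar R) :
  c != 0%R -> measurable_fun setT f -> (forall x, 0 <= f x) ->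
  \int[lebesgue_mx R m n]_x f x =
  (`|c| ^+ (m * n)%N)%:E * \int[lebesgue_mx R m n]_x f (c *: x + v)%R.
Proof.
move=> c0; elim: m v f => [|m IH] v f mf f0.
  by rewrite !integral_mx0 expr0 mul1e; congr f; rewrite [RHS]flatmx0.
have mfc : measurable_fun setT (f \o @mx_cons R m n).
  exact: measurableT_comp mf (@measurable_mx_cons R m n).
have mg : measurable_fun setT (fun x : 'M[R]_(_, _) => f (c *: x + v)%R).
  exact: measurableT_comp mf (@measurable_affine_mx _ _ c v).
rewrite !ge0_integral_mxS//.
rewrite (ge0_integral_affine_rV (mx_uncons v).1 c0); last 2 first.
- by apply: (measurable_fun_fubini_tonelli_F _ mfc) => x; exact: f0.
- by move=> x; apply: integral_ge0.
rewrite mulSn exprD EFinM -muleA; congr (_ * _).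
under eq_integral => t _.
  rewrite (IH (mx_uncons v).2); [|exact: measurableT_comp mfc _|by []].
  under [X in _ * X]eq_integral do rewrite -mx_cons_affine.
  over.
rewrite /= ge0_integralZl ?lee_fin ?exprn_ge0//.
- by apply: (measurable_fun_fubini_tonelli_F _ 
    (measurableT_comp mg (@measurable_mx_cons R m n))) => x; exact: f0.
- by move=> *; apply: integral_ge0.
Qed.

Lemma ge0_integral_prod_rV n (F : 'I_n -> measurableTypeR R -> \bar R) :
  (forall j, measurable_fun setT (F j)) -> (forall j x, 0 <= F j x) ->
  \int[lebesgue_rV R n]_x (\prod_(j < n) F j (x 0%R j)) =
  \prod_(j < n) \int[lebesgue_measure]_t F j t.
Proof.
elim: n F => [|n IH] F mF F0; first by rewrite integral_rV0 !big_ord0.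
have mP k (G : 'I_k -> measurableTypeR R -> \bar R) : (forall j, measurable_fun setT (G j)) ->
   measurable_fun setT (fun x : 'rV[R]_k => \prod_(j < k) G j (x 0%R j)).
  move=> mG; apply: emeasurable_prod => j.
  exact: measurableT_comp (mG j) (measurable_mx_coord _ _).
rewrite ge0_integral_rVS; [|exact: mP|by move=> x; apply: prode_ge0 => *].
have P0 : 0 <= \prod_(j < n) \int[lebesgue_measure]_t F (lift ord0 j) t.
  by apply: prode_ge0 => j _; apply: integral_ge0.
rewrite big_ord_recl -ge0_integralZr//.
apply: eq_integral => t _.
rewrite -IH// -ge0_integralZl//; last 2 first.
- by apply: (mP n (fun j => F (lift ord0 j))) => j; exact: mF.
- by move=> *; apply: prode_ge0.
apply: eq_integral => x _; rewrite big_ord_recl mxE unlift_none; congr (_ * _).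
by apply: eq_bigr => j _; rewrite mxE liftK.
Qed.

Lemma ge0_integral_prod_mx m n (F : 'I_m -> 'rV[R]_n -> \bar R) :
  (forall i, measurable_fun setT (F i)) -> (forall i x, 0 <= F i x) ->
  \int[lebesgue_mx R m n]_x (\prod_(i < m) F i (row i x)) =
  \prod_(i < m) \int[lebesgue_rV R n]_t F i t.
Proof.
elim: m F => [|m IH] F mF F0; first by rewrite integral_mx0 !big_ord0.
have mP k (G : 'I_k -> 'rV[R]_n -> \bar R) : (forall j, measurable_fun setT (G j)) ->
   measurable_fun setT (fun x : 'M[R]_(k, n) => \prod_(j < k) G j (row j x)).
  move=> mG; apply: emeasurable_prod => j.
  exact: measurableT_comp (mG j) (measurable_row _).
rewrite ge0_integral_mxS; [|exact: mP|by move=> x; apply: prode_ge0 => *].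
have P0 : 0 <= \prod_(j < m) \int[lebesgue_rV R n]_t F (lift ord0 j) t.
  by apply: prode_ge0 => j _; apply: integral_ge0.
rewrite big_ord_recl -ge0_integralZr//.
apply: eq_integral => t _.
rewrite -IH// -ge0_integralZl//; last 2 first.
- by apply: (mP m (fun j => F (lift ord0 j))) => j; exact: mF.
- by move=> *; apply: prode_ge0.
apply: eq_integral => x _; rewrite big_ord_recl; congr (_ * _).
  by congr (F _ _); apply/rowP => j; rewrite !mxE unlift_none.
by apply: eq_bigr => j _; congr (F _ _); apply/rowP => k; rewrite !mxE liftK.
Qed.

End Lebesgue_rV_mx.

(** * Power and exponential estimates on the half-line *)

Section Calculus.
Context {R : realType}.
Implicit Types (a b c d e s t x A : R).
Notation mu := (@lebesgue_measure R).

Lemma powRD_gt0 x a b : 0 < x -> x `^ (a + b) = x `^ a * x `^ b.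
Proof. by move=> x0; rewrite powRD// (gt_eqF x0) implybT. Qed.

Lemma ler_powRN x y a : 0 <= a -> 0 < x -> x <= y -> y `^ (- a) <= x `^ (- a).
Proof.
move=> a0 x0 xy; have y0 := lt_le_trans x0 xy.
rewrite !powRN lef_pV2 ?posrE ?powR_gt0//.
by rewrite ge0_ler_powR// nnegrE ltW.
Qed.

Lemma continuous_powR_gt0 a x : 0 < x -> {for x, continuous (fun u : R => u `^ a)}.
Proof.
move=> x0; apply/differentiable_continuous/derivable1_diffP.
by apply: derivable_powR; rewrite in_itv/= x0.
Qed.

Lemma itv0y_bigcup :
  `]0, +oo[%classic = \bigcup_k `[(k.+1%:R)^-1, k.+2%:R]%classic :> set R.
Proof.
apply/seteqP; split => x /=; rewrite in_itv/= andbT.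
  move=> x0.
  exists (maxn (Num.truncn x^-1) (Num.truncn x)) => //=; rewrite in_itv/=.
  apply/andP; split.
    rewrite -[leRHS]invrK lef_pV2 ?posrE ?invr_gt0//.
    by apply: ltW; apply: lt_le_trans (truncnS_gt _) _; rewrite ler_nat ltnS leq_maxl.
  apply: ltW; apply: lt_le_trans (truncnS_gt _) _; rewrite ler_nat ltnS.
  exact: leq_trans (leq_maxr _ _) (leqnSn _).
by move=> [k _]/=; rewrite in_itv/= => /andP[+ _]; apply: lt_le_trans; rewrite invr_gt0.
Qed.

(** The integral over (0, +oo) is the increasing limit of the integrals over
    [1/(k+1), k+2], and each of these is at most an increment of F. *)
Lemma le_integral_bounded_antiderivative (f g F : R -> R) a b :
  measurable_fun (`]0, +oo[ : set R) f ->
  (forall x, 0 < x -> 0 <= f x <= g x) ->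
  (forall x, 0 < x -> {for x, continuous g}) ->
  (forall x, 0 < x -> is_derive x 1 F (g x)) ->
  (forall x, 0 < x -> a <= F x <= b) ->
  (\int[mu]_(x in `]0%R, +oo[) (f x)%:E <= (b - a)%:E)%E.
Proof.
move=> mf fg cg dF Fab.
pose J k : set R := `[(k.+1%:R)^-1, k.+2%:R]%classic.
have sub k : J k `<=` `]0, +oo[%classic.
  by move=> x; rewrite itv0y_bigcup => ?; exists k.
have mfk k : measurable_fun (J k) (EFin \o f).
  by apply/measurable_EFinP; apply: measurable_funS mf.
have ndF : {homo J : n m / (n <= m)%N >-> (n <= m)%O}.
  move=> k l kl; apply/subsetPset => x /=; rewrite /J /= !in_itv/= => /andP[h1 h2].
  apply/andP; split; [apply: le_trans h1|apply: (le_trans h2)].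
    by rewrite lef_pV2 ?posrE// ler_nat ltnS.
  by rewrite ler_nat !ltnS.
have pos k x : J k x -> 0 < x.
  by move=> /sub; rewrite /= in_itv/= andbT.
rewrite itv0y_bigcup -/J.
have cvJ : (\int[mu]_(x in J k) (f x)%:E)%E @[k --> \oo] -->
    (\int[mu]_(x in \bigcup_k J k) (f x)%:E)%E.
  apply: ge0_nondecreasing_set_cvg_integral => //.
  + by move=> k; exact: measurable_itv.
  + by move=> i x h; rewrite lee_fin (andP (fg x (pos i x h))).1.
rewrite -(cvg_lim _ cvJ)//.
apply: lime_le.
  apply: ereal_nondecreasing_is_cvgn.
  apply: ge0_nondecreasing_set_nondecreasing_integral => //.
    by move=> i; exact: measurable_itv.
  by move=> i x h; rewrite lee_fin (andP (fg x (pos i x h))).1.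
apply: nearW => k.
have kk : (k.+1%:R)^-1 < k.+2%:R :> R.
  by apply: (@le_lt_trans _ _ 1); rewrite ?invf_le1 ?ler1n ?ltr1n.
have cgk : {within J k, continuous g}.
  apply: continuous_in_subspaceT => x; rewrite inE => /pos; exact: cg.
apply: (@le_trans _ _ (\int[mu]_(x in J k) (g x)%:E)%E).
  apply: ge0_le_integral => //.
  - exact: measurable_itv.
  - by move=> x /pos x0; rewrite lee_fin (andP (fg x x0)).1.
  - exact: mfk.
  - apply/measurable_EFinP.
    by apply: subspace_continuous_measurable_fun => //; exact: measurable_itv.
  - by move=> x /pos x0; rewrite lee_fin (andP (fg x x0)).2.
have i0 : 0 < (k.+1%:R)^-1 :> R by rewrite invr_gt0.
have cF x : 0 < x -> {for x, continuous F}.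
  move=> x0; apply/differentiable_continuous/derivable1_diffP.
  by have := dF _ x0; case.
rewrite (@continuous_FTC2 _ g F)//.
- rewrite -EFinB lee_fin; apply: lerB.
    by have /andP[] := Fab _ (lt_trans i0 kk).
  by have /andP[] := Fab _ i0.
- split.
  + move=> x; rewrite in_itv/= => /andP[h _].
    by have := dF _ (lt_trans i0 h); case.
  + apply: cvg_at_right_filter; exact: cF.
  + apply: cvg_at_left_filter; apply: cF; exact: lt_trans kk.
- move=> x; rewrite in_itv/= => /andP[h _]; rewrite derive1E.
  by have := dF _ (lt_trans i0 h); case.
Qed.

Lemma is_derive_powR_shift c A s : 0 < A + s ->
  is_derive s 1 (fun u => (A + u) `^ c) (c * (A + s) `^ (c - 1)).
Proof.
move=> h.
have dg : is_derive s 1 (fun u : R => A + u) 1.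
  by apply: is_derive_eq; rewrite add0r mulr1.
by have := is_derive1_comp (is_derive1_powR c h) dg; rewrite mulr1.
Qed.

Lemma measurable_beta_integrand c d A :
  measurable_fun setT (fun s : measurableTypeR R => s `^ c * (A + s) `^ d).
Proof.
apply: measurable_funM; first exact: measurable_powR.
by apply: (measurableT_comp (measurable_powR _)); exact: measurable_funD.
Qed.

(** A beta integral with its scaling in A; the bound comes from an explicit bounded
    antiderivative F of a majorant g. With e = d - c, the two summands of F take
    values of size at most A^(-e) and account respectively for s <= A, where the
    integrand is comparable to A^(1-e) s^(c-1) (A+s)^(-c-1), and for s > A, where it
    is comparable to (A+s)^(-e-1). *)
Lemma integral_beta_le c d A : 0 < c -> c < d -> 0 < A ->
  (\int[mu]_(s in `]0%R, +oo[) (s `^ (c - 1) * (A + s) `^ (- d))%:E <=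
   (2 * (c^-1 + (d - c)^-1) * A `^ (c - d))%:E)%E.
Proof.
move=> c0 cd A0.
set e := d - c; have e0 : 0 < e by rewrite subr_gt0.
have -> : c - d = - e by rewrite opprB.
have de : - d = - e - c by rewrite /e; ring.
have As s : 0 < s -> 0 < A + s by move=> s0; rewrite addr_gt0.
pose F s := 2 * c^-1 * A `^ (- e) * (s `^ c * (A + s) `^ (- c)) -
            2 * e^-1 * (A + s) `^ (- e).
pose g s := 2 * A `^ (1 - e) * (s `^ (c - 1) * (A + s) `^ (- c - 1)) +
            2 * (A + s) `^ (- e - 1).
have -> : 2 * (c^-1 + e^-1) * A `^ (- e) =
    2 * c^-1 * A `^ (- e) - (- (2 * e^-1 * A `^ (- e))) by ring.
apply: (@le_integral_bounded_antiderivative _ g F).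
- by apply: measurable_funTS; exact: measurable_beta_integrand.
- move=> s s0; have Ass := As _ s0; rewrite mulr_ge0 ?powR_ge0//=.
  have A1 := @powRD_gt0 (A + s) (- c) (1 - e) Ass.
  have [sA|sA] := leP s A.
    have h : (A + s) `^ (1 - e) <= 2 * A `^ (1 - e).
      have [e1|e1] := leP e 1.
        apply: (@le_trans _ _ ((2 * A) `^ (1 - e))).
          apply: ge0_ler_powR; rewrite ?nnegrE ?subr_ge0 ?mulr_ge0 ?(ltW Ass) ?(ltW A0)//.
          by lra.
        rewrite powRM ?(ltW A0)//.
        apply: ler_wpM2r; rewrite ?powR_ge0//.
        apply: ler1_powR => //; first by rewrite ler1n.
        by lra.
      have -> : 1 - e = - (e - 1) by ring.
      have := @ler_powRN A (A + s) (e - 1).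
      rewrite subr_ge0 (ltW e1) => /(_ isT A0).
      rewrite lerDl ltW// => /(_ isT) /le_trans; apply.
      by rewrite ler_peMl ?powR_ge0// ler1n.
    apply: (@le_trans _ _ (2 * A `^ (1 - e) * (s `^ (c - 1) * (A + s) `^ (- c - 1)))); last first.
      by rewrite lerDl mulr_ge0 ?powR_ge0.
    have -> : - d = (1 - e) + (- c - 1) by rewrite de; ring.
    rewrite (powRD_gt0 (1 - e) (- c - 1) Ass) mulrCA; apply: ler_wpM2r => //.
    by rewrite mulr_ge0 ?powR_ge0.
  apply: (@le_trans _ _ (2 * (A + s) `^ (- e - 1))); last first.
    by rewrite lerDr !mulr_ge0 ?powR_ge0.
  rewrite (_ : - d = (- c + 1) + (- e - 1)); last by rewrite de; ring.
  rewrite (powRD_gt0 (- c + 1) (- e - 1) Ass) mulrA.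
  apply: ler_wpM2r; rewrite ?powR_ge0//.
  have -> : s `^ (c - 1) * (A + s) `^ (- c + 1) = (s `^ c * (A + s) `^ (- c)) * ((A + s) / s).
    rewrite powRD_gt0// [X in _ * X]powRD_gt0// powRr1 ?ltW// powR_inv1 ?ltW//.
    by ring.
  rewrite -[leRHS]mul1r; apply: ler_pM.
  - by rewrite mulr_ge0 ?powR_ge0.
  - by rewrite divr_ge0// ltW.
  - rewrite powRN ler_pdivrMr ?powR_gt0// mul1r ge0_ler_powR ?nnegrE ?ltW//.
    by rewrite ltrDr.
  - by rewrite ler_pdivrMr//; lra.
- move=> s s0.
  have cA a : {for s, continuous (fun u => (A + u) `^ a)}.
    apply/differentiable_continuous/derivable1_diffP.
    by have := is_derive_powR_shift a (As _ s0); case.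
  apply: (@continuousD _ R^o R^o).
    apply: continuousM; first exact: cst_continuous.
    by apply: continuousM; [exact: continuous_powR_gt0|exact: cA].
  by apply: continuousM; [exact: cst_continuous|exact: cA].
- move=> s s0; rewrite /F.
  have h1 := is_derive1_powR c s0.
  have h2 := is_derive_powR_shift (- c) (As _ s0).
  have h3 := is_derive_powR_shift (- e) (As _ s0).
  apply: is_derive_eq.
  rewrite /GRing.scale /=.
  have E : (A + s) `^ (- c) = (A + s) * (A + s) `^ (- c - 1).
    by rewrite powRD_gt0 ?As// powR_inv1 ?ltW ?As// mulrCA divff ?mulr1// gt_eqF// As.
  have E2 : s `^ c = s * s `^ (c - 1).
    by rewrite powRD_gt0// powR_inv1 ?ltW// mulrCA divff ?mulr1// gt_eqF.
  have E3 : A `^ (1 - e) = A * A `^ (- e).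
    by rewrite powRD_gt0// powRr1// ltW.
  rewrite /g E E2 E3; field.
  by rewrite !gt_eqF.
- move=> s s0; have Ass := As _ s0.
  have B1 : 0 <= s `^ c * (A + s) `^ (- c) <= 1.
    rewrite mulr_ge0 ?powR_ge0//= powRN ler_pdivrMr ?powR_gt0// mul1r.
    by rewrite ge0_ler_powR ?nnegrE ?ltW// ltrDr.
  have B2 : 0 <= (A + s) `^ (- e) <= A `^ (- e).
    by rewrite powR_ge0/= ler_powRN ?ltW// ltrDl.
  have Ae := powR_ge0 A (- e).
  have c1 : 0 < c^-1 by rewrite invr_gt0.
  have e1 : 0 < e^-1 by rewrite invr_gt0.
  have P1 : 0 <= c^-1 * A `^ (- e) by rewrite mulr_ge0// ltW.
  have P2 : c^-1 * A `^ (- e) * (s `^ c * (A + s) `^ (- c)) <= c^-1 * A `^ (- e).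
    by rewrite ler_piMr//; case/andP : B1.
  have P3 : 0 <= c^-1 * A `^ (- e) * (s `^ c * (A + s) `^ (- c)).
    by rewrite mulr_ge0//; case/andP : B1.
  have P4 : e^-1 * (A + s) `^ (- e) <= e^-1 * A `^ (- e).
    by rewrite ler_pM2l//; case/andP : B2.
  have P5 : 0 <= e^-1 * (A + s) `^ (- e).
    by rewrite mulr_ge0 ?powR_ge0// ltW.
  by rewrite /F; apply/andP; split; lra.
Qed.

(** Taking logarithms, this is ln u <= u - 1 at u = (1 + s) / M. *)
Lemma expRN_le_powR (M : R) : 0 <= M ->
  exists2 C : R, 0 < C & forall s, 0 <= s -> expR (- s) <= C * (1 + s) `^ (- M).
Proof.
rewrite le_eqVlt => /predU1P[<-|M0].
  by exists 1 => // s s0; rewrite oppr0 powRr0 mulr1 -expR0 ler_expR oppr_le0.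
exists (expR (1 + M * ln M)); first exact: expR_gt0.
move=> s s0; have s1 : 0 < 1 + s by rewrite ltr_pwDl.
rewrite /powR gt_eqF// -expRD ler_expR.
have : ln ((1 + s) / M) <= (1 + s) / M - 1.
  have := @le_ln1Dx _ ((1 + s) / M - 1); rewrite addrCA subrr addr0; apply.
  by rewrite ltrBDr addNr divr_gt0.
rewrite ln_div ?posrE// -(ler_pM2l M0) mulrBr mulrBr mulrCA divff ?gt_eqF// !mulr1.
by lra.
Qed.

Lemma ge0_integral_even (f : measurableTypeR R -> \bar R) :
  measurable_fun setT f -> (forall x, 0 <= f x)%E -> (forall x, f (- x) = f x) ->
  (\int[mu]_x f x = \int[mu]_(x in `]0%R, +oo[) f x + \int[mu]_(x in `]0%R, +oo[) f x)%E.
Proof.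
move=> mf f0 ef.
rewrite -(set_itvNyy R) (@itv_bndbnd_setU _ _ _ (BLeft 0))//.
rewrite ge0_integral_setU//=; last 2 first.
- by move: mf; apply: measurable_funS.
- apply/disj_set2P; rewrite -subset0 => x [/=]; rewrite !in_itv/= andbT => h1 h2.
  by move: h1; rewrite ltNge h2.
rewrite addeC; congr (_ + _)%E.
  by rewrite integral_itv_obnd_cbnd//; exact: measurable_funTS.
rewrite integral_itv_obnd_cbnd; last exact: measurable_funTS.
rewrite ge0_integration_by_substitution0//.
under [RHS]eq_integral do rewrite ef.
by rewrite integral_itv_bndo_bndc//; exact: measurable_funTS.
Qed.

End Calculus.

(** * The Euclidean norm and one-dimensional kernels *)

Section Indicators.
Context {R : realType}.

Lemma measurable_fun_bool2R d (T : measurableType d) (b : T -> bool) :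
  measurable_fun setT b -> measurable_fun setT (fun x => (b x)%:R : R).
Proof.
move=> mb; rewrite (_ : (fun x => _) = (fun x => if b x then 1 else 0)).
  by apply: measurable_fun_ifT.
by apply/funext => x; case: (b x).
Qed.

(** A finite conjunction is detected by the product of the indicators. *)
Lemma measurable_fun_forall_ord n d (T : measurableType d) (b : 'I_n -> T -> bool) :
  (forall j, measurable_fun setT (b j)) ->
  measurable_fun setT (fun x => [forall j, b j x]).
Proof.
move=> mb.
rewrite (_ : (fun x => _) = (fun x => \prod_(j < n) ((b j x)%:R : R) == 1)).
  apply: measurable_fun_eqr => //; apply: measurable_prod => j _.
  exact: measurable_fun_bool2R.
apply/funext => x; apply/forallP/eqP => [H|H j].
  by rewrite big1// => j _; rewrite H.
apply: contra_eqT H => /negPf bj; rewrite (bigD1 j)//= bj mul0r eq_sym.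
exact: oner_neq0.
Qed.

End Indicators.

Section EuclideanNorm.
Context {R : realType} {n : nat}.
Implicit Types x : 'rV[R]_n.

Definition enorm x : R := Num.sqrt (sqr_norm2 x).

Lemma sqr_norm2_ge0 x : 0 <= sqr_norm2 x.
Proof. by apply: sumr_ge0 => j _; exact: sqr_ge0. Qed.

Lemma enorm_ge0 x : 0 <= enorm x. Proof. exact: sqrtr_ge0. Qed.

Lemma sqr_enorm x : enorm x ^+ 2 = sqr_norm2 x.
Proof. by rewrite sqr_sqrtr// sqr_norm2_ge0. Qed.

Lemma coord_le_enorm x j : `|x 0 j| <= enorm x.
Proof.
rewrite -(@ler_pXn2r _ 2)// ?nnegrE ?enorm_ge0// sqr_enorm real_normK ?num_real//.
by rewrite /sqr_norm2 (bigD1 j)//= lerDl; apply: sumr_ge0 => i _; exact: sqr_ge0.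
Qed.

Lemma enorm_eq0 x : (enorm x == 0) = (x == 0).
Proof.
apply/eqP/eqP => [x0|->].
  apply/rowP => j; rewrite mxE; apply/eqP.
  by rewrite -normr_le0 -x0 coord_le_enorm.
by rewrite /enorm /sqr_norm2 big1 ?sqrtr0// => j _; rewrite mxE expr0n.
Qed.

Lemma enorm_gt0 x : x != 0 -> 0 < enorm x.
Proof. by move=> x0; rewrite lt_neqAle eq_sym enorm_eq0 x0 enorm_ge0. Qed.

Lemma enormN x : enorm (- x) = enorm x.
Proof.
by congr Num.sqrt; apply: eq_bigr => j _; rewrite mxE sqrrN.
Qed.

Lemma measurable_sqr_norm2 : measurable_fun setT (@sqr_norm2 R n).
Proof.
apply: measurable_sum => j; apply: measurable_funX; exact: measurable_mx_coord.
Qed.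

Lemma measurable_enorm : measurable_fun setT enorm.
Proof.
rewrite /enorm (_ : (fun x => _) = (fun x => sqr_norm2 x `^ 2^-1)).
  exact: (measurableT_comp (measurable_powR _) measurable_sqr_norm2).
by apply/funext => x; rewrite powR12_sqrt// sqr_norm2_ge0.
Qed.

Lemma measurable_eq0_rV : measurable_fun setT (fun x : 'rV[R]_n => x == 0).
Proof.
rewrite (_ : (fun x => _) = (fun x => enorm x == 0)).
  by apply: measurable_fun_eqr => //; exact: measurable_enorm.
by apply/funext => x; rewrite enorm_eq0.
Qed.

End EuclideanNorm.

Section OneDim.
Context {R : realType}.
Notation mu := (@lebesgue_measure R).

(** One-dimensional model of the Riesz-type kernel: of size |t|^(-b) near 0 and
    |t|^(-2) at infinity. A product of n copies with b = lam / n dominates the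
    n-dimensional kernel, which reduces every integral below to dimension one. *)
Definition riesz1 (b t : R) : \bar R :=
  if t == 0 then +oo%E else (`|t| `^ (- b) * (1 + `|t|) `^ (- (2 - b)))%:E.

Lemma riesz1_gt0 b t : (0 < riesz1 b t)%E.
Proof.
rewrite /riesz1; case: eqVneq => // t0.
by rewrite lte_fin mulr_gt0// powR_gt0 ?normr_gt0// ltr_pwDl.
Qed.

Lemma measurable_riesz1 b : measurable_fun setT (riesz1 b : measurableTypeR R -> \bar R).
Proof.
apply: measurable_fun_ifT.
- exact: measurable_fun_eqr.
- exact: measurable_cst.
- apply/measurable_EFinP; apply: measurable_funM.
    exact: (measurableT_comp (measurable_powR _)).
  apply: (measurableT_comp (measurable_powR _)).
  by apply: measurable_funD => //; exact: measurableT_comp.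
Qed.

Lemma integral_even_le (f : measurableTypeR R -> \bar R) (g : R -> R) (C : R) :
  measurable_fun setT f -> (forall x, 0 <= f x)%E -> (forall x, f (- x) = f x) ->
  (forall t, 0 < t -> (f t <= (g t)%:E)%E) ->
  measurable_fun setT g ->
  (\int[mu]_(s in `]0%R, +oo[) (g s)%:E <= C%:E)%E ->
  (\int[mu]_x f x <= (C *+ 2)%:E)%E.
Proof.
move=> mf f0 ef fg mg H.
have H2 : (\int[mu]_(s in `]0%R, +oo[) f s <= C%:E)%E.
  apply: le_trans H; apply: ge0_le_integral => //.
  - exact: measurable_funTS.
  - by apply/measurable_EFinP; exact: measurable_funTS.
  - by move=> x /=; rewrite in_itv/= andbT; exact: fg.
by rewrite ge0_integral_even// mulr2n EFinD; apply: leeD.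
Qed.

(** The integral over |t| <= rho is of order rho^(1-b) for small rho and of order 1
    for large rho, hence at most a multiple of rho^s for each s between 0 and 1 - b;
    the freedom in s is what lets q range over an interval. *)
Lemma integral_riesz1_near (b s : R) : 0 < b < 1 -> 0 <= s <= 1 - b ->
  exists2 C : R, 0 <= C & forall rho, 0 < rho ->
  (\int[mu]_t (riesz1 b t * (`|t| <= rho)%R%:R%:E) <= (C * rho `^ s)%:E)%E.
Proof.
move=> /andP[b0 b1] /andP[s0 sb].
have mf rho : measurable_fun setT (fun t : measurableTypeR R =>
    (riesz1 b t * (`|t| <= rho)%R%:R%:E)%E).
  apply: emeasurable_funM; first exact: measurable_riesz1.
  apply/measurable_EFinP/measurable_fun_bool2R.
  by apply: measurable_fun_ler => //; exact: measurableT_comp.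
have f0 rho t : (0 <= riesz1 b t * (`|t| <= rho)%R%:R%:E)%E.
  by rewrite mule_ge0// ?lee_fin// ltW// riesz1_gt0.
have ef rho t : (riesz1 b (- t) * (`|- t| <= rho)%R%:R%:E =
   riesz1 b t * (`|t| <= rho)%R%:R%:E)%E.
  by rewrite /riesz1 normrN oppr_eq0.
have [s_eq0|s_neq0] := eqVneq s 0.
  pose C0 := 2 * ((1 - b)^-1 + ((2 - b) - (1 - b))^-1) * 1 `^ ((1 - b) - (2 - b)).
  have C0_ge0 : 0 <= C0.
    by rewrite /C0 powR1 mulr1 mulr_ge0// addr_ge0// invr_ge0; lra.
  exists (C0 *+ 2); first by rewrite mulrn_wge0.
  move=> rho rho0; rewrite s_eq0 powRr0 mulr1.
  apply: (@integral_even_le _ (fun t => t `^ ((1 - b) - 1) * (1 + t) `^ (- (2 - b)))) => //.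
  - move=> t t0; rewrite /riesz1 gt_eqF// gtr0_norm//.
    rewrite (_ : 1 - b - 1 = - b); last by ring.
    rewrite -EFinM lee_fin ler_piMr ?mulr_ge0 ?powR_ge0//.
    by case: (t <= rho).
  - exact: measurable_beta_integrand.
  - by apply: integral_beta_le => //; lra.
have {s_neq0}s0 : 0 < s by rewrite lt_neqAle eq_sym s_neq0.
pose C0 := 2 `^ (s + 1) * (2 * (s^-1 + (s + 1 - s)^-1)).
have C0_ge0 : 0 <= C0.
  by rewrite /C0 mulr_ge0 ?powR_ge0// mulr_ge0// addr_ge0// invr_ge0; lra.
exists (C0 *+ 2); first by rewrite mulrn_wge0.
move=> rho rho0; rewrite mulrnAl.
pose g t := (2 * rho) `^ (s + 1) * (t `^ (s - 1) * (rho + t) `^ (- (s + 1))).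
have mg : measurable_fun setT (fun t => t `^ (s - 1) * (rho + t) `^ (- (s + 1))). by exact: measurable_beta_integrand.
(* on t <= rho, the factor (2 rho)^(s+1) (rho + t)^(-(s+1)) is at least 1 *)
apply: (@integral_even_le _ g) => //.
- move=> t t0; rewrite /riesz1 gt_eqF// gtr0_norm// -EFinM lee_fin.
  have rt : 0 < rho + t by rewrite addr_gt0.
  have [trho|_] := leP t rho; last by rewrite mulr0 /g !mulr_ge0 ?powR_ge0.
  rewrite mulr1 /g mulrCA; apply: (@le_trans _ _ (t `^ (s - 1))).
    have t1 : 0 < 1 + t by rewrite addr_gt0.
    have -> : t `^ (- b) = t `^ (s - 1) * t `^ (1 - b - s).
      by rewrite -powRD_gt0//; congr (_ `^ _); ring.
    rewrite -mulrA ler_piMr ?powR_ge0//.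
    have -> : (1 + t) `^ (- (2 - b)) = (1 + t) `^ (- (1 - b - s)) * (1 + t) `^ (- (1 + s)).
      by rewrite -powRD_gt0//; congr (_ `^ _); ring.
    rewrite mulrA -[leRHS]mulr1.
    apply: ler_pM; rewrite ?mulr_ge0 ?powR_ge0//.
      rewrite powRN ler_pdivrMr ?powR_gt0// mul1r.
      apply: ge0_ler_powR; rewrite ?nnegrE ?(ltW t0) ?(ltW t1)//; first by lra.
      by rewrite lerDr.
    rewrite powRN invf_le1 ?powR_gt0//.
    have t1' : 1 <= 1 + t by rewrite lerDl ltW.
    by have := ler_powR t1' (addr_ge0 ler01 (ltW s0)); rewrite powRr0.
  rewrite ler_peMr ?powR_ge0//.
  rewrite powRN ler_pdivlMr ?powR_gt0// mul1r.
  apply: ge0_ler_powR; rewrite ?nnegrE; last by lra.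
  - by rewrite addr_ge0// ltW.
  - exact: ltW.
  - by rewrite mulr_ge0// ltW.
- by apply: measurable_funM.
- rewrite /g; under eq_integral do rewrite EFinM.
  rewrite ge0_integralZl_EFin//; last 3 first.
  - by move=> t _; rewrite lee_fin mulr_ge0 ?powR_ge0.
  - by apply/measurable_EFinP; exact: measurable_funTS.
  - by rewrite powR_ge0.
  apply: (@le_trans _ _ (((2 * rho) `^ (s + 1))%:E *
     (2 * (s^-1 + (s + 1 - s)^-1) * rho `^ (s - (s + 1)))%:E)%E).
    apply: lee_wpmul2l; first by rewrite lee_fin powR_ge0.
    by apply: integral_beta_le => //; lra.
  rewrite -EFinM lee_fin powRM ?(ltW rho0)//.
  have -> : rho `^ s = rho `^ (s + 1) * rho `^ (s - (s + 1)).
    by rewrite -powRD_gt0//; congr (_ `^ _); ring.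
  by rewrite /C0 le_eqVlt; apply/orP; left; apply/eqP; ring.
Qed.

Lemma integral_invsqr_le : exists2 C : R, 0 <= C & forall rho, 0 < rho ->
  (\int[mu]_t ((rho + `|t|) `^ (-2))%:E <= (C * rho^-1)%:E)%E.
Proof.
pose C0 : R := 2 * (1^-1 + (2 - 1)^-1).
have C0_ge0 : 0 <= C0.
  by rewrite /C0 mulr_ge0// addr_ge0// invr_ge0; lra.
exists (C0 *+ 2); first by rewrite mulrn_wge0.
move=> rho rho0; rewrite mulrnAl.
have mg : measurable_fun setT (fun t => t `^ (1 - 1) * (rho + t) `^ (- 2)). by exact: measurable_beta_integrand.
apply: (@integral_even_le _ (fun t => t `^ (1 - 1) * (rho + t) `^ (- 2))) => //.
- apply/measurable_EFinP; apply: (measurableT_comp (measurable_powR _)).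
  by apply: measurable_funD => //; exact: measurableT_comp.
- by move=> t; rewrite lee_fin powR_ge0.
- by move=> t; rewrite normrN.
- by move=> t t0; rewrite subrr powRr0 mul1r gtr0_norm.
- apply: le_trans (@integral_beta_le _ 1 2 rho _ _ rho0) _; rewrite ?ltr1n//.
  rewrite lee_fin (_ : 1 - 2 = - 1); last by ring.
  by rewrite powR_inv1// ltW.
Qed.

End OneDim.

(** * A Hardy-Littlewood-Sobolev inequality *)

Section ProdE.
Context {R : realType}.
Local Open Scope ereal_scope.

Lemma lee_prod (I : Type) (r : seq I) (P : pred I) (E1 E2 : I -> \bar R) :
  (forall i, P i -> 0 <= E1 i <= E2 i) ->
  \prod_(i <- r | P i) E1 i <= \prod_(i <- r | P i) E2 i.
Proof.
move=> leE12; suff : 0 <= \prod_(i <- r | P i) E1 i <= \prod_(i <- r | P i) E2 i by case/andP.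
elim/big_rec2: _ => [|i x2 x1 Pi /andP[x1_ge0 le_x12]]; first by rewrite lexx lee01.
have /andP[E1i_ge0 leE12i] := leE12 i Pi.
by rewrite mule_ge0//= lee_pmul.
Qed.

Lemma prode_gt0 (I : Type) (r : seq I) (P : pred I) (E : I -> \bar R) :
  (forall i, P i -> 0 < E i) -> 0 < \prod_(i <- r | P i) E i.
Proof. by move=> E0; elim/big_rec: _ => // i x Pi x0; rewrite mule_gt0// E0. Qed.

End ProdE.

Section TranslationInvariance.
Context {R : realType}.
Local Open Scope ereal_scope.

Lemma ge0_integral_reflect_rV n (x : 'rV[R]_n) (f : 'rV[R]_n -> \bar R) :
  measurable_fun setT f -> (forall z, 0 <= f z) ->
  \int[lebesgue_rV R n]_w f (x - w)%R = \int[lebesgue_rV R n]_z f z.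
Proof.
move=> mf f0.
rewrite [RHS](@ge0_integral_affine_rV R n (-1) x f)//.
rewrite normrN1 expr1n mul1e; apply: eq_integral => w _.
by rewrite scaleN1r addrC.
Qed.

Lemma measurable_kernel_form n (h : 'rV[R]_n -> R) (K : 'rV[R]_n * 'rV[R]_n -> \bar R) :
  measurable_fun setT h -> measurable_fun setT K ->
  measurable_fun setT (fun z => (h z.1)%:E * K z * (h z.2)%:E).
Proof.
move=> mh mK; apply: emeasurable_funM.
  apply: emeasurable_funM => //.
  by apply/measurable_EFinP; exact: (measurableT_comp mh measurable_fst).
by apply/measurable_EFinP; exact: (measurableT_comp mh measurable_snd).
Qed.

End TranslationInvariance.

Section HLS.
Context {R : realType} (n : nat) (lam p q : R).
Hypotheses (n_gt0 : (0 < n)%N) (lam_gt0 : 0 < lam) (lam_ltn : lam < n%:R).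
Hypotheses (q_ge2 : 2 <= q) (q_lam : q * lam <= 2 * n%:R) (pq : p^-1 + q^-1 = 1).
Implicit Types (x z w : 'rV[R]_n).

Let N : R := n%:R.
Let N0 : 0 < N. Proof. by rewrite ltr0n. Qed.
Let q0 : 0 < q. Proof. by apply: lt_le_trans q_ge2. Qed.
Let qi : 0 < q^-1 <= 2^-1. Proof. by rewrite invr_gt0 q0 lef_pV2 ?posrE. Qed.
Let pE : p^-1 = 1 - q^-1. Proof. by rewrite -pq addrK. Qed.
Let p0 : 0 < p. Proof. by rewrite -invr_gt0 pE; move: qi => /andP[? ?]; lra. Qed.
Let p_div_q : p / q = p - 1.
Proof.
have -> : q^-1 = 1 - p^-1 by rewrite pE; ring.
by rewrite mulrBr mulr1 divff// gt_eqF.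
Qed.
Let b : R := lam / N.
Let s : R := 1 - 2 / q.
Let b01 : 0 < b < 1.
Proof. by rewrite divr_gt0//= ltr_pdivrMr// mul1r. Qed.
Let s0b : 0 <= s <= 1 - b.
Proof.
rewrite subr_ge0 ler_pdivrMr// mul1r q_ge2/= lerD2l lerN2 ler_pdivrMr//.
by rewrite mulrAC ler_pdivlMr// mulrC.
Qed.

(** Of size |z|^(-lam) near 0 and |z|^(-2n) at infinity: the decay at infinity makes
    the kernel integrable there, which |z|^(-lam) alone is not. *)
Definition riesz_fun z : R :=
  enorm z `^ (- lam) * (1 + enorm z) `^ (- (2 * n%:R - lam)).

(** The value +oo at 0 is that of the Bessel potentials of order at most n, which
    this kernel has to dominate. *)
Definition riesz z : \bar R := if z == 0 then +oo%E else (riesz_fun z)%:E.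

Lemma riesz_fun_ge0 z : 0 <= riesz_fun z.
Proof. by rewrite mulr_ge0 ?powR_ge0. Qed.

Lemma riesz_ge0 z : (0 <= riesz z)%E.
Proof. by rewrite /riesz; case: ifP => // _; rewrite lee_fin riesz_fun_ge0. Qed.

Lemma rieszN z : riesz (- z) = riesz z.
Proof. by rewrite /riesz /riesz_fun oppr_eq0 enormN. Qed.

Lemma measurable_riesz_fun : measurable_fun setT riesz_fun.
Proof.
apply: measurable_funM.
  exact: (measurableT_comp (measurable_powR _) measurable_enorm).
apply: (measurableT_comp (measurable_powR _)).
by apply: measurable_funD => //; exact: measurable_enorm.
Qed.

Lemma measurable_riesz : measurable_fun setT riesz.
Proof.
apply: measurable_fun_ifT; first exact: measurable_eq0_rV.
- exact: measurable_cst.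
- by apply/measurable_EFinP; exact: measurable_riesz_fun.
Qed.

Let prod_cst_powR (a c : R) : 0 <= a -> \prod_(j < n) a `^ c = a `^ (c * n%:R).
Proof.
by move=> a0; rewrite prodr_const card_ord -powR_mulrn ?powR_ge0// -powRrM.
Qed.

(** Each coordinate is at most the Euclidean norm, and the exponents of the kernel
    are n times those of the one-dimensional factors. *)
Lemma riesz_le_prod z : (riesz z <= \prod_(j < n) riesz1 b (z ord0 j))%E.
Proof.
have [[j zj0]|nz] := pselect (exists j, z 0 j = 0).
  rewrite (bigD1 j)//= {1}/riesz1 zj0 eqxx gt0_mulye ?leey//.
  by apply: prode_gt0 => i _; exact: riesz1_gt0.
have zn j : z 0 j != 0 by apply/eqP => zj; apply: nz; exists j.
have z0 : z != 0.
  by apply/eqP => z0; have := zn (Ordinal n_gt0); rewrite z0 mxE eqxx.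
rewrite /riesz (negbTE z0).
rewrite (eq_bigr (fun j => (`|z 0 j| `^ (- b) * (1 + `|z 0 j|) `^ (- (2 - b)))%:E)); last first.
  by move=> j _; rewrite /riesz1 (negbTE (zn j)).
rewrite prodEFin lee_fin.
have -> : riesz_fun z = \prod_(j < n) (enorm z `^ (- b) * (1 + enorm z) `^ (- (2 - b))).
  rewrite big_split/= !prod_cst_powR ?addr_ge0 ?enorm_ge0// /riesz_fun.
  congr (_ `^ _ * _ `^ _); rewrite /b -/N; field; exact: lt0r_neq0.
apply: ler_prod => j _; rewrite mulr_ge0 ?powR_ge0//=.
have zj : 0 < `|z 0 j| by rewrite normr_gt0.
move: b01 => /andP[b0 b1].
apply: ler_pM; rewrite ?powR_ge0//; apply: ler_powRN => //.
- exact: ltW.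
- exact: coord_le_enorm.
- by lra.
- by rewrite lerD2l coord_le_enorm.
Qed.

Let near0 (rho : R) z : bool := [forall j, `|z 0 j| <= rho].

Let measurable_near0 rho : measurable_fun setT (near0 rho).
Proof.
apply: (@measurable_fun_forall_ord R) => j; apply: measurable_fun_ler => //.
by apply: measurableT_comp => //; exact: measurable_mx_coord.
Qed.

Lemma integral_riesz_near : exists2 C : R, 0 <= C & forall rho, 0 < rho ->
  (\int[lebesgue_rV R n]_z (riesz z * (near0 rho z)%:R%:E) <=
     (C * rho `^ (s * n%:R))%:E)%E.
Proof.
have [C C0 HC] := @integral_riesz1_near R b s b01 s0b.
exists (C ^+ n); first by rewrite exprn_ge0.
move=> rho rho0.
have mind : measurable_fun setT (fun t : measurableTypeR R => (`|t| <= rho)%R%:R%:E : \bar R).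
  apply/measurable_EFinP/measurable_fun_bool2R.
  by apply: measurable_fun_ler => //; exact: measurableT_comp.
pose F (t : measurableTypeR R) := (riesz1 b t * (`|t| <= rho)%R%:R%:E)%E.
have F0 t : (0 <= F t)%E.
  by rewrite mule_ge0// ?lee_fin// ltW// riesz1_gt0.
have mF : measurable_fun setT F.
  by apply: emeasurable_funM; [exact: measurable_riesz1|exact: mind].
apply: (@le_trans _ _ (\int[lebesgue_rV R n]_z \prod_(j < n) F (z ord0 j)))%E.
  apply: ge0_le_integral => //.
  - by move=> z _; rewrite mule_ge0 ?riesz_ge0// lee_fin.
  - apply: emeasurable_funM; first exact: measurable_riesz.
    by apply/measurable_EFinP/measurable_fun_bool2R; exact: measurable_near0.
  - apply: emeasurable_prod => j.
    exact: (measurableT_comp mF (measurable_mx_coord _ _)).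
  - move=> z _; case: (boolP (near0 rho z)) => [/forallP nz|_]; last first.
      by rewrite mule0; apply: prode_ge0.
    rewrite mule1; apply: (le_trans (riesz_le_prod z)).
    by rewrite le_eqVlt; apply/orP; left; apply/eqP/eq_bigr => j _; rewrite /F nz mule1.
rewrite (ge0_integral_prod_rV (F := fun=> F))//.
apply: (@le_trans _ _ (\prod_(j < n) (C * rho `^ s)%:E))%E.
  by apply: lee_prod => j _; rewrite integral_ge0//=; exact: HC.
rewrite prodEFin lee_fin prodr_const card_ord exprMn.
by rewrite -[(rho `^ s) ^+ n]powR_mulrn ?powR_ge0// -powRrM.
Qed.

Let far z rho : R := riesz_fun z `^ q * (~~ near0 rho z)%:R.

Let measurable_far rho : measurable_fun setT (far ^~ rho).
Proof.
apply: measurable_funM.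
  exact: (measurableT_comp (measurable_powR _) measurable_riesz_fun).
by apply: measurable_fun_bool2R; apply: measurable_neg; exact: measurable_near0.
Qed.

Let far_ge0 z rho : 0 <= far z rho. Proof. by rewrite mulr_ge0 ?powR_ge0. Qed.

(** Outside the cube of half-side rho the norm exceeds rho and all coordinates, so
    that (rho + |z_j|)^2 <= 4 |z|^2 for each j; and riesz_fun^q <= |z|^(-2n), because
    lam <= 2n/q <= 2n. *)
Lemma far_le_prod z rho : 0 < rho ->
  far z rho <= 4 ^+ n * \prod_(j < n) (rho + `|z 0 j|) `^ (- 2).
Proof.
move=> rho0; rewrite /far.
have P0 : 0 <= \prod_(j < n) (rho + `|z 0 j|) `^ (- 2).
  by apply: prodr_ge0 => j _; exact: powR_ge0.
case: (boolP (near0 rho z)) => [_|]; first by rewrite mulr0 mulr_ge0// exprn_ge0.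
rewrite negb_forall => /existsP[j]; rewrite -ltNge => rz; rewrite mulr1.
set r := enorm z.
have rhor : rho < r by exact: lt_le_trans rz (coord_le_enorm _ _).
have r0 : 0 < r by exact: lt_trans rhor.
have r1 : 0 < 1 + r by rewrite addr_gt0.
move: qi => /andP[qi0 qi2].
have l1 : lam <= 2 * N / q by rewrite ler_pdivlMr// mulrC.
have l2 : 2 * N / q <= 2 * N by rewrite ler_piMr ?mulr_ge0 ?(ltW N0)//; lra.
have h1 : riesz_fun z <= r `^ (- (2 * N / q)).
  have -> : r `^ (- (2 * N / q)) = r `^ (- lam) * r `^ (- (2 * N / q - lam)).
    by rewrite -powRD_gt0//; congr (_ `^ _); ring.
  rewrite /riesz_fun -/r ler_wpM2l ?powR_ge0//.
  apply: (@le_trans _ _ ((1 + r) `^ (- (2 * N / q - lam)))).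
    by apply: ler_powR; [rewrite lerDl ltW|rewrite lerN2 lerD2r].
  by apply: ler_powRN => //; [rewrite subr_ge0|rewrite lerDr].
apply: (@le_trans _ _ ((r `^ (- (2 * N / q))) `^ q)).
  by apply: ge0_ler_powR; rewrite ?nnegrE ?powR_ge0 ?riesz_fun_ge0// ltW.
rewrite -powRrM (_ : - (2 * N / q) * q = (- 2) * n%:R); last first.
  by rewrite /N; field; exact: lt0r_neq0.
rewrite -prod_cst_powR ?(ltW r0)//.
have -> : 4 ^+ n = \prod_(j < n) 4 :> R by rewrite prodr_const card_ord.
rewrite -big_split/=.
apply: ler_prod => i _; rewrite powR_ge0/=.
have : (2 * r) `^ (- 2) <= (rho + `|z 0 i|) `^ (- 2).
  apply: ler_powRN; rewrite // ?ltr_wpDr//.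
  by have := coord_le_enorm z i; rewrite -/r; lra.
rewrite powRM ?(ltW r0)// (_ : 2 `^ (- 2) = 4^-1); last first.
  by rewrite powR_invn// -natrX.
by rewrite ler_pdivrMl.
Qed.

Lemma integral_riesz_far : exists2 C : R, 0 <= C & forall rho, 0 < rho ->
  (\int[lebesgue_rV R n]_z (far z rho)%:E <= (C * rho `^ (- n%:R))%:E)%E.
Proof.
have [C C0 HC] := @integral_invsqr_le R.
exists (4 ^+ n * C ^+ n); first by rewrite mulr_ge0 ?exprn_ge0.
move=> rho rho0.
pose F (t : measurableTypeR R) := ((rho + `|t|) `^ (- 2))%:E.
have F0 t : (0 <= F t)%E by rewrite lee_fin powR_ge0.
have mF : measurable_fun setT F.
  apply/measurable_EFinP; apply: (measurableT_comp (measurable_powR _)).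
  by apply: measurable_funD => //; exact: measurableT_comp.
have mP : measurable_fun setT (fun z : 'rV[R]_n => \prod_(j < n) F (z ord0 j))%E.
  apply: emeasurable_prod => j.
  exact: (measurableT_comp mF (measurable_mx_coord _ _)).
apply: (@le_trans _ _ (\int[lebesgue_rV R n]_z ((4 ^+ n)%:E * \prod_(j < n) F (z ord0 j)))%E).
  apply: ge0_le_integral => //.
  - by move=> z _; rewrite lee_fin far_ge0.
  - by apply/measurable_EFinP; exact: measurable_far.
  - exact: emeasurable_funM.
  - by move=> z _; rewrite /F prodEFin -EFinM lee_fin far_le_prod.
rewrite ge0_integralZl_EFin ?exprn_ge0//; last by move=> z _; exact: prode_ge0.
rewrite (ge0_integral_prod_rV (F := fun=> F))//.
apply: (@le_trans _ _ ((4 ^+ n)%:E * \prod_(j < n) (C * rho^-1)%:E))%E.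
  apply: lee_wpmul2l; first by rewrite lee_fin exprn_ge0.
  by apply: lee_prod => j _; rewrite integral_ge0//=; exact: HC.
rewrite prodEFin -EFinM lee_fin prodr_const card_ord exprMn mulrA.
by rewrite powR_invn ?(ltW rho0)// exprVn.
Qed.

(** Young's inequality for c a^(1/q) and k a^(-1/q): the height a distributes the
    weight between the two terms. *)
Lemma young_level (a c k : R) : 0 < a -> 0 <= c -> 0 <= k ->
  c * k <= a `^ (p - 1) * c `^ p + a^-1 * k `^ q.
Proof.
move=> a0 c0 k0.
have := @conjugate_powR R (c * a `^ q^-1) (k * a `^ (- q^-1)) p q.
rewrite !mulr_ge0 ?powR_ge0// => /(_ isT isT p0 q0 pq).
have -> : c * a `^ q^-1 * (k * a `^ (- q^-1)) = c * k.
  by rewrite mulrACA -powRD_gt0// addrN powRr0 mulr1.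
move=> /le_trans; apply.
rewrite !powRM ?powR_ge0// -!powRrM.
have -> : q^-1 * p = p - 1 by rewrite mulrC p_div_q.
have -> : - q^-1 * q = - 1 by rewrite mulNr mulVf// gt_eqF.
rewrite powR_inv1 ?(ltW a0)//.
have ki : q^-1 <= 1 by move: qi => /andP[? ?]; lra.
have pi : p^-1 <= 1 by rewrite pE; move: qi => /andP[? ?]; lra.
apply: lerD; last by rewrite [k `^ _ * _]mulrC ler_piMr// mulr_ge0 ?powR_ge0// invr_ge0 ltW.
by rewrite [c `^ _ * _]mulrC ler_piMr// mulr_ge0 ?powR_ge0.
Qed.

Let measurable_form (h : 'rV[R]_n -> R) : measurable_fun setT h ->
  measurable_fun setT (fun xw : 'rV[R]_n * 'rV[R]_n =>
    (h xw.1)%:E * riesz (xw.1 - xw.2) * (h xw.2)%:E)%E.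
Proof.
move=> mh; apply: (measurable_kernel_form (K := fun z : 'rV[R]_n * 'rV[R]_n => riesz (z.1 - z.2))) => //.
by apply: (measurableT_comp measurable_riesz); exact: measurable_funB_mx.
Qed.

Section Form.
Variables (h : 'rV[R]_n -> R).
Hypotheses (mh : measurable_fun setT h) (h0 : forall x, 0 <= h x).

(* By symmetry, the form is at most twice the integral of U. *)
Let U (z : 'rV[R]_n * 'rV[R]_n) : \bar R :=
  ((h z.1)%:E * riesz (z.1 - z.2) * (h z.2)%:E * ((h z.2 <= h z.1)%R%:R)%:E)%E.

Let U0 xw : (0 <= U xw)%E.
Proof. by rewrite /U !mule_ge0 ?riesz_ge0 ?lee_fin. Qed.

Let measurable_U : measurable_fun setT U.
Proof.
apply: emeasurable_funM; first exact: (measurable_form mh).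
apply/measurable_EFinP/measurable_fun_bool2R/measurable_fun_ler.
  exact: (measurableT_comp mh measurable_snd).
exact: (measurableT_comp mh measurable_fst).
Qed.

Let form_le_U x w : ((h x)%:E * riesz (x - w) * (h w)%:E <= U (x, w) + U (w, x))%E.
Proof.
have [hwx|hxw] := leP (h w) (h x).
  rewrite {1}/U /= hwx mule1; apply: leeDl; exact: U0.
rewrite [in X in (_ <= _ + X)%E]/U /= (ltW hxw) mule1 -[w - x]opprB rieszN.
rewrite (_ : (h x)%:E * _ * _ = (h w)%:E * riesz (x - w) * (h x)%:E)%E.
  by apply: leeDr; exact: U0.
by rewrite muleAC (muleC (h x)%:E) muleAC.
Qed.

(* The splitting behind the whole estimate: near the diagonal h w is replaced by
   the larger h x, and away from it Young's inequality at height h x is used. *)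
Let pointwise x w rho : 0 < h x -> 0 < rho ->
  (U (x, w) <= (h x)%:E * ((h x)%:E * (riesz (x - w) * (near0 rho (x - w))%:R%:E) +
     ((h x `^ (p - 1))%:E * (h w `^ p)%:E + ((h x)^-1)%:E * (far (x - w) rho)%:E)))%E.
Proof.
move=> hx rho0; set z := x - w; rewrite /U /= -/z -!muleA.
apply: lee_wpmul2l; first by rewrite lee_fin ltW.
have R0 : (0 <= (h x `^ (p - 1))%:E * (h w `^ p)%:E + ((h x)^-1)%:E * (far z rho)%:E)%E.
  by rewrite adde_ge0 ?mule_ge0 ?lee_fin ?powR_ge0 ?invr_ge0 ?far_ge0 ?(ltW hx).
case: (leP (h w) (h x)) => [hwx|_]; last first.
  by rewrite !mule0 adde_ge0// mule_ge0 ?lee_fin ?(ltW hx)// mule_ge0 ?riesz_ge0.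
rewrite mule1; case: (boolP (near0 rho z)) => [_|fz].
  rewrite mule1; apply: (@le_trans _ _ ((h x)%:E * riesz z)%E); last exact: leeDl.
  by rewrite muleC; apply: lee_wpmul2r; rewrite ?riesz_ge0 ?lee_fin.
rewrite !mule0 add0e.
have z0 : z != 0.
  apply: contraNneq fz => ->; apply/forallP => j.
  by rewrite mxE normr0 ltW.
rewrite /riesz (negbTE z0) /far fz mulr1 -!EFinM -EFinD lee_fin mulrC.
by apply: young_level; rewrite ?riesz_fun_ge0.
Qed.

(** For fixed x, integrate the pointwise bound in w with the radius
    rho = h(x)^(-p/n). All three terms then are multiples of h(x)^p, whose integral
    is 1. *)
Lemma riesz_form_normalized C1 C2 :
  0 <= C1 -> 0 <= C2 ->
  (forall rho, 0 < rho -> (\int[lebesgue_rV R n]_z (riesz z * (near0 rho z)%:R%:E) <=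
     (C1 * rho `^ (s * n%:R))%:E)%E) ->
  (forall rho, 0 < rho ->
  (\int[lebesgue_rV R n]_z (far z rho)%:E <= (C2 * rho `^ (- n%:R))%:E)%E) ->
  (\int[lebesgue_rV R n]_x (h x `^ p)%:E = 1)%E ->
  (\int[lebesgue_rV R n]_x \int[lebesgue_rV R n]_w
      ((h x)%:E * riesz (x - w) * (h w)%:E) <= (2 * (C1 + 1 + C2))%:E)%E.
Proof.
move=> C10 C20 H1 H2 hp.
have mhp : measurable_fun setT (fun x => (h x `^ p)%:E).
  by apply/measurable_EFinP; exact: (measurableT_comp (measurable_powR _) mh).
have inner x : (\int[lebesgue_rV R n]_w U (x, w) <= (C1 + 1 + C2)%:E * (h x `^ p)%:E)%E.
  have [hx|hx] := ltP 0 (h x); last first.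
    have {}hx : h x = 0 by apply/eqP; rewrite eq_le hx h0.
    rewrite integral0_eq; first by rewrite -EFinM lee_fin mulr_ge0 ?powR_ge0// !addr_ge0.
    by move=> w _; rewrite /U /= hx !mul0e.
  pose rho := h x `^ (- (p / n%:R)).
  have rho0 : 0 < rho by exact: powR_gt0.
  have mn : measurable_fun setT (fun z : 'rV[R]_n => (riesz z * (near0 rho z)%:R%:E)%E).
    apply: emeasurable_funM; first exact: measurable_riesz.
    by apply/measurable_EFinP/measurable_fun_bool2R; exact: measurable_near0.
  have n0 z : (0 <= riesz z * (near0 rho z)%:R%:E)%E by rewrite mule_ge0 ?riesz_ge0.
  have mf : measurable_fun setT (fun z => (far z rho)%:E) by apply/measurable_EFinP.
  have f0 z : (0 <= (far z rho)%:E)%E by rewrite lee_fin.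
  have mxw : measurable_fun setT (fun w : 'rV[R]_n => x - w).
    exact: measurable_funB_mx.
  have mn' := measurableT_comp mn mxw.
  have mf' := measurableT_comp mf mxw.
  have nn w : (0 <= (h x)%:E * (riesz (x - w) * (near0 rho (x - w))%:R%:E))%E.
    by rewrite mule_ge0// lee_fin ltW.
  have hh w : (0 <= (h x `^ (p - 1))%:E * (h w `^ p)%:E)%E.
    by rewrite mule_ge0// lee_fin powR_ge0.
  have ff w : (0 <= ((h x)^-1)%:E * (far (x - w) rho)%:E)%E.
    by rewrite mule_ge0// lee_fin invr_ge0.
  apply: (@le_trans _ _ (\int[lebesgue_rV R n]_w ((h x)%:E *
     ((h x)%:E * (riesz (x - w) * (near0 rho (x - w))%:R%:E) +
     ((h x `^ (p - 1))%:E * (h w `^ p)%:E + ((h x)^-1)%:E * (far (x - w) rho)%:E))))%E).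
    apply: ge0_le_integral => //.
    - exact: (measurableT_comp measurable_U (measurable_pair1 _)).
    - apply: emeasurable_funM => //; apply: emeasurable_funD.
        exact: emeasurable_funM.
      by apply: emeasurable_funD; apply: emeasurable_funM.
    - by move=> w _; exact: pointwise.
  rewrite ge0_integralZl_EFin//; last 2 first.
  - by move=> w _; rewrite !adde_ge0.
  - apply: emeasurable_funD; first exact: emeasurable_funM.
    by apply: emeasurable_funD; apply: emeasurable_funM.
  rewrite ge0_integralD//; last 3 first.
  - exact: emeasurable_funM.
  - by move=> w _; rewrite !adde_ge0.
  - by apply: emeasurable_funD; apply: emeasurable_funM.
  rewrite ge0_integralD//; last 2 first.
  - exact: emeasurable_funM.
  - exact: emeasurable_funM.
  rewrite ge0_integralZl_EFin//.
  rewrite ge0_integralZl_EFin ?powR_ge0//; last by move=> w _; rewrite lee_fin powR_ge0.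
  rewrite ge0_integralZl_EFin ?invr_ge0//.
  rewrite hp (ge0_integral_reflect_rV x mn n0) (ge0_integral_reflect_rV x mf f0) mule1.
  apply: (@le_trans _ _ ((h x)%:E * ((h x)%:E * (C1 * rho `^ (s * n%:R))%:E +
     ((h x `^ (p - 1))%:E + ((h x)^-1)%:E * (C2 * rho `^ (- n%:R))%:E)))%E).
    apply: lee_wpmul2l; first by rewrite lee_fin.
    apply: leeD; first by apply: lee_wpmul2l; [rewrite lee_fin|exact: H1].
    by apply: leeD2l; apply: lee_wpmul2l; [rewrite lee_fin invr_ge0|exact: H2].
  have Nn : n%:R != 0 :> R by rewrite pnatr_eq0 -lt0n.
  have e1 : h x * h x * rho `^ (s * n%:R) = h x `^ p.
    have {1 2}-> : h x = h x `^ 1 by rewrite powRr1.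
    rewrite -!powRD_gt0// -powRrM -powRD_gt0//; congr (_ `^ _).
    have -> : - (p / n%:R) * (s * n%:R) = - p + 2 * (p / q) by rewrite /s; field; rewrite Nn gt_eqF.
    by rewrite p_div_q; ring.
  have e2 : h x * h x `^ (p - 1) = h x `^ p by rewrite mulr_powRB1.
  have e3 : rho `^ (- n%:R) = h x `^ p.
    by rewrite -powRrM; congr (_ `^ _); field.
  rewrite -![((h x)%:E * (_ * _)%:E)%E]EFinM -![((h x)^-1%:E * _)%E]EFinM -!EFinD -!EFinM lee_fin e3.
  rewrite le_eqVlt; apply/orP; left; apply/eqP.
  transitivity (C1 * (h x * h x * rho `^ (s * n%:R)) + h x * h x `^ (p - 1) + C2 * (h x / h x) * h x `^ p).
    by ring.
  by rewrite e1 e2 divff ?gt_eqF//; ring.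
have outer : (\int[lebesgue_rV R n]_x \int[lebesgue_rV R n]_w U (x, w) <= (C1 + 1 + C2)%:E)%E.
  apply: (@le_trans _ _ (\int[lebesgue_rV R n]_x ((C1 + 1 + C2)%:E * (h x `^ p)%:E))%E).
    apply: ge0_le_integral => //.
    - by move=> x _; apply: integral_ge0.
    - exact: (measurable_fun_fubini_tonelli_F _ measurable_U).
    - exact: emeasurable_funM.
  rewrite ge0_integralZl_EFin ?hp ?mule1// ?addr_ge0//.
  by move=> x _; rewrite lee_fin powR_ge0.
have mUs : measurable_fun setT (fun z : 'rV[R]_n * 'rV[R]_n => U (z.2, z.1)).
  apply: (measurableT_comp measurable_U).
  by apply: measurable_fun_pair; [exact: measurable_snd|exact: measurable_fst].
apply: (@le_trans _ _ (\int[lebesgue_rV R n]_x \int[lebesgue_rV R n]_w (U (x, w) + U (w, x)))%E).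
  apply: ge0_le_integral => //.
  - by move=> x _; apply: integral_ge0 => w _; rewrite !mule_ge0 ?riesz_ge0 ?lee_fin.
  - apply: (measurable_fun_fubini_tonelli_F _ (measurable_form mh)).
    by move=> z; rewrite !mule_ge0 ?riesz_ge0 ?lee_fin.
  - have mS : measurable_fun setT (fun xw => U xw + U (xw.2, xw.1))%E.
      exact: emeasurable_funD.
    by apply: (measurable_fun_fubini_tonelli_F _ mS) => xw; rewrite adde_ge0.
  - move=> x _; apply: ge0_le_integral => //.
    + by move=> w _; rewrite !mule_ge0 ?riesz_ge0 ?lee_fin.
    + exact: (measurableT_comp (measurable_form mh) (measurable_pair1 x)).
    + apply: emeasurable_funD; first exact: (measurableT_comp measurable_U (measurable_pair1 x)).
      exact: (measurableT_comp measurable_U (measurable_pair2 x)).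
under eq_integral => x _.
  rewrite ge0_integralD//; last 2 first.
  - exact: (measurableT_comp measurable_U (measurable_pair1 x)).
  - exact: (measurableT_comp measurable_U (measurable_pair2 x)).
  over.
rewrite ge0_integralD//; last 4 first.
- by move=> x _; apply: integral_ge0.
- exact: (measurable_fun_fubini_tonelli_F _ measurable_U).
- by move=> x _; apply: integral_ge0.
- exact: (measurable_fun_fubini_tonelli_F _ mUs).
rewrite mulr_natl mulr2n EFinD; apply: leeD; first exact: outer.
by rewrite -(fubini_tonelli U).
Qed.

End Form.

(** Both sides are homogeneous of degree 2 in h, so that h may be normalized; the
    cases where the integral of h^p is 0 or +oo are trivial. *)
Theorem riesz_form_le : exists2 C : R, 0 < C &
  forall h : 'rV[R]_n -> R, measurable_fun setT h -> (forall x, 0 <= h x) ->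
  (\int[lebesgue_rV R n]_x \int[lebesgue_rV R n]_w
      ((h x)%:E * riesz (x - w) * (h w)%:E) <=
   C%:E * (\int[lebesgue_rV R n]_x (h x `^ p)%:E) `^ (2 / p))%E.
Proof.
have [C1 C10 H1] := integral_riesz_near.
have [C2 C20 H2] := integral_riesz_far.
pose C := 2 * (C1 + 1 + C2).
have C_gt0 : 0 < C by rewrite /C; lra.
exists C => // h mh h0.
have mhp : measurable_fun setT (fun x => (h x `^ p)%:E).
  by apply/measurable_EFinP; exact: (measurableT_comp (measurable_powR _) mh).
have hp0 x : (0 <= (h x `^ p)%:E)%E by rewrite lee_fin powR_ge0.
have p2 : 0 < 2 / p by rewrite divr_gt0.
have I0 : (0 <= \int[lebesgue_rV R n]_x (h x `^ p)%:E)%E by exact: integral_ge0.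
case EI : (\int[lebesgue_rV R n]_x (h x `^ p)%:E)%E I0 => [I| |] I0 //; last first.
  by rewrite poweRyr ?gt_eqF// gt0_muley ?lte_fin// leey.
have [I_eq0|I_neq0] := eqVneq I 0.
  have h_ae0 : ae_eq (lebesgue_rV R n) setT (fun x => (h x `^ p)%:E) (cst 0%E).
    apply/(ae_eq_integral_abs (lebesgue_rV R n)) => //.
    under eq_integral do rewrite gee0_abs//.
    by rewrite EI I_eq0.
  rewrite (_ : (\int[_]_x _)%E = 0%E) ?mule_ge0 ?poweR_ge0 ?lee_fin ?(ltW C_gt0)//.
  rewrite (_ : 0%E = \int[lebesgue_rV R n]_x (cst 0%E x))%E; last by rewrite integral0.
  apply: ae_eq_integral => //.
    by apply: (measurable_fun_fubini_tonelli_F _ (measurable_form mh)) => xw;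
      rewrite !mule_ge0 ?riesz_ge0 ?lee_fin.
  apply: filterS h_ae0 => x /= /(_ Logic.I) [] /powR_eq0_eq0 hx _.
  by rewrite integral0_eq// => w _; rewrite hx !mul0e.
have {I_neq0 I0}I0 : 0 < I by rewrite lt_neqAle eq_sym I_neq0 -lee_fin.
pose A := I `^ p^-1.
have A0 : 0 < A by exact: powR_gt0.
have Ap : A `^ p = I by rewrite /A -powRrM mulVf ?powRr1 ?ltW// gt_eqF.
have A2 : A ^+ 2 = I `^ (2 / p).
  by rewrite -powR_mulrn ?(ltW A0)// /A -powRrM mulrC.
pose g x := A^-1 * h x.
have mg : measurable_fun setT g by exact: measurable_funM.
have g0 x : 0 <= g x by rewrite mulr_ge0// invr_ge0 ltW.
have gp : (\int[lebesgue_rV R n]_x (g x `^ p)%:E = 1)%E.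
  under eq_integral => x _ do rewrite /g powRM ?invr_ge0 ?(ltW A0)// EFinM.
  rewrite ge0_integralZl_EFin ?powR_ge0// EI -EFinM.
  by rewrite -powR_inv1 ?(ltW A0)// powRAC Ap powR_inv1 ?(ltW I0)// mulVf// gt_eqF.
have hg x : h x = A * g x by rewrite /g mulrA divff ?mul1r// gt_eqF.
have -> : (\int[lebesgue_rV R n]_x \int[lebesgue_rV R n]_w
      ((h x)%:E * riesz (x - w) * (h w)%:E) =
    (A ^+ 2)%:E * \int[lebesgue_rV R n]_x \int[lebesgue_rV R n]_w
      ((g x)%:E * riesz (x - w) * (g w)%:E))%E.
  have ge0 xw : (0 <= (g xw.1)%:E * riesz (xw.1 - xw.2) * (g xw.2)%:E)%E.
    by rewrite !mule_ge0 ?riesz_ge0 ?lee_fin.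
  rewrite -ge0_integralZl_EFin ?exprn_ge0 ?(ltW A0)//; last 2 first.
  - by move=> x _; apply: integral_ge0 => w _; exact: (ge0 (x, w)).
  - by apply: (measurable_fun_fubini_tonelli_F _ (measurable_form mg)).
  apply: eq_integral => x _.
  rewrite -ge0_integralZl_EFin ?exprn_ge0 ?(ltW A0)//; last 2 first.
  - by move=> w _; exact: (ge0 (x, w)).
  - exact: (measurableT_comp (measurable_form mg) (measurable_pair1 x)).
  apply: eq_integral => w _; rewrite !hg expr2 !EFinM -!muleA; congr (_ * _)%E.
  by rewrite [RHS]muleCA [in RHS](muleCA A%:E (h x)%:E) [in RHS](muleCA A%:E (riesz _)).
rewrite poweR_EFin A2 muleC; apply: lee_wpmul2r; first by rewrite lee_fin powR_ge0.
exact: riesz_form_normalized.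
Qed.

End HLS.

(** * Bessel potentials as mixtures of Gaussians *)

Section Gauss1.
Context {R : realType}.
Notation mu := (@lebesgue_measure R).
Implicit Types d e t u v : R.

Lemma measurable_inv : measurable_fun setT (fun x : R => x^-1).
Proof.
rewrite (_ : (fun x => _) = (fun x => x * (x ^+ 2) `^ (- 1))).
  apply: measurable_funM => //; apply: (measurableT_comp (measurable_powR _)).
  exact: measurable_funX.
apply/funext => x; rewrite powR_inv1 ?sqr_ge0//.
have [->|x0] := eqVneq x 0; first by rewrite invr0 mul0r.
by field.
Qed.

(** The heat-type kernel d^(-1/2) exp(-pi t^2 / d), of integral 1; the Fourier
    transform exchanges it with exp(-pi d s^2). *)
Definition gauss1 d t := d `^ (- 2^-1) * expR (- (pi * t ^+ 2 / d)).

Lemma gauss1_ge0 d t : 0 <= gauss1 d t.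
Proof. by rewrite mulr_ge0 ?powR_ge0 ?expR_ge0. Qed.

Lemma measurable_gauss1 dd (T : measurableType dd) (f g : T -> R) :
  measurable_fun setT f -> measurable_fun setT g ->
  measurable_fun setT (fun x => gauss1 (f x) (g x)).
Proof.
move=> mf mg; apply: measurable_funM.
  exact: (measurableT_comp (measurable_powR _) mf).
apply: (measurableT_comp (@measurable_expR R)).
apply: (measurable_funN (f := fun x => pi * g x ^+ 2 / f x)).
apply: measurable_funM; last exact: (measurableT_comp measurable_inv mf).
by apply: measurable_funM => //; apply: measurable_funX.
Qed.

(** Identification with the normal density of variance d / (2 pi), whose integral
    is known. *)
Lemma gauss1_normal d v t : 0 < d ->
  gauss1 d (t - v) = normal_pdf v (Num.sqrt (d / (2 * pi))) t.
Proof.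
move=> d0; have pi0 : 0 < pi :> R by exact: pi_gt0.
have s0 : 0 < d / (2 * pi) by rewrite divr_gt0// mulr_gt0.
rewrite normal_pdfE ?gt_eqF ?sqrtr_gt0// /gauss1 /normal_peak /normal_fun.
rewrite sqr_sqrtr ?(ltW s0)//; congr (_ * expR _).
  have -> : d / (2 * pi) * pi *+ 2 = d.
    by move: (pi : R) pi0 => P P0; rewrite -mulr_natr; field; rewrite gt_eqF.
  by rewrite powRN powR12_sqrt// ltW.
by move: (pi : R) pi0 => P P0; rewrite -mulr_natr; field; rewrite !gt_eqF.
Qed.

Lemma integral_gauss1 d v : 0 < d ->
  (\int[mu]_t (gauss1 d (t - v))%:E = 1)%E.
Proof.
move=> d0; under eq_integral do rewrite gauss1_normal//.
exact: integral_normal_pdf.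
Qed.

(** The semigroup law of Gaussians rests on this identity; pi is generalized to P. *)
Lemma complete_square P d e u v t : d != 0 -> e != 0 -> d + e != 0 ->
  - (P * (u - t) ^+ 2 / d) - P * (v - t) ^+ 2 / e =
  - (P * (u - v) ^+ 2 / (d + e)) -
  P * (t - (u * e + v * d) / (d + e)) ^+ 2 / (d * e / (d + e)).
Proof. by move=> d0 e0 de0; field; rewrite d0 e0 de0. Qed.

Lemma gauss1_mul d e u v t : 0 < d -> 0 < e ->
  gauss1 d (u - t) * gauss1 e (v - t) =
  gauss1 (d + e) (u - v) * gauss1 (d * e / (d + e)) (t - (u * e + v * d) / (d + e)).
Proof.
move=> d0 e0; have de0 : 0 < d + e by rewrite addr_gt0.
rewrite /gauss1 mulrACA [RHS]mulrACA -!expRD; congr (_ * expR _).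
  rewrite -!powRM ?mulr_ge0 ?divr_ge0 ?mulr_ge0 ?invr_ge0 ?(ltW d0) ?(ltW e0) ?(ltW de0)//.
  by congr (_ `^ _); field; rewrite gt_eqF.
by apply: complete_square; rewrite gt_eqF.
Qed.

Lemma integral_gauss1_mul d e u v : 0 < d -> 0 < e ->
  (\int[mu]_t (gauss1 d (u - t) * gauss1 e (v - t))%:E = (gauss1 (d + e) (u - v))%:E)%E.
Proof.
move=> d0 e0; under eq_integral do rewrite gauss1_mul// EFinM.
rewrite ge0_integralZl_EFin//; last 3 first.
- by move=> t _; rewrite lee_fin gauss1_ge0.
- by apply/measurable_EFinP; apply: measurable_gauss1 => //; exact: measurable_funB.
- exact: gauss1_ge0.
by rewrite integral_gauss1 ?mule1// divr_gt0 ?mulr_gt0 ?addr_gt0.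
Qed.

End Gauss1.

Section GaussN.
Context {R : realType} {n : nat}.
Implicit Types (d : R) (x : 'rV[R]_n).

Definition gauss d x : R := \prod_(j < n) gauss1 d (x ord0 j).

Lemma gauss_ge0 d x : 0 <= gauss d x.
Proof. by apply: prodr_ge0 => j _; exact: gauss1_ge0. Qed.

Lemma measurable_gauss dd (T : measurableType dd) (f : T -> R) (g : T -> 'rV[R]_n) :
  measurable_fun setT f -> measurable_fun setT g ->
  measurable_fun setT (fun z => gauss (f z) (g z)).
Proof.
move=> mf mg; apply: measurable_prod => j _; apply: measurable_gauss1 => //.
exact: (measurableT_comp (measurable_mx_coord _ _) mg).
Qed.

Lemma gaussE d x : 0 < d ->
  gauss d x = d `^ (- (n%:R / 2)) * expR (- (pi * sqr_norm2 x / d)).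
Proof.
move=> d0; rewrite /gauss big_split/= prodr_const card_ord; congr (_ * _).
  by rewrite -powR_mulrn ?powR_ge0// -powRrM; congr (_ `^ _); ring.
rewrite -expR_sum; congr expR.
by rewrite sumrN -mulr_suml -mulr_sumr.
Qed.

Lemma integral_gauss d : 0 < d -> (\int[lebesgue_rV R n]_x (gauss d x)%:E = 1)%E.
Proof.
move=> d0; rewrite /gauss; under eq_integral do rewrite -prodEFin.
rewrite (ge0_integral_prod_rV (F := fun _ t => (gauss1 d t)%:E)); last 2 first.
- by move=> _; apply/measurable_EFinP; exact: measurable_gauss1.
- by move=> _ t; rewrite lee_fin gauss1_ge0.
rewrite big1// => j _; rewrite -(integral_gauss1 0 d0).
by apply: eq_integral => t _; rewrite subr0.
Qed.

Lemma integral_gauss_mul d e x w : 0 < d -> 0 < e ->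
  (\int[lebesgue_rV R n]_y (gauss d (x - y) * gauss e (w - y))%:E =
   (gauss (d + e) (x - w))%:E)%E.
Proof.
move=> d0 e0.
under eq_integral => y _.
  rewrite /gauss -big_split/=.
  under eq_bigr do rewrite !mxE.
  rewrite -prodEFin; over.
rewrite (ge0_integral_prod_rV (F := fun j t =>
  (gauss1 d (x ord0 j - t) * gauss1 e (w ord0 j - t))%:E)); last 2 first.
- move=> j; apply/measurable_EFinP; apply: measurable_funM;
    by apply: measurable_gauss1 => //; exact: measurable_funB.
- by move=> j t; rewrite lee_fin mulr_ge0 ?gauss1_ge0.
rewrite /gauss -prodEFin; apply: eq_bigr => j _.
by rewrite integral_gauss1_mul// !mxE.
Qed.

(** The Gaussian factor controls |x| >= sqrt d, and the exponential factor makes up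
    for the missing power d^(-(r-n)/2) when r exceeds n. *)
Lemma gauss_le_powR (r : R) : n%:R <= r ->
  exists2 C : R, 0 < C & forall d x, 0 < d ->
    expR (- (d / (4 * pi))) * gauss d x <= C * (sqr_norm2 x + d) `^ (- (r / 2)).
Proof.
move=> nr; have r0 : 0 <= r by exact: le_trans nr.
have pi0 : 0 < pi :> R by exact: pi_gt0.
have pi1 : 1 <= pi :> R by apply: le_trans (pi_ge2 R); rewrite ler1n.
have r2 : 0 <= r / 2 by rewrite divr_ge0.
have rn2 : 0 <= (r - n%:R) / 2 by rewrite divr_ge0// subr_ge0.
have [C1 C10 H1] := expRN_le_powR r2.
have [C2 C20 H2] := expRN_le_powR rn2.
pose c := (4 * pi) `^ ((r - n%:R) / 2).
have c0 : 0 < c by rewrite powR_gt0// mulr_gt0.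
exists (C2 * c * C1); first by rewrite !mulr_gt0.
move=> d x d0; set A := sqr_norm2 x.
have A0 : 0 <= A by exact: sqr_norm2_ge0.
have Ad : 0 < A + d by rewrite ltr_wpDl.
have p4 : 0 < 4 * pi :> R by rewrite mulr_gt0.
have B2 : expR (- (d / (4 * pi))) <= C2 * c * d `^ (- ((r - n%:R) / 2)).
  have d4 : 0 < d / (4 * pi) by rewrite divr_gt0.
  apply: (le_trans (H2 _ (ltW d4))); rewrite -mulrA; apply: ler_wpM2l; first exact: ltW.
  apply: (@le_trans _ _ ((d / (4 * pi)) `^ (- ((r - n%:R) / 2)))).
    by apply: ler_powRN => //; rewrite lerDr.
  rewrite powRM ?(ltW d0) ?invr_ge0 ?(ltW p4)// mulrC; apply: ler_wpM2r; first exact: powR_ge0.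
  by rewrite /c -(powR_inv1 (ltW p4)) -powRrM mulN1r opprK.
have B1 : expR (- (pi * A / d)) <= C1 * (d `^ (r / 2) * (A + d) `^ (- (r / 2))).
  have Ad0 : 0 <= pi * A / d by rewrite divr_ge0 ?mulr_ge0// ltW.
  apply: (le_trans (H1 _ Ad0)); apply: ler_wpM2l; first exact: ltW.
  have -> : d `^ (r / 2) * (A + d) `^ (- (r / 2)) = ((A + d) / d) `^ (- (r / 2)).
    rewrite powRM ?(ltW Ad) ?invr_ge0 ?(ltW d0)// mulrC; congr (_ * _).
    by rewrite -(powR_inv1 (ltW d0)) -powRrM mulrNN mul1r.
  apply: ler_powRN => //; first by rewrite divr_gt0.
  rewrite mulrDl divff ?gt_eqF// addrC lerD2l ler_wpM2r ?invr_ge0 ?(ltW d0)//.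
  by rewrite ler_peMl.
rewrite gaussE// -/A.
apply: (@le_trans _ _ (C2 * c * d `^ (- ((r - n%:R) / 2)) *
  (d `^ (- (n%:R / 2)) * (C1 * (d `^ (r / 2) * (A + d) `^ (- (r / 2))))))).
  apply: ler_pM; rewrite ?mulr_ge0 ?expR_ge0 ?powR_ge0//.
  by apply: ler_wpM2l; rewrite ?powR_ge0.
have e : d `^ (- ((r - n%:R) / 2)) * d `^ (- (n%:R / 2)) * d `^ (r / 2) = 1.
  by rewrite -!powRD_gt0// (_ : _ + _ = 0) ?powRr0//; ring.
rewrite le_eqVlt; apply/orP; left; apply/eqP.
by rewrite -[RHS]mulr1 -[X in _ = _ * X]e; ring.
Qed.

End GaussN.

Section BesselKernel.
Context {R : realType} {n : nat}.
Notation mu := (@lebesgue_measure R).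
Implicit Types (a d s t : R) (x z : 'rV[R]_n).

(** The mixing measure: the density of a Gamma law of shape a/2 and scale 4 pi,
    extended by 0 to the whole line. *)
Definition bweight a d : R :=
  if 0 < d then ((4 * pi) `^ (a / 2) * Gamma (a / 2))^-1 *
    (d `^ (a / 2 - 1) * expR (- (d / (4 * pi)))) else 0.

Lemma Gamma_ge0 a : 0 <= Gamma a.
Proof.
by apply: Rintegral_ge0 => t _; rewrite mulr_ge0 ?powR_ge0 ?expR_ge0.
Qed.

Definition bconst a : R := ((4 * pi) `^ (a / 2) * Gamma (a / 2))^-1.

Lemma bconst_ge0 a : 0 <= bconst a.
Proof. by rewrite invr_ge0 mulr_ge0 ?powR_ge0 ?Gamma_ge0. Qed.

Lemma bweight_ge0 a d : 0 <= bweight a d.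
Proof.
rewrite /bweight; case: ifP => // _.
by rewrite mulr_ge0 ?bconst_ge0// mulr_ge0 ?powR_ge0 ?expR_ge0.
Qed.

Lemma measurable_bweight a : measurable_fun setT (bweight a).
Proof.
apply: measurable_fun_ifT => //; first exact: measurable_fun_ltr.
apply: measurable_funM => //; apply: measurable_funM; first exact: measurable_powR.
apply: (measurableT_comp (@measurable_expR R)).
apply: (measurable_funN (f := fun d => d / (4 * pi))).
exact: measurable_funM.
Qed.

Lemma integral_bweight a (F : R -> R) :
  (\int[mu]_d (bweight a d * F d)%:E =
   \int[mu]_(d in `]0%R, +oo[) (bweight a d * F d)%:E)%E.
Proof.
rewrite [RHS]integral_mkcond; apply: eq_integral => d _; rewrite patchE.
case: ifPn => //; rewrite notin_setE /= in_itv/= andbT => /negP d0.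
by rewrite /bweight (negbTE d0) mul0r.
Qed.

Lemma bessel_integrandE a x d : 0 < d ->
  bweight a d * gauss d x = bconst a *
    (expR (- (pi * sqr_norm2 x / d)) * expR (- (d / (4 * pi))) *
      d `^ (- ((n%:R - a) / 2)) / d).
Proof.
move=> d0; rewrite /bweight d0 gaussE// -/(bconst a).
have e : d `^ (- ((n%:R - a) / 2)) / d = d `^ (a / 2 - 1) * d `^ (- (n%:R / 2)).
  by rewrite -(powR_inv1 (ltW d0)) -!powRD_gt0//; congr (_ `^ _); field.
by rewrite -[in RHS](mulrA (_ * _)) e; ring.
Qed.

Lemma measurable_bessel_integrand a :
  measurable_fun setT (fun xd : 'rV[R]_n * measurableTypeR R => bweight a xd.2 * gauss xd.2 xd.1).
Proof.
apply: measurable_funM.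
  exact: (measurableT_comp (measurable_bweight a) measurable_snd).
by apply: measurable_gauss; [exact: measurable_snd|exact: measurable_fst].
Qed.

(** The Bessel potential is a mixture of the probability densities gauss d. Integrals
    of Bessel potentials, their convolutions and their Fourier transforms thus
    reduce, by Tonelli's or Fubini's theorem, to those of Gaussians. *)
Lemma bessel_potentialE a x :
  bessel_potential a x = (\int[mu]_d (bweight a d * gauss d x)%:E)%E.
Proof.
rewrite /bessel_potential -/(bconst a) integral_bweight.
have m : measurable_fun (`]0, +oo[ : set (measurableTypeR R)) (fun d =>
    bweight a d * gauss d x).
  apply: measurable_funTS.
  exact: (measurableT_comp (measurable_bessel_integrand a) (measurable_pair1 x)).
have [b0|b_neq0] := eqVneq (bconst a) 0.
  rewrite b0 mul0e integral0_eq// => d /=; rewrite in_itv/= andbT => d0.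
  by rewrite bessel_integrandE// b0 mul0r.
pose f d := (bconst a)^-1 * (bweight a d * gauss d x).
have fE d : 0 < d -> f d = expR (- (pi * sqr_norm2 x / d)) * expR (- (d / (4 * pi))) *
      d `^ (- ((n%:R - a) / 2)) / d.
  by move=> d0; rewrite /f bessel_integrandE// mulKf.
under eq_integral => d.
  rewrite inE /= in_itv/= andbT => d0; rewrite -fE//; over.
rewrite -ge0_integralZl_EFin//; last 3 first.
- by move=> d _; rewrite lee_fin /f; apply: mulr_ge0; [rewrite invr_ge0 bconst_ge0|rewrite mulr_ge0 ?bweight_ge0 ?gauss_ge0].
- by apply/measurable_EFinP; apply: measurable_funM.
- exact: bconst_ge0.
by apply: eq_integral => d _; rewrite -EFinM /f mulVKf.
Qed.

Lemma bessel_potential_ge0 a x : (0 <= bessel_potential a x)%E.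
Proof.
rewrite bessel_potentialE; apply: integral_ge0 => d _.
by rewrite lee_fin mulr_ge0 ?bweight_ge0 ?gauss_ge0.
Qed.

Lemma measurable_bessel_potential a : measurable_fun setT (bessel_potential a : 'rV[R]_n -> \bar R).
Proof.
rewrite (_ : bessel_potential a = fun x => (\int[mu]_d (bweight a d * gauss d x)%:E)%E).
  have m : measurable_fun setT (fun xd : 'rV[R]_n * measurableTypeR R =>
    (bweight a xd.2 * gauss xd.2 xd.1)%:E).
    by apply/measurable_EFinP; exact: measurable_bessel_integrand.
  apply: (measurable_fun_fubini_tonelli_F _ m) => xd.
  by rewrite lee_fin mulr_ge0 ?bweight_ge0 ?gauss_ge0.
by apply/funext => x; rewrite bessel_potentialE.
Qed.

(** The exponential factor of the weight is absorbed in the hypothesis on F; what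
    remains is a beta integral. *)
Lemma bweight_integral_le a A C (F : R -> R) (r : R) : 0 < a -> a / 2 < r -> 0 < A -> 0 <= C ->
  measurable_fun setT F -> (forall d, 0 <= F d) ->
  (forall d, 0 < d -> expR (- (d / (4 * pi))) * F d <= C * (A + d) `^ (- r)) ->
  (\int[mu]_d (bweight a d * F d)%:E <=
   (bconst a * C * (2 * ((a / 2)^-1 + (r - a / 2)^-1)) * A `^ (a / 2 - r))%:E)%E.
Proof.
move=> a0 ar A0 C0 mF F0 FC.
have mg : measurable_fun setT (fun d => (d `^ (a / 2 - 1) * (A + d) `^ (- r))%:E).
  by apply/measurable_EFinP; exact: measurable_beta_integrand.
rewrite integral_bweight.
apply: (@le_trans _ _ (\int[mu]_(d in `]0%R, +oo[)
    ((bconst a * C)%:E * (d `^ (a / 2 - 1) * (A + d) `^ (- r))%:E))%E).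
  apply: ge0_le_integral => //.
  - by move=> d _; rewrite lee_fin mulr_ge0 ?bweight_ge0.
  - apply/measurable_EFinP; apply: measurable_funTS; apply: measurable_funM => //.
    exact: measurable_bweight.
  - by apply: emeasurable_funM => //; exact: measurable_funTS.
  - move=> d /=; rewrite in_itv/= andbT => d0.
    rewrite -EFinM lee_fin /bweight d0 -/(bconst a) -!mulrA.
    apply: ler_wpM2l; first exact: bconst_ge0.
    rewrite [leRHS]mulrCA; apply: ler_wpM2l; first exact: powR_ge0.
    exact: FC.
rewrite ge0_integralZl_EFin//; last 3 first.
- by move=> d _; rewrite lee_fin mulr_ge0 ?powR_ge0.
- exact: measurable_funTS.
- by rewrite mulr_ge0 ?bconst_ge0.
rewrite -(mulrA (bconst a * C)) [in leRHS]EFinM.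
apply: lee_wpmul2l; first by rewrite lee_fin mulr_ge0 ?bconst_ge0.
by apply: integral_beta_le => //; rewrite divr_gt0.
Qed.

Lemma powR_sqr_enorm x (c : R) : sqr_norm2 x `^ c = enorm x `^ (2 * c).
Proof. by rewrite -sqr_enorm -powR_mulrn ?enorm_ge0// -powRrM. Qed.

(** Choosing r = n gives the true singularity |x|^(-(n-a)) when a < n, and large r
    gives decay of any order. *)
Lemma bessel_potential_le a (r : R) : 0 < a -> a < r -> n%:R <= r ->
  exists2 C : R, 0 <= C & forall x, x != 0 ->
    (bessel_potential a x <= (C * enorm x `^ (- (r - a)))%:E)%E.
Proof.
move=> a0 ar nr; have [C C0 H] := gauss_le_powR nr.
exists (bconst a * C * (2 * ((a / 2)^-1 + (r / 2 - a / 2)^-1))).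
  rewrite !mulr_ge0 ?bconst_ge0 ?(ltW C0)// addr_ge0// invr_ge0; lra.
move=> x x0; rewrite bessel_potentialE.
have A0 : 0 < sqr_norm2 x by rewrite -sqr_enorm exprn_gt0// enorm_gt0.
have -> : - (r - a) = 2 * (a / 2 - r / 2) by field.
rewrite -powR_sqr_enorm; apply: bweight_integral_le => //.
- by rewrite ltr_pM2r.
- exact: ltW.
- exact: measurable_gauss.
- by move=> d; exact: gauss_ge0.
- by move=> d; exact: H.
Qed.

(** The convolution of the kernel of order a with itself behaves like the kernel of
    order 2a. By the semigroup law of Gaussians it is the integral over (s, t) of
    bweight a s * bweight a t * gauss (s + t), and a Gaussian of parameter s + t at
    squared distance A is bounded by a product of one factor in s and one in t, since
    A + s + t exceeds both A + s and A + t. *)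
Lemma bessel_selfconv_le a (r : R) : 0 < a -> 2 * a < r -> n%:R <= r ->
  exists2 C : R, 0 <= C & forall x w, x != w ->
    (\int[lebesgue_rV R n]_y (bessel_potential a (x - y) * bessel_potential a (w - y)) <=
      (C * enorm (x - w) `^ (- (r - 2 * a)))%:E)%E.
Proof.
move=> a0 ar nr; have [C C0 H] := gauss_le_powR nr.
pose D := bconst a * (2 * ((a / 2)^-1 + (r / 4 - a / 2)^-1)).
have D0 : 0 <= D.
  rewrite !mulr_ge0 ?bconst_ge0 ?(ltW C0)// addr_ge0// invr_ge0; lra.
exists (C * D ^+ 2); first by rewrite mulr_ge0 ?exprn_ge0// ltW.
move=> x w xw; set z := x - w.
have z0 : z != 0 by rewrite subr_eq0.
have A0 : 0 < sqr_norm2 z by rewrite -sqr_enorm exprn_gt0// enorm_gt0.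
set A := sqr_norm2 z in A0.
have r4 : 0 < r / 4 by lra.
have mgs (y : 'rV[R]_n) : measurable_fun setT (fun d : measurableTypeR R => gauss d y) by exact: measurable_gauss.
have mBg (y : 'rV[R]_n) : measurable_fun setT (fun d : measurableTypeR R => (bweight a d * gauss d y)%:E).
  by apply/measurable_EFinP; apply: measurable_funM; [exact: measurable_bweight|exact: mgs].
have -> : (\int[lebesgue_rV R n]_y (bessel_potential a (x - y) * bessel_potential a (w - y)) =
  \int[mu]_s \int[mu]_t (bweight a s * (bweight a t * gauss (s + t) z))%:E)%E.
  pose F (y : 'rV[R]_n) s t : \bar R := ((bweight a s * gauss s (x - y)) * (bweight a t * gauss t (w - y)))%:E.
  have F0 y s t : (0 <= F y s t)%E.
    by rewrite lee_fin !mulr_ge0 ?bweight_ge0 ?gauss_ge0.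
  have mB (v : 'rV[R]_n) dd (T : measurableType dd) (f : T -> 'rV[R]_n) (g : T -> measurableTypeR R) :
      measurable_fun setT f -> measurable_fun setT g ->
      measurable_fun setT (fun u => bweight a (g u) * gauss (g u) (v - f u)).
    move=> mf mg; apply: measurable_funM; first exact: (measurableT_comp (measurable_bweight a) mg).
    by apply: measurable_gauss => //; exact: measurable_funB_mx.
  have -> : (\int[lebesgue_rV R n]_y (bessel_potential a (x - y) * bessel_potential a (w - y)) =
     \int[lebesgue_rV R n]_y \int[mu]_s \int[mu]_t F y s t)%E.
    apply: eq_integral => y _; rewrite [in LHS]bessel_potentialE -ge0_integralZr//; last 2 first.
    - by move=> s _; rewrite lee_fin mulr_ge0 ?bweight_ge0 ?gauss_ge0.
    - exact: bessel_potential_ge0.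
    apply: eq_integral => s _; rewrite bessel_potentialE -ge0_integralZl_EFin//; last 2 first.
    - by move=> t _; rewrite lee_fin mulr_ge0 ?bweight_ge0 ?gauss_ge0.
    - by rewrite mulr_ge0 ?bweight_ge0 ?gauss_ge0.
  have mF3 : measurable_fun setT (fun u : ('rV[R]_n * measurableTypeR R) * measurableTypeR R =>
      F u.1.1 u.1.2 u.2).
    apply/measurable_EFinP; apply: measurable_funM.
      by apply: mB; [exact: (measurableT_comp measurable_fst measurable_fst)
                    |exact: (measurableT_comp measurable_snd measurable_fst)].
    by apply: mB; [exact: (measurableT_comp measurable_fst measurable_fst)|exact: measurable_snd].
  have mF2 : measurable_fun setT (fun u : 'rV[R]_n * measurableTypeR R =>
      \int[mu]_t F u.1 u.2 t)%E.
    by apply: (measurable_fun_fubini_tonelli_F _ mF3) => u; exact: F0.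
  rewrite (fubini_tonelli (fun u : 'rV[R]_n * measurableTypeR R => \int[mu]_t F u.1 u.2 t)%E mF2);
    last by move=> u; exact: integral_ge0.
  apply: eq_integral => s _ /=.
  have mFs : measurable_fun setT (fun u : 'rV[R]_n * measurableTypeR R => F u.1 s u.2).
    apply/measurable_EFinP; apply: measurable_funM.
      by apply: mB => //; exact: measurable_fst.
    by apply: mB; [exact: measurable_fst|exact: measurable_snd].
  rewrite (fubini_tonelli (fun u : 'rV[R]_n * measurableTypeR R => F u.1 s u.2) mFs);
    last by move=> u; exact: F0.
  apply: eq_integral => t _ /=.
  have [s0|s0] := ltP 0 s; last first.
    rewrite integral0_eq; first by rewrite /bweight ltNge s0 mul0r.
    by move=> y _; rewrite /F /bweight ltNge s0 /= !mul0r.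
  have [t0|t0] := ltP 0 t; last first.
    rewrite integral0_eq; first by rewrite /bweight [0 < t]ltNge t0 mul0r mulr0.
    by move=> y _; rewrite /F /bweight [0 < t]ltNge t0 /= mul0r mulr0.
  rewrite /z mulrA EFinM -(integral_gauss_mul x w s0 t0) -ge0_integralZl_EFin//; last 3 first.
  - by move=> y _; rewrite lee_fin mulr_ge0 ?gauss_ge0.
  - apply/measurable_EFinP; apply: measurable_funM; apply: measurable_gauss => //;
      exact: measurable_funB_mx.
  - by rewrite mulr_ge0 ?bweight_ge0.
  by apply: eq_integral => y _; rewrite -EFinM /F; congr EFin; ring.
pose F d := expR (d / (4 * pi)) * (A + d) `^ (- (r / 4)).
have F0 d : 0 <= F d by rewrite mulr_ge0 ?expR_ge0 ?powR_ge0.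
have mF : measurable_fun setT F.
  apply: measurable_funM.
    by apply: (measurableT_comp (@measurable_expR R)); exact: measurable_funM.
  by apply: (measurableT_comp (measurable_powR _)); exact: measurable_funD.
have bF d : 0 <= bweight a d * F d by rewrite mulr_ge0 ?bweight_ge0.
have mbF : measurable_fun setT (fun d => (bweight a d * F d)%:E).
  by apply/measurable_EFinP; exact: (measurable_funM (measurable_bweight a) mF).
have IF : (\int[mu]_d (bweight a d * F d)%:E <= (D * A `^ (a / 2 - r / 4))%:E)%E.
  have := @bweight_integral_le a A 1 F (r / 4) a0 _ A0 ler01 mF F0; rewrite mulr1; apply.
  - by lra.
  - by move=> d d0; rewrite mul1r /F mulrA -expRD addNr expR0 mul1r.
have pw s t : bweight a s * (bweight a t * gauss (s + t) z) <=
    C * (bweight a s * F s) * (bweight a t * F t).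
  have [s0|s0] := ltP 0 s; last by rewrite /bweight ltNge s0 !(mul0r, mulr0).
  have [t0|t0] := ltP 0 t; last by rewrite /bweight [0 < t]ltNge t0 !(mul0r, mulr0).
  rewrite (_ : C * _ * _ = bweight a s * (bweight a t * (C * F s * F t))); last by ring.
  do 2 (apply: ler_wpM2l; first exact: bweight_ge0).
  have st0 : 0 < s + t by rewrite addr_gt0.
  have As : 0 < A + s by rewrite addr_gt0.
  have At : 0 < A + t by rewrite addr_gt0.
  have Ast : 0 < A + (s + t) by rewrite addr_gt0.
  have h : (A + (s + t)) `^ (- (r / 2)) <= (A + s) `^ (- (r / 4)) * (A + t) `^ (- (r / 4)).
    have -> : - (r / 2) = - (r / 4) + - (r / 4) by field.
    rewrite powRD_gt0//; apply: ler_pM; rewrite ?powR_ge0//; apply: ler_powRN => //; lra.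
  have := H (s + t) z st0; rewrite -/A expRN -ler_pdivlMl ?invr_gt0 ?expR_gt0// invrK.
  move=> /le_trans; apply; rewrite mulrCA -!mulrA; apply: ler_wpM2l; first exact: ltW.
  rewrite /F mulrDl expRD.
  rewrite [leRHS]mulrA [leRHS]mulrACA.
  by apply: ler_wpM2l => //; rewrite mulr_ge0 ?expR_ge0.
have mpw : measurable_fun setT (fun u : measurableTypeR R * measurableTypeR R =>
    (bweight a u.1 * (bweight a u.2 * gauss (u.1 + u.2) z))%:E).
  apply/measurable_EFinP; apply: measurable_funM.
    exact: (measurableT_comp (measurable_bweight a) measurable_fst).
  apply: measurable_funM.
    exact: (measurableT_comp (measurable_bweight a) measurable_snd).
  apply: measurable_gauss => //.
  by apply: measurable_funD; [exact: measurable_fst|exact: measurable_snd].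
have pw0 s t : 0 <= bweight a s * (bweight a t * gauss (s + t) z).
  by rewrite !mulr_ge0 ?bweight_ge0 ?gauss_ge0.
pose I := (\int[mu]_d (bweight a d * F d)%:E)%E.
have I0 : (0 <= I)%E by apply: integral_ge0 => d _; rewrite lee_fin.
have inner s : (\int[mu]_t (bweight a s * (bweight a t * gauss (s + t) z))%:E <=
    (C * (bweight a s * F s))%:E * I)%E.
  rewrite -ge0_integralZl_EFin//; last 2 first.
  - by move=> t _; rewrite lee_fin.
  - by rewrite mulr_ge0// ltW.
  apply: ge0_le_integral => //.
  - by move=> t _; rewrite lee_fin.
  - exact: (measurableT_comp mpw (measurable_pair1 s)).
  - exact: emeasurable_funM.
  - by move=> t _; rewrite -EFinM lee_fin.
apply: (@le_trans _ _ (C%:E * (I * I))%E).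
  apply: (@le_trans _ _ (\int[mu]_s ((C%:E * (bweight a s * F s)%:E) * I))%E).
    apply: ge0_le_integral => //.
    - by move=> s _; apply: integral_ge0 => t _; rewrite lee_fin.
    - by apply: (measurable_fun_fubini_tonelli_F _ mpw) => u; rewrite lee_fin.
    - by apply: emeasurable_funM => //; exact: emeasurable_funM.
  rewrite ge0_integralZr//; last 2 first.
  - exact: emeasurable_funM.
  - by move=> s _; rewrite -EFinM lee_fin mulr_ge0// ltW.
  rewrite ge0_integralZl_EFin ?(ltW C0)//; first by rewrite muleA.
  by move=> s _; rewrite lee_fin.
have -> : (C * D ^+ 2 * enorm z `^ (- (r - 2 * a)))%:E =
   (C%:E * ((D * A `^ (a / 2 - r / 4))%:E * (D * A `^ (a / 2 - r / 4))%:E))%E.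
  have -> : enorm z `^ (- (r - 2 * a)) = A `^ (a / 2 - r / 4) * A `^ (a / 2 - r / 4).
    by rewrite -powRD_gt0// /A powR_sqr_enorm; congr (_ `^ _); field.
  by rewrite -!EFinM; congr EFin; ring.
apply: lee_wpmul2l; first by rewrite lee_fin ltW.
by apply: lee_pmul.
Qed.

End BesselKernel.

(** * Quadratic forms of products of Bessel-like kernels *)

Section ProductKernel.
Context {R : realType} (n m : nat) (alpha : 'I_m -> R).
Hypotheses (n_gt0 : (0 < n)%N) (m_gt0 : (0 < m)%N).
Hypothesis halpha : forall k, 0 < alpha k < n%:R.
Let lam : R := (m * n)%:R - \sum_(k < m) alpha k.
Hypothesis lam_lt : lam < n%:R.

Lemma lam_sum : lam = \sum_(k < m) (n%:R - alpha k).
Proof.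
rewrite big_split/= sumrN sumr_const card_ord /lam; congr (_ - _).
by rewrite mulnC mulrnA.
Qed.

Lemma lam_gt0 : 0 < lam.
Proof.
rewrite lam_sum (bigD1 (Ordinal m_gt0))//= ltr_pwDl//.
  by rewrite subr_gt0; case/andP: (halpha (Ordinal m_gt0)).
by apply: sumr_ge0 => k _; rewrite subr_ge0 ltW//; case/andP: (halpha k).
Qed.

(** Two choices of exponents, one for each regime: n - alpha_k for all k gives the
    total lam, which is optimal near the diagonal; raising each exponent by
    (2n - lam) / m gives the total 2n, which is used at infinity. *)
Lemma prod_le_riesz (T : Type) (z : T -> 'rV[R]_n) (K : 'I_m -> T -> \bar R) :
  (forall k t, 0 <= K k t)%E ->
  (forall k (mu : R), n%:R - alpha k <= mu -> exists2 C : R, 0 <= C &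
     forall t, z t != 0 -> (K k t <= (C * enorm (z t) `^ (- mu))%:E)%E) ->
  exists2 C : R, 0 < C & forall t, (\prod_(k < m) K k t <= C%:E * riesz lam (z t))%E.
Proof.
move=> K0 HK.
have prod_bound (nu : 'I_m -> R) : (forall k, n%:R - alpha k <= nu k) ->
  exists2 C : R, 0 <= C & forall t, z t != 0 ->
    (\prod_(k < m) K k t <= (C * enorm (z t) `^ (- \sum_(k < m) nu k))%:E)%E.
  move=> hnu.
  have /choice[C HC] : forall k, exists C : R, 0 <= C /\
      forall t, z t != 0 -> (K k t <= (C * enorm (z t) `^ (- nu k))%:E)%E.
    by move=> k; have [C C0 H] := HK k _ (hnu k); exists C.
  exists (\prod_(k < m) C k); first by apply: prodr_ge0 => k _; case: (HC k).
  move=> t zt; have r0 : 0 < enorm (z t) by exact: enorm_gt0.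
  have -> : enorm (z t) `^ (- \sum_(k < m) nu k) = \prod_(k < m) enorm (z t) `^ (- nu k).
    rewrite -sumrN; elim/big_rec2: _ => [|k y1 y2 _ <-]; first by rewrite powRr0.
    by rewrite powRD_gt0.
  rewrite -big_split/= -prodEFin; apply: lee_prod => k _.
  by rewrite K0/=; have [_] := HC k; apply.
have [C1 C10 H1] := prod_bound (fun k => n%:R - alpha k) (fun=> lexx _).
have n2 : 0 <= 2 * n%:R - lam.
  by rewrite subr_ge0 ltW// (lt_le_trans lam_lt)// ler_peMl// ler1n.
have [|C2 C20 H2] := prod_bound (fun k => n%:R - alpha k + (2 * n%:R - lam) / m%:R).
  by move=> k; rewrite lerDl divr_ge0.
rewrite -lam_sum in H1.
have e2 : \sum_(k < m) (n%:R - alpha k + (2 * n%:R - lam) / m%:R) = 2 * n%:R.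
  rewrite big_split/= -lam_sum sumr_const card_ord -[_ / _ *+ m]mulr_natr divfK; first by ring.
  by rewrite pnatr_eq0 -lt0n.
rewrite e2 in H2.
pose D := C1 + C2 + 1.
have D0 : 0 < D by rewrite ltr_wpDl// addr_ge0.
exists (D * 2 `^ (2 * n%:R - lam)); first by rewrite mulr_gt0// powR_gt0.
move=> t; have [zt|zt] := eqVneq (z t) 0.
  rewrite /riesz zt eqxx gt0_muley ?leey// lte_fin mulr_gt0// powR_gt0//.
rewrite /riesz (negbTE zt) -EFinM /riesz_fun; set r := enorm (z t).
have r0 : 0 < r by exact: enorm_gt0.
have r1 : 0 < 1 + r by rewrite addr_gt0.
set e := 2 * n%:R - lam in n2 *.
have e1 : 2 `^ e * 2 `^ (- e) = 1 :> R by rewrite -powRD_gt0// subrr powRr0.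
have [rle1|rgt1] := leP r 1.
  apply: (le_trans (H1 t zt)); rewrite lee_fin -/r.
  rewrite (_ : D * _ * _ = D * (r `^ (- lam) * (2 `^ e * (1 + r) `^ (- e)))); last by ring.
  apply: ler_pM => //; first exact: powR_ge0.
    by rewrite /D -addrA lerDl addr_ge0.
  rewrite ler_peMr ?powR_ge0// -[X in X <= _]e1; apply: ler_wpM2l; first exact: powR_ge0.
  by apply: ler_powRN => //; lra.
apply: (le_trans (H2 t zt)); rewrite lee_fin -/r.
have -> : - (2 * n%:R) = - lam + - e :> R by rewrite /e; ring.
rewrite powRD_gt0//.
rewrite (_ : D * _ * _ = D * (r `^ (- lam) * (2 `^ e * (1 + r) `^ (- e)))); last by ring.
apply: ler_pM => //; first by rewrite mulr_ge0 ?powR_ge0.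
  by rewrite /D addrAC lerDr addr_ge0.
apply: ler_wpM2l; first exact: powR_ge0.
rewrite -[leLHS]mul1r -[X in X * _ <= _]e1 -mulrA; apply: ler_wpM2l; first exact: powR_ge0.
rewrite -powRM ?(ltW r0)//; apply: ler_powRN => //; lra.
Qed.

End ProductKernel.

Section BesselForm.
Context {R : realType} (n m : nat) (alpha : 'I_m -> R) (p q : R).
Hypotheses (n_gt0 : (0 < n)%N) (m_gt0 : (0 < m)%N).
Hypothesis halpha : forall k, 0 < alpha k < n%:R.
Let lam : R := (m * n)%:R - \sum_(k < m) alpha k.
Hypothesis lam_lt : lam < n%:R.
Hypotheses (q_ge2 : 2 <= q) (hq : q <= 2 * n%:R / lam) (pq : p^-1 + q^-1 = 1).

Lemma poweR_sqr (x : \bar R) (r : R) : r != 0 -> (0 <= x)%E ->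
  ((x `^ r) ^+ 2 = x `^ (2 * r))%E.
Proof.
move=> r0 x0; rewrite expe2 mulr_natl mulr2n poweRD//.
by apply: add_neq0_poweRD_def; rewrite -mulr2n mulrn_eq0.
Qed.

Lemma exponent_gt0 : 0 < lam. Proof. by apply: lam_gt0. Qed.

Lemma q_lam_le : q * lam <= 2 * n%:R.
Proof. by rewrite -ler_pdivlMr// exponent_gt0. Qed.

(** Stated for arbitrary factors because it serves twice: for Bessel potentials of
    order alpha_k, and for self-convolutions of those of order alpha_k / 2. *)
Lemma prod_form_le (T1 : 'I_m -> 'rV[R]_n * 'rV[R]_n -> \bar R) :
  (forall k, measurable_fun setT (T1 k)) ->
  (forall k t, 0 <= T1 k t)%E ->
  (forall k (mu : R), n%:R - alpha k <= mu -> exists2 C : R, 0 <= C &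
     forall t, t.1 - t.2 != 0 -> (T1 k t <= (C * enorm (t.1 - t.2) `^ (- mu))%:E)%E) ->
  exists2 C : R, 0 < C & forall h : 'rV[R]_n -> R,
    measurable_fun setT h -> (forall x, 0 <= h x) ->
    (\int[lebesgue_rV R n]_x \int[lebesgue_rV R n]_w
      ((h x)%:E * (\prod_(k < m) T1 k (x, w)) * (h w)%:E) <=
     C%:E * (\int[lebesgue_rV R n]_x (h x `^ p)%:E) `^ (2 / p))%E.
Proof.
move=> mT T0 HT.
have [C1 C10 H1] := prod_le_riesz m_gt0 lam_lt T0 HT.
have [C2 C20 H2] := riesz_form_le n_gt0 exponent_gt0 lam_lt q_ge2 q_lam_le pq.
exists (C1 * C2); first exact: mulr_gt0.
move=> h mh h0; rewrite EFinM -muleA.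
apply: le_trans (lee_wpmul2l _ (H2 h mh h0)); last by rewrite lee_fin ltW.
have P0 t : (0 <= \prod_(k < m) T1 k t)%E by exact: prode_ge0.
have mL := measurable_kernel_form mh (emeasurable_prod (index_enum _) mT).
have L0 z : (0 <= (h z.1)%:E * (\prod_(k < m) T1 k z) * (h z.2)%:E)%E.
  by rewrite !mule_ge0 ?lee_fin.
have mR : measurable_fun setT (fun z : 'rV[R]_n * 'rV[R]_n =>
    ((h z.1)%:E * riesz lam (z.1 - z.2) * (h z.2)%:E)%E).
  apply: (measurable_kernel_form (K := fun z : 'rV[R]_n * 'rV[R]_n => riesz lam (z.1 - z.2))) => //.
  by apply: (measurableT_comp (measurable_riesz lam)); exact: measurable_funB_mx.
have R0 z : (0 <= (h z.1)%:E * riesz lam (z.1 - z.2) * (h z.2)%:E)%E.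
  by rewrite !mule_ge0 ?lee_fin ?riesz_ge0.
rewrite -(fubini_tonelli1 _ mL L0) -(fubini_tonelli1 _ mR R0).
rewrite -ge0_integralZl_EFin ?(ltW C10)//.
apply: ge0_le_integral => //.
- exact: emeasurable_funM.
- move=> z _; rewrite muleA; apply: lee_wpmul2r; first by rewrite lee_fin.
  rewrite muleCA; apply: lee_wpmul2l; first by rewrite lee_fin.
  exact: H1.
Qed.

Let p_gt0 : 0 < p.
Proof.
have q0 : 0 < q by exact: lt_le_trans q_ge2.
have qi : q^-1 <= 2^-1 by rewrite lef_pV2 ?posrE.
by rewrite -invr_gt0; move: pq qi; lra.
Qed.

Theorem bessel_product_form_le : exists2 C : R, 0 < C &
  forall h : 'rV[R]_n -> R, h \in Lfun (lebesgue_rV R n) p%:E ->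
  (\int[lebesgue_rV R n \x lebesgue_rV R n]_z
          ((h z.1)%:E *
           (\prod_(k < m) bessel_potential (alpha k) (z.1 - z.2)) *
           (h z.2)%:E)
        <= C%:E * ('N[lebesgue_rV R n]_p%:E[EFin \o h]) ^+ 2)%E.
Proof.
pose T1 (k : 'I_m) (t : 'rV[R]_n * 'rV[R]_n) := bessel_potential (alpha k) (t.1 - t.2).
have mT k : measurable_fun setT (T1 k).
  by apply: (measurableT_comp (measurable_bessel_potential _)); exact: measurable_funB_mx.
have T0 k t : (0 <= T1 k t)%E by exact: bessel_potential_ge0.
have [|C C0 H] := prod_form_le mT T0.
  move=> k mu hmu; have /andP[a0 an] := halpha k.
  have [|||C C0 HC] := @bessel_potential_le R n (alpha k) (mu + alpha k) => //; [lra|lra|].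
  by exists C => // t t0; have := HC _ t0; rewrite addrK.
exists C => // h hL.
have mh : measurable_fun setT h by have := sub_Lfun_mfun hL; rewrite inE.
pose g x := `|h x|.
have mg : measurable_fun setT g by exact: measurableT_comp.
have g0 x : 0 <= g x by exact: normr_ge0.
have P0 t : (0 <= \prod_(k < m) T1 k t)%E by exact: prode_ge0.
have mf (f : 'rV[R]_n -> R) (mf : measurable_fun setT f) :=
  measurable_kernel_form mf (emeasurable_prod (index_enum _) mT).
have -> : ('N[lebesgue_rV R n]_p%:E[EFin \o h] ^+ 2 =
    (\int[lebesgue_rV R n]_x (g x `^ p)%:E) `^ (2 / p))%E.
  have -> : ('N[lebesgue_rV R n]_p%:E[EFin \o h] =
      (\int[lebesgue_rV R n]_x (g x `^ p)%:E) `^ p^-1)%E by rewrite unlock.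
  rewrite poweR_sqr ?invr_eq0 ?gt_eqF//.
  by apply: integral_ge0 => x _; rewrite lee_fin powR_ge0.
apply: le_trans (H g mg g0).
rewrite -(fubini_tonelli1 _ (mf g mg)); last first.
  by move=> z; rewrite !mule_ge0 ?lee_fin.
apply: (le_trans (lee_abs _)).
apply: (le_trans (le_abse_integral _ _ (mf h mh))) => //.
rewrite le_eqVlt; apply/orP; left; apply/eqP; apply: eq_integral => z _.
by rewrite !abseM (gee0_abs (P0 z)).
Qed.

End BesselForm.

Local Open Scope complex_scope.

(** * Complex-valued integration *)

Section ComplexAlgebra.
Context {R : realType}.
Implicit Types z w : R[i].
Notation Re := complex.Re.
Notation Im := complex.Im.
Notation normc := Normc.normc.

Lemma cReM z w : Re (z * w) = Re z * Re w - Im z * Im w.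
Proof. by case: z w => [a b] [c d]. Qed.

Lemma cImM z w : Im (z * w) = Re z * Im w + Im z * Re w.
Proof. by case: z w => [a b] [c d]. Qed.

Lemma cReD z w : Re (z + w) = Re z + Re w.
Proof. by case: z w => [a b] [c d]. Qed.

Lemma cImD z w : Im (z + w) = Im z + Im w.
Proof. by case: z w => [a b] [c d]. Qed.

Lemma complex_eq z w : Re z = Re w -> Im z = Im w -> z = w.
Proof. by case: z w => [a b] [c d] /= -> ->. Qed.

Lemma normc_ge0 z : 0 <= normc z.
Proof. by case: z => a b; exact: sqrtr_ge0. Qed.

Lemma Re_le_normc z : `|Re z| <= normc z.
Proof.
case: z => a b /=; rewrite -sqrtr_sqr; apply: ler_wsqrtr.
by rewrite lerDl sqr_ge0.
Qed.

Lemma Im_le_normc z : `|Im z| <= normc z.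
Proof.
case: z => a b /=; rewrite -sqrtr_sqr; apply: ler_wsqrtr.
by rewrite lerDr sqr_ge0.
Qed.

Lemma normc_le z : normc z <= `|Re z| + `|Im z|.
Proof.
case: z => a b /=; rewrite -(@ler_pXn2r _ 2)// ?nnegrE ?sqrtr_ge0 ?addr_ge0//.
rewrite sqr_sqrtr ?addr_ge0 ?sqr_ge0// sqrrD !real_normK ?num_real//.
by rewrite addrAC lerDl mulrn_wge0// mulr_ge0.
Qed.

Lemma normc_real (x : R) : normc x%:C = `|x|.
Proof. by rewrite /= expr0n/= addr0 sqrtr_sqr. Qed.

Lemma normc_expi (t : R) : normc (expi t) = 1.
Proof. by rewrite /= cos2Dsin2 sqrtr1. Qed.

Lemma expiD (s t : R) : expi (s + t) = expi s * expi t.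
Proof.
apply: complex_eq; rewrite ?cReM ?cImM /=; first exact: cosD.
by rewrite sinD addrC.
Qed.

Lemma expi0 : expi 0 = 1 :> R[i].
Proof. by rewrite /expi cos0 sin0. Qed.

End ComplexAlgebra.

Section RealIntegral.
Context {R : realType} d1 d2 (T1 : measurableType d1) (T2 : measurableType d2).
Variables (m1 : {sigma_finite_measure set T1 -> \bar R})
  (m2 : {sigma_finite_measure set T2 -> \bar R}).
Variable f : T1 * T2 -> R.

(** Real-valued integrals are 0 where the integral diverges or is undefined; going
    through positive and negative parts shows measurability even so. *)
Lemma measurable_Rintegral_fst : measurable_fun setT f ->
  measurable_fun setT (fun x => \int[m2]_y f (x, y)).
Proof.
move=> mf; apply: measurableT_comp => //.
have mfe : measurable_fun setT (EFin \o f) by exact/measurable_EFinP.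
rewrite (_ : (fun x => _) = (fun x => \int[m2]_y ((EFin \o f)^\+ (x, y)) -
    \int[m2]_y ((EFin \o f)^\- (x, y)))%E).
  apply: emeasurable_funB.
    by apply: (measurable_fun_fubini_tonelli_F (EFin \o f)^\+%E) => //; exact: measurable_funepos.
  by apply: (measurable_fun_fubini_tonelli_F (EFin \o f)^\-%E) => //; exact: measurable_funeneg.
apply/funext => x; rewrite integralE.
by congr (_ - _)%E; apply: eq_integral => y _; rewrite ?funeposE ?funenegE.
Qed.

Hypothesis intf : (m1 \x m2)%E.-integrable setT (EFin \o f).

Let mf : measurable_fun setT f.
Proof. by apply/measurable_EFinP; exact: measurable_int intf. Qed.

Let mF : measurable_fun setT (fun x => (\int[m2]_y f (x, y))%:E).
Proof. by apply/measurable_EFinP; exact: measurable_Rintegral_fst. Qed.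

Let ae_fine : ae_eq m1 setT (fubini_F m2 (EFin \o f)) (fun x => (\int[m2]_y f (x, y))%:E).
Proof.
have := integrable_ae measurableT (integrable_fubini_F intf).
apply: filterS => x /(_ Logic.I) h _.
by rewrite /Rintegral fineK.
Qed.

Lemma Rintegral_prod_fst :
  \int[m1]_x \int[m2]_y f (x, y) = Rintegral (m1 \x m2)%E setT f.
Proof.
congr fine; rewrite -(integral12_prod_meas1 intf).
by apply: ae_eq_integral => //; [exact: measurable_fubini_F intf|exact: ae_eq_sym].
Qed.

End RealIntegral.

Section RealIntegralSwap.
Context {R : realType} d1 d2 (T1 : measurableType d1) (T2 : measurableType d2).
Variables (m1 : {sigma_finite_measure set T1 -> \bar R})
  (m2 : {sigma_finite_measure set T2 -> \bar R}).
Variable f : T1 * T2 -> R.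
Hypothesis intf : (m1 \x m2)%E.-integrable setT (EFin \o f).

Let swapf (z : T2 * T1) := f (z.2, z.1).

Lemma integrable_swap : (m2 \x m1)%E.-integrable setT (EFin \o swapf).
Proof.
have mf : measurable_fun setT f by apply/measurable_EFinP; exact: measurable_int intf.
have msf : measurable_fun setT swapf.
  by apply: (measurableT_comp mf); apply: measurable_fun_pair;
    [exact: measurable_snd|exact: measurable_fst].
have /integrable21ltyP H : measurable_fun setT (EFin \o f) by exact/measurable_EFinP.
apply/integrable12ltyP; first exact/measurable_EFinP.
by have [+ _] := H m1 m2; apply.
Qed.

Lemma Rintegral_swap :
  \int[m1]_x \int[m2]_y f (x, y) = \int[m2]_y \int[m1]_x f (x, y).
Proof.
rewrite (Rintegral_prod_fst intf) (Rintegral_prod_fst integrable_swap).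
congr fine; rewrite -(integral21_prod_meas1 intf).
by rewrite -(integral12_prod_meas1 integrable_swap).
Qed.

End RealIntegralSwap.

Section ComplexIntegral.
Context {R : realType} d (T : measurableType d) (mu : {measure set T -> \bar R}).
Notation Re := complex.Re.
Notation Im := complex.Im.
Notation normc := Normc.normc.
Implicit Types f g : T -> R[i].

Definition cmeasurable f :=
  measurable_fun setT (fun x => Re (f x)) /\ measurable_fun setT (fun x => Im (f x)).

(** Integrability is expressed through the modulus rather than through real and
    imaginary parts, since the modulus is multiplicative. *)
Definition cintegrable f :=
  cmeasurable f /\ (\int[mu]_x (normc (f x))%:E < +oo)%E.

Lemma cmeasurableM f g : cmeasurable f -> cmeasurable g -> cmeasurable (fun x => f x * g x).
Proof.
move=> [rf if_] [rg ig]; split.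
  under eq_fun do rewrite cReM.
  by apply: measurable_funB; apply: measurable_funM.
under eq_fun do rewrite cImM.
by apply: measurable_funD; apply: measurable_funM.
Qed.

Lemma cmeasurable_real (f : T -> R) : measurable_fun setT f -> cmeasurable (fun x => (f x)%:C).
Proof. by move=> mf; split. Qed.

Lemma cmeasurable_cst (c : R[i]) : cmeasurable (fun=> c).
Proof. by split; exact: measurable_cst. Qed.

Lemma cmeasurable_expi (f : T -> R) : measurable_fun setT f -> cmeasurable (fun x => expi (f x)).
Proof.
move=> mf; split => /=.
  apply: (measurableT_comp _ mf).
  by apply: continuous_measurable_fun; exact: continuous_cos.
apply: (measurableT_comp _ mf).
by apply: continuous_measurable_fun; exact: continuous_sin.
Qed.

Lemma measurable_normc f : cmeasurable f -> measurable_fun setT (fun x => normc (f x)).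
Proof.
move=> [rf if_].
rewrite (_ : (fun x => _) = (fun x => (Re (f x) ^+ 2 + Im (f x) ^+ 2) `^ 2^-1)).
  apply: (measurableT_comp (measurable_powR _)).
  by apply: measurable_funD; apply: measurable_funX.
by apply/funext => x; case: (f x) => a b /=; rewrite powR12_sqrt ?addr_ge0 ?sqr_ge0.
Qed.

Lemma cintegrable_le f (g : T -> R) : cmeasurable f -> (forall x, normc (f x) <= g x) ->
  mu.-integrable setT (EFin \o g) -> cintegrable f.
Proof.
move=> mf fg /integrableP[mg oo]; split => //; apply: le_lt_trans oo.
apply: ge0_le_integral => //.
- by move=> x _; rewrite lee_fin normc_ge0.
- by apply/measurable_EFinP; exact: measurable_normc.
- by apply: measurableT_comp.
- move=> x _ /=; rewrite lee_fin ger0_norm//.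
  exact: le_trans (normc_ge0 _) (fg x).
Qed.

Lemma cintegrable_norm f : cintegrable f -> mu.-integrable setT (fun x => (normc (f x))%:E).
Proof.
move=> [mf foo]; apply/integrableP; split.
  by apply/measurable_EFinP; exact: measurable_normc.
by under eq_integral do rewrite /= ger0_norm ?normc_ge0//.
Qed.

Lemma cintegrable_Re f : cintegrable f -> mu.-integrable setT (EFin \o (fun x => Re (f x))).
Proof.
move=> fi; apply: le_integrable (cintegrable_norm fi) => //.
  by apply/measurable_EFinP; case: fi => -[].
by move=> x _ /=; rewrite lee_fin [leRHS]ger0_norm ?normc_ge0// Re_le_normc.
Qed.

Lemma cintegrable_Im f : cintegrable f -> mu.-integrable setT (EFin \o (fun x => Im (f x))).
Proof.
move=> fi; apply: le_integrable (cintegrable_norm fi) => //.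
  by apply/measurable_EFinP; case: fi => -[].
by move=> x _ /=; rewrite lee_fin [leRHS]ger0_norm ?normc_ge0// Im_le_normc.
Qed.

Lemma eq_cintegral f g : f =1 g -> cintegral mu f = cintegral mu g.
Proof. by move=> /funext ->. Qed.

Lemma eq_cintegrable f g : f =1 g -> cintegrable f -> cintegrable g.
Proof. by move=> /funext ->. Qed.

Lemma cintegrableZl (c : R[i]) f : cintegrable f -> cintegrable (fun x => c * f x).
Proof.
move=> fi; have [mf _] := fi.
apply: (@cintegrable_le _ (fun x => normc c * normc (f x))).
- by apply: cmeasurableM => //; exact: cmeasurable_cst.
- by move=> x; rewrite Normc.normcM.
- rewrite (_ : EFin \o _ = (fun x => (normc c)%:E * (normc (f x))%:E)%E) //.
  by apply: integrableZl => //; exact: cintegrable_norm.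
Qed.

Lemma cintegralZl (c : R[i]) f : cintegrable f ->
  cintegral mu (fun x => c * f x) = c * cintegral mu f.
Proof.
move=> fi; have fr := cintegrable_Re fi; have fI := cintegrable_Im fi.
apply: complex_eq; rewrite ?cReM ?cImM /=.
  under eq_Rintegral do rewrite cReM.
  rewrite RintegralB//; last 2 first.
  - exact: (integrableZl measurableT (Re c) fr).
  - exact: (integrableZl measurableT (Im c) fI).
  by rewrite !RintegralZl.
under eq_Rintegral do rewrite cImM.
rewrite RintegralD//; last 2 first.
- exact: (integrableZl measurableT (Re c) fI).
- exact: (integrableZl measurableT (Im c) fr).
by rewrite !RintegralZl.
Qed.

Lemma cintegralD f g : cintegrable f -> cintegrable g ->
  cintegral mu (fun x => f x + g x) = cintegral mu f + cintegral mu g.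
Proof.
move=> fi gi; apply: complex_eq; rewrite ?cReD ?cImD /=.
  under eq_Rintegral do rewrite cReD.
  by rewrite RintegralD//; exact: cintegrable_Re.
under eq_Rintegral do rewrite cImD.
by rewrite RintegralD//; exact: cintegrable_Im.
Qed.

(** The factor 2 comes from bounding the real and imaginary parts separately. *)
Lemma normc_cintegral_le f : cintegrable f ->
  ((normc (cintegral mu f))%:E <= 2%:E * \int[mu]_x (normc (f x))%:E)%E.
Proof.
move=> fi; have [mf foo] := fi.
have I0 : (0 <= \int[mu]_x (normc (f x))%:E)%E.
  by apply: integral_ge0 => x _; rewrite lee_fin normc_ge0.
have h (g : T -> R) : mu.-integrable setT (EFin \o g) -> (forall x, `|g x| <= normc (f x)) ->
    (`|\int[mu]_x g x|%:E <= \int[mu]_x (normc (f x))%:E)%E.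
  move=> gi gf; rewrite EFin_normr_Rintegral//.
  have mg := measurable_int _ gi.
  apply: (le_trans (le_abse_integral _ _ mg)) => //.
  apply: ge0_le_integral => //.
  - exact: measurableT_comp.
  - by apply/measurable_EFinP; exact: measurable_normc.
  - by move=> x _ /=; rewrite lee_fin.
have h1 := h _ (cintegrable_Re fi) (fun x => Re_le_normc _).
have h2 := h _ (cintegrable_Im fi) (fun x => Im_le_normc _).
apply: (@le_trans _ _ (`|\int[mu]_x Re (f x)| + `|\int[mu]_x Im (f x)|)%:E).
  by rewrite lee_fin; exact: normc_le (cintegral mu f).
by rewrite EFinD mule_natl mule2n; exact: leeD.
Qed.

Lemma cintegral_real (f : T -> R) : cintegral mu (fun x => (f x)%:C) = (\int[mu]_x f x)%:C.
Proof.
apply: complex_eq => //=; rewrite /Rintegral.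
by rewrite integral0_eq.
Qed.

(** Convergence is taken componentwise, in accordance with the definition of the
    complex integral. *)
Definition ccvg (u : nat -> R[i]) (l : R[i]) :=
  (Re (u k) @[k --> \oo] --> Re l) /\ (Im (u k) @[k --> \oo] --> Im l).

Lemma ccvg_unique u l1 l2 : ccvg u l1 -> ccvg u l2 -> l1 = l2.
Proof.
move=> [r1 i1] [r2 i2]; apply: complex_eq.
  by apply: cvg_unique r1 r2.
by apply: cvg_unique i1 i2.
Qed.

Lemma ccvgM u v l1 l2 : ccvg u l1 -> ccvg v l2 -> ccvg (fun k => u k * v k) (l1 * l2).
Proof.
move=> [r1 i1] [r2 i2]; split; rewrite ?cReM ?cImM.
  under eq_fun do rewrite cReM.
  by apply: cvgB; apply: cvgM.
under eq_fun do rewrite cImM.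
by apply: cvgD; apply: cvgM.
Qed.

Lemma ccvg_cst l : ccvg (fun=> l) l.
Proof. by split; exact: cvg_cst. Qed.

Lemma ccvg_real (u : nat -> R) (l : R) : u @ \oo --> l -> ccvg (fun k => (u k)%:C) l%:C.
Proof. by move=> ul; split => //=; exact: cvg_cst. Qed.

(** Dominated convergence with pointwise hypotheses on a sequence; the integrability
    of the limit is part of the conclusion. *)
Lemma Rdominated_cvg (u : nat -> T -> R) (l g : T -> R) :
  (forall k, measurable_fun setT (u k)) -> mu.-integrable setT (EFin \o g) ->
  (forall x k, `|u k x| <= g x) -> (forall x, u k x @[k --> \oo] --> l x) ->
  mu.-integrable setT (EFin \o l) /\ (\int[mu]_x u k x @[k --> \oo] --> \int[mu]_x l x).
Proof.
move=> mu_ gi ug ul.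
have ml : measurable_fun setT l by apply: (measurable_fun_cvg mu_) => x _; exact: ul.
have mue k : measurable_fun setT (EFin \o u k) by exact/measurable_EFinP.
have mle : measurable_fun setT (EFin \o l) by exact/measurable_EFinP.
have ule x : (EFin \o u k) x @[k --> \oo] --> (EFin \o l) x.
  by apply/fine_cvgP; split; [exact: nearW|exact: ul].
have [li _ lim] := dominated_convergence measurableT mue mle
   (aeW _ (fun x _ => ule x)) gi
   (aeW _ (fun x k _ => ug x k : (`|(EFin \o u k) x| <= (EFin \o g) x)%E)).
split => //; apply: fine_cvg; rewrite fineK//.
exact: integrable_fin_num.
Qed.

Lemma cdominated_cvg (u : nat -> T -> R[i]) (l : T -> R[i]) (g : T -> R) :
  (forall k, cmeasurable (u k)) -> mu.-integrable setT (EFin \o g) ->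
  (forall x k, normc (u k x) <= g x) -> (forall x, ccvg (u ^~ x) (l x)) ->
  ccvg (fun k => cintegral mu (u k)) (cintegral mu l).
Proof.
move=> mu_ gi ug ul; split => /=.
  have [] // := @Rdominated_cvg (fun k x => Re (u k x)) (fun x => Re (l x)) g.
  - by move=> k; case: (mu_ k).
  - by move=> x k; exact: le_trans (Re_le_normc _) (ug x k).
  - by move=> x; case: (ul x).
have [] // := @Rdominated_cvg (fun k x => Im (u k x)) (fun x => Im (l x)) g.
- by move=> k; case: (mu_ k).
- by move=> x k; exact: le_trans (Im_le_normc _) (ug x k).
- by move=> x; case: (ul x).
Qed.

End ComplexIntegral.

Section ComplexFubini.
Context {R : realType} d1 d2 (T1 : measurableType d1) (T2 : measurableType d2).
Variables (m1 : {sigma_finite_measure set T1 -> \bar R})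
  (m2 : {sigma_finite_measure set T2 -> \bar R}).
Notation normc := Normc.normc.

Lemma cmeasurable_comp (f : T2 -> R[i]) (h : T1 -> T2) :
  cmeasurable f -> measurable_fun setT h -> cmeasurable (fun x => f (h x)).
Proof. by move=> [rf if_] mh; split; [exact: measurableT_comp rf mh|exact: measurableT_comp if_ mh]. Qed.

Variable f : T1 * T2 -> R[i].

Lemma cmeasurable_cintegral_fst : cmeasurable f ->
  cmeasurable (fun x => cintegral m2 (fun y => f (x, y))).
Proof.
by move=> [rf if_]; split => /=; [apply: (measurable_Rintegral_fst _ rf)|apply: (measurable_Rintegral_fst _ if_)].
Qed.

Lemma cintegrable_prod : cmeasurable f ->
  (\int[m1]_x \int[m2]_y (normc (f (x, y)))%:E < +oo)%E -> cintegrable (m1 \x m2)%E f.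
Proof.
move=> mf oo; split => //; rewrite (fubini_tonelli1 (fun z => (normc (f z))%:E))//.
- by apply/measurable_EFinP; exact: measurable_normc.
- by move=> z; rewrite lee_fin normc_ge0.
Qed.

Hypothesis fi : cintegrable (m1 \x m2)%E f.

Lemma cintegral_swap :
  cintegral m1 (fun x => cintegral m2 (fun y => f (x, y))) =
  cintegral m2 (fun y => cintegral m1 (fun x => f (x, y))).
Proof.
apply: complex_eq => /=.
  exact: (Rintegral_swap (cintegrable_Re fi)).
exact: (Rintegral_swap (cintegrable_Im fi)).
Qed.

Lemma cintegral_prod_fst :
  cintegral m1 (fun x => cintegral m2 (fun y => f (x, y))) = cintegral (m1 \x m2)%E f.
Proof.
apply: complex_eq => /=.
  exact: (Rintegral_prod_fst (cintegrable_Re fi)).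
exact: (Rintegral_prod_fst (cintegrable_Im fi)).
Qed.

End ComplexFubini.

(** * Integrals of derivatives and the Fourier transform of a Gaussian *)

Section MeasurePreserving.
Context {R : realType} d (T : measurableType d) (mu : {measure set T -> \bar R}).
Variables (tau : T -> T) (a : R).
Hypotheses (a_gt0 : 0 < a) (mtau : measurable_fun setT tau).
Hypothesis tauP : forall f : T -> \bar R, measurable_fun setT f -> (forall x, 0 <= f x)%E ->
  (\int[mu]_x f x = a%:E * \int[mu]_x f (tau x))%E.

Lemma integrable_change (f : T -> R) : mu.-integrable setT (EFin \o f) ->
  mu.-integrable setT (EFin \o (fun x => f (tau x))).
Proof.
move=> /integrableP[mf oo]; apply/integrableP; split; first exact: measurableT_comp mf mtau.
have := tauP (measurableT_comp (@abse_measurable R setT) mf) (fun x => abse_ge0 _).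
move=> E; move: oo; rewrite /= in E *; rewrite E.
have : (0 <= \int[mu]_x `|(f (tau x))%:E|)%E by exact: integral_ge0.
case: (\int[mu]_x _)%E => //=; last by rewrite gt0_muley ?lte_fin.
by move=> r _ _; rewrite ltry.
Qed.

Lemma Rintegral_change (f : T -> R) : mu.-integrable setT (EFin \o f) ->
  \int[mu]_x f x = a * \int[mu]_x f (tau x).
Proof.
move=> fi; have gi := integrable_change fi; have mf := measurable_int _ fi.
rewrite /Rintegral -[a in RHS]/(fine a%:E) -fineM//; last exact: integrable_fin_num.
congr fine; rewrite integralE (tauP (measurable_funepos mf))// (tauP (measurable_funeneg mf))//.
have eP : (fun x => (EFin \o f)^\+ (tau x))%E = (EFin \o (fun x => f (tau x)))^\+%E.
  by apply/funext => x; rewrite !funeposE.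
have eN : (fun x => (EFin \o f)^\- (tau x))%E = (EFin \o (fun x => f (tau x)))^\-%E.
  by apply/funext => x; rewrite !funenegE.
rewrite eP eN -muleBr//; last exact: (integrable_add_def measurableT gi).
by congr (_ * _)%E; rewrite [RHS]integralE.
Qed.

End MeasurePreserving.

Section ZeroDerivative.
Context {R : realType} d (T : measurableType d) (mu : {measure set T -> \bar R}).
Variable (tau : nat -> T -> T).
Hypothesis mtau : forall k, measurable_fun setT (tau k).
Hypothesis tauP : forall k (f : T -> \bar R), measurable_fun setT f -> (forall x, 0 <= f x)%E ->
  (\int[mu]_x f x = 1%:E * \int[mu]_x f (tau k x))%E.

(** The integral of k (f o tau_k - f) vanishes since tau_k preserves the measure, and
    dominated convergence passes to the limit. With tau_k the translation by 1/k
    along a vector, f' is the derivative of f along that vector: this is integration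
    by parts without boundary terms. *)
Lemma Rintegral_derivative_eq0 (f f' G : T -> R) :
  mu.-integrable setT (EFin \o f) -> mu.-integrable setT (EFin \o G) ->
  (forall x k, `|k.+1%:R * (f (tau k x) - f x)| <= G x) ->
  (forall x, k.+1%:R * (f (tau k x) - f x) @[k --> \oo] --> f' x) ->
  mu.-integrable setT (EFin \o f') /\ \int[mu]_x f' x = 0.
Proof.
move=> fi Gi fG ff'.
have fti k := integrable_change ltr01 (mtau k) (tauP k) fi.
have di k : mu.-integrable setT (EFin \o (fun x => f (tau k x) - f x)).
  exact: (integrableB measurableT (fti k) fi).
have mf k : measurable_fun setT (fun x => k.+1%:R * (f (tau k x) - f x)).
  by apply: measurable_funM => //; apply/measurable_EFinP; exact: measurable_int (di k).
have [f'i lim] := Rdominated_cvg mf Gi fG ff'; split => //.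
suff E : (fun k => \int[mu]_x (k.+1%:R * (f (tau k x) - f x))) = (fun=> 0).
  by move: lim; rewrite E => /(cvg_unique _ (cvg_cst 0)) ->.
apply/funext => k; rewrite RintegralZl// RintegralB//.
by rewrite (Rintegral_change ltr01 (mtau k) (tauP k) fi) mul1r subrr mulr0.
Qed.

End ZeroDerivative.

Section Weight.
Context {R : realType}.
Notation mu := (@lebesgue_measure R).
Implicit Types t u s : R.

(** A reference integrable function, comparable to its translates by at most 1, which
    serves to dominate functions and their difference quotients. *)
Definition weight1 t : R := (1 + `|t|) `^ (- 2).

Lemma weight1_gt0 t : 0 < weight1 t.
Proof. by rewrite powR_gt0// ltr_pwDl. Qed.

Lemma measurable_weight1 : measurable_fun setT (weight1 : measurableTypeR R -> R).
Proof.
apply: (measurableT_comp (measurable_powR _)).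
by apply: measurable_funD => //; exact: measurableT_comp.
Qed.

Lemma integral_weight1_lty : (\int[mu]_t (weight1 t)%:E < +oo)%E.
Proof.
have [C C0 H] := @integral_invsqr_le R.
exact: le_lt_trans (H 1 ltr01) (ltry _).
Qed.

Lemma weight1_shift t u : `|t - u| <= 1 -> weight1 t <= 4 * weight1 u.
Proof.
move=> tu; have h : 1 + `|u| <= 2 * (1 + `|t|).
  have : `|u| <= `|t| + `|t - u|.
    by have := ler_normB t (t - u); rewrite opprB addrC subrK.
  by have := normr_ge0 t; lra.
have t1 : 0 < 1 + `|t| by rewrite ltr_pwDl.
have u1 : 0 < 1 + `|u| by rewrite ltr_pwDl.
have : (2 * (1 + `|t|)) `^ (- 2) <= (1 + `|u|) `^ (- 2) by apply: ler_powRN.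
rewrite powRM ?(ltW t1)// (_ : 2 `^ (- 2) = 4^-1); last by rewrite powR_invn// -natrX.
by rewrite ler_pdivrMl.
Qed.

(** c t^2 >= |t| - 1/(4c), and exp(-|t|) beats any power. *)
Lemma expR_sqr_decay (c : R) : 0 < c ->
  exists2 K : R, 0 < K & forall t, (1 + `|t|) * expR (- (c * t ^+ 2)) <= K * weight1 t.
Proof.
move=> c0; have [C C0 H] := @expRN_le_powR R 3 (ler0n R 3).
exists (expR ((4 * c)^-1) * C); first by rewrite mulr_gt0// expR_gt0.
move=> t; have t1 : 0 < 1 + `|t| by rewrite ltr_pwDl.
have h : expR (- (c * t ^+ 2)) <= expR ((4 * c)^-1) * expR (- `|t|).
  rewrite -expRD ler_expR -(real_normK (num_real t)).
  have : 0 <= c * (`|t| - (2 * c)^-1) ^+ 2 by rewrite mulr_ge0 ?sqr_ge0// ltW.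
  rewrite (_ : c * (`|t| - (2 * c)^-1) ^+ 2 = c * `|t| ^+ 2 - `|t| + (4 * c)^-1); first by lra.
  by field; rewrite gt_eqF.
apply: (@le_trans _ _ ((1 + `|t|) * (expR ((4 * c)^-1) * (C * (1 + `|t|) `^ (- 3))))).
  apply: ler_wpM2l; first exact: ltW.
  by apply: (le_trans h); apply: ler_wpM2l; [exact: expR_ge0|exact: H].
rewrite /weight1 (_ : - 2 = 1 + - 3 :> R); last by ring.
by rewrite powRD_gt0// powRr1 ?(ltW t1)// le_eqVlt; apply/orP; left; apply/eqP; ring.
Qed.

End Weight.

Section DifferenceQuotient.
Context {R : realType}.

Lemma cvg_difference_quotient (V : normedModType R) (f : V -> R) (x v : V) (l : R) :
  is_derive x v f l ->
  k.+1%:R * (f (x + (k.+1%:R)^-1 *: v) - f x) @[k --> \oo] --> l.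
Proof.
move=> [df dl].
have h0 : (forall k, (k.+1%:R : R)^-1 != 0) /\ ((k.+1%:R : R)^-1 @[k --> \oo] --> 0).
  split; first by move=> k; rewrite invr_eq0 pnatr_eq0.
  exact: cvg_harmonic.
have : h^-1 *: (f (h *: v + x) - f x) @[h --> 0^'] --> l by rewrite -dl; exact: df.
move=> /cvgr_dnbhsP/(_ _ h0).
rewrite [X in X @ _ --> _ -> _](_ : _ = (fun k => k.+1%:R * (f (x + (k.+1%:R)^-1 *: v) - f x)))//.
by apply/funext => k /=; rewrite invrK [x + _]addrC.
Qed.

(** By the mean value theorem. *)
Lemma difference_quotient_le (F F' : R -> R) (B : R) k :
  (forall u : R, is_derive u (1 : R) F (F' u)) ->
  (forall u : R, 0 <= u <= 1 -> `|F' u| <= B) ->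
  `|k.+1%:R * (F (k.+1%:R)^-1 - F 0)| <= B.
Proof.
move=> dF FB; have k0 : 0 < (k.+1%:R : R)^-1 by rewrite invr_gt0.
have cF : {within `[0, (k.+1%:R)^-1], continuous F}.
  apply: continuous_subspaceT => u.
  by apply/differentiable_continuous/derivable1_diffP; have := dF u; case.
have [c /[!in_itv]/= /andP[c0 c1] ->] := MVT k0 (fun u _ => dF u) cF.
rewrite subr0 mulrCA divff ?mulr1 ?pnatr_eq0//; apply: FB.
by rewrite (ltW c0)/= (le_trans (ltW c1))// invf_le1// ler1n.
Qed.

End DifferenceQuotient.

Section Gaussian1D.
Context {R : realType} (a : R).
Hypothesis a_gt0 : 0 < a.
Notation mu := (@lebesgue_measure R).
Implicit Types t s : R.

Let E t := expR (- (pi * a * t ^+ 2)).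
Let tau (k : nat) (t : measurableTypeR R) : measurableTypeR R := 1 * t + (k.+1%:R)^-1.

Let mtau k : measurable_fun setT (tau k). Proof. exact: measurable_affine1. Qed.

Let tauP k (f : measurableTypeR R -> \bar R) : measurable_fun setT f -> (forall x, 0 <= f x)%E ->
  (\int[mu]_x f x = 1%:E * \int[mu]_x f (tau k x))%E.
Proof.
by move=> mf f0; rewrite (ge0_integral_affine1 (k.+1%:R)^-1 (oner_neq0 R) mf f0) normr1.
Qed.

Let mE : measurable_fun setT (E : measurableTypeR R -> R).
Proof.
apply: (measurableT_comp (@measurable_expR R)).
apply: (measurable_funN (f := fun t => pi * a * t ^+ 2)).
by apply: measurable_funM => //; exact: measurable_funX.
Qed.

Let pi0 : 0 < pi :> R. Proof. exact: pi_gt0. Qed.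
Let pa0 : 0 < pi * a. Proof. exact: mulr_gt0. Qed.

Let integral_E : (\int[mu]_t (E t)%:E = (a `^ (- 2^-1))%:E)%E.
Proof.
have ai : 0 < a^-1 by rewrite invr_gt0.
have := integral_gauss1 0 ai; under eq_integral do rewrite subr0.
have gE t : gauss1 a^-1 t = a `^ 2^-1 * E t.
  rewrite /gauss1 -powR_inv1 ?(ltW a_gt0)// -powRrM mulrNN mul1r; congr (_ * expR _).
  by rewrite powR_inv1 ?(ltW a_gt0)// invrK mulrAC.
under eq_integral do rewrite gE EFinM.
rewrite ge0_integralZl_EFin ?powR_ge0//; last 2 first.
- by move=> t _; rewrite lee_fin expR_ge0.
- exact/measurable_EFinP.
have I0 : (0 <= \int[mu]_t (E t)%:E)%E by apply: integral_ge0 => t _; rewrite lee_fin expR_ge0.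
have a2 : 0 < a `^ 2^-1 by exact: powR_gt0.
case: (\int[mu]_t (E t)%:E)%E I0 => [I| |]//; last by rewrite gt0_muley ?lte_fin.
move=> _; rewrite -EFinM => -[h]; congr EFin.
by rewrite powRN -[LHS](mulKf (lt0r_neq0 a2)) h mulr1.
Qed.

(* One bound dominates the integrands of the Fourier integral at s, of its
   derivative in s, and of the derivative of the integrand in t. *)
Let exists_dom s : exists2 M : R, 0 < M & forall t,
  (2 * pi * a * `|t| + 2 * pi * `|s| + 2 * pi * `|t| + 1) * E t <= M * weight1 t.
Proof.
have [K K0 HK] := expR_sqr_decay pa0.
pose c := 2 * pi * a + 2 * pi * `|s| + 2 * pi + 1.
have c0 : 0 < c by rewrite ltr_wpDl// !addr_ge0 ?mulr_ge0 ?(ltW pi0) ?(ltW a_gt0).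
exists (c * K); first exact: mulr_gt0.
move=> t; apply: (@le_trans _ _ (c * ((1 + `|t|) * E t))); last first.
  by rewrite -mulrA ler_pM2l//; exact: HK.
rewrite mulrA ler_wpM2r ?expR_ge0// /c.
have := normr_ge0 t; have := normr_ge0 s; have := ltW pi0; have := ltW a_gt0.
set P := pi; set S := `|s|; set X := `|t|; move=> h1 h2 h3 h4.
have h5 := mulr_ge0 (mulr_ge0 h2 h3) h4.
have h6 := mulr_ge0 h2 h1.
by nra.
Qed.

Let wi (M : R) : mu.-integrable setT (EFin \o (fun t => M * weight1 t)).
Proof.
have w0 : mu.-integrable setT (EFin \o (weight1 : measurableTypeR R -> R)).
  apply/integrableP; split; first by apply/measurable_EFinP; exact: measurable_weight1.
  under eq_integral do rewrite /= ger0_norm ?(ltW (weight1_gt0 _))//.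
  exact: integral_weight1_lty.
exact: (integrableZl measurableT M w0).
Qed.

Let mtrig s : measurable_fun setT (fun t : measurableTypeR R => E t * cos (2 * pi * s * t)) /\
  measurable_fun setT (fun t : measurableTypeR R => E t * sin (2 * pi * s * t)).
Proof.
split; apply: measurable_funM => //.
  apply: (measurableT_comp (continuous_measurable_fun (@continuous_cos R))).
  exact: measurable_funM.
apply: (measurableT_comp (continuous_measurable_fun (@continuous_sin R))).
exact: measurable_funM.
Qed.

Let norm_cos t : `|cos t| <= 1 :> R.
Proof. by rewrite ler_norml cos_geN1 cos_le1. Qed.
Let norm_sin t : `|sin t| <= 1 :> R.
Proof. by rewrite ler_norml sin_geN1 sin_le1. Qed.

Let integrable_dom (f : measurableTypeR R -> R) M : measurable_fun setT f ->
  (forall t, `|f t| <= M * weight1 t) -> 0 < M -> mu.-integrable setT (EFin \o f).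
Proof.
move=> mf fM M0; apply: le_integrable (wi M) => //; first exact/measurable_EFinP.
move=> t _ /=; rewrite lee_fin [leRHS]ger0_norm// mulr_ge0 ?(ltW M0)//.
exact: (ltW (weight1_gt0 _)).
Qed.

Let Ecos_i s : mu.-integrable setT (EFin \o (fun t => E t * cos (2 * pi * s * t))).
Proof.
have [M M0 HM] := exists_dom s; apply: (integrable_dom (mtrig s).1 _ M0) => t.
apply: le_trans (HM t); rewrite normrM ger0_norm ?expR_ge0// mulrC.
apply: ler_wpM2r; first exact: expR_ge0.
apply: (le_trans (norm_cos _)).
by rewrite lerDr !addr_ge0 ?mulr_ge0 ?(ltW pi0) ?(ltW a_gt0).
Qed.

Let Esin_i s : mu.-integrable setT (EFin \o (fun t => E t * sin (2 * pi * s * t))).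
Proof.
have [M M0 HM] := exists_dom s; apply: (integrable_dom (mtrig s).2 _ M0) => t.
apply: le_trans (HM t); rewrite normrM ger0_norm ?expR_ge0// mulrC.
apply: ler_wpM2r; first exact: expR_ge0.
apply: (le_trans (norm_sin _)).
by rewrite lerDr !addr_ge0 ?mulr_ge0 ?(ltW pi0) ?(ltW a_gt0).
Qed.

Let tEsin_i s : mu.-integrable setT (EFin \o (fun t => - (2 * pi) * t * (E t * sin (2 * pi * s * t)))).
Proof.
have [M M0 HM] := exists_dom s.
apply: (@integrable_dom _ M _ _ M0).
  by apply: measurable_funM; [exact: measurable_funM|exact: (mtrig s).2].
move=> t; apply: le_trans (HM t).
rewrite mulrCA normrM (ger0_norm (expR_ge0 _)) [leRHS]mulrC.
apply: ler_wpM2l; first exact: expR_ge0.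
have p2 : 0 <= 2 * pi :> R by rewrite mulr_ge0// ltW.
rewrite normrM normrM normrN (ger0_norm p2).
apply: (@le_trans _ _ (2 * pi * `|t|)); first by rewrite ler_piMr// mulr_ge0.
have := mulr_ge0 (mulr_ge0 p2 (ltW a_gt0)) (normr_ge0 t).
have := mulr_ge0 p2 (normr_ge0 s).
by lra.
Qed.

(* the Fourier transform of the Gaussian E, as a cosine transform *)
Let C s := \int[mu]_t (E t * cos (2 * pi * s * t)).

Let derivable_lin (c t : R) : is_derive t 1 (fun u : R => c * u) c.
Proof. by apply: is_derive_eq; rewrite /GRing.scale /= mulr1. Qed.

Let deriv_cos s t : is_derive s 1 (fun u => E t * cos (2 * pi * u * t))
  (- (2 * pi) * t * (E t * sin (2 * pi * s * t))).
Proof.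
have h := is_derive1_comp (is_derive_cos _) (derivable_lin (2 * pi * t) s).
have h' : is_derive s 1 (fun u => cos (2 * pi * u * t)) (- sin (2 * pi * s * t) * (2 * pi * t)).
  rewrite (_ : (fun u => _) = cos \o (fun u => 2 * pi * t * u)); last first.
    by apply/funext => u /=; rewrite mulrAC.
  by rewrite (mulrAC (2 * pi) s t).
apply: is_derive_eq; rewrite /GRing.scale /=.
by generalize (sin (2 * pi * s * t)) (E t) (@pi R) => S E0 P; ring.
Qed.

Let derivative_C s : is_derive s 1 C (\int[mu]_t (- (2 * pi) * t * (E t * sin (2 * pi * s * t)))).
Proof.
have [M M0 HM] := exists_dom 0.
have sI : (`]s - 1, s + 1[%classic : set R) s by rewrite /= in_itv/=; apply/andP; split; lra.
pose f u t := E t * cos (2 * pi * u * t).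
have intf u : (`]s - 1, s + 1[%classic : set R) u -> mu.-integrable setT (EFin \o f u) by move=> _; exact: Ecos_i.
have derf u t : (`]s - 1, s + 1[%classic : set R) u -> [set: R] t -> derivable (f ^~ t) u 1.
  by move=> _ _; have := deriv_cos u t; case.
have d1E u t : ((f ^~ t)^`())%classic u = - (2 * pi) * t * (E t * sin (2 * pi * u * t)).
  by rewrite derive1E; have := deriv_cos u t; case.
have p2 : 0 <= 2 * pi :> R by rewrite mulr_ge0// ltW.
have G0 t : 0 <= M * weight1 t by rewrite mulr_ge0 ?(ltW M0)// ltW ?weight1_gt0.
have Gub u t : (`]s - 1, s + 1[%classic : set R) u -> [set: R] t -> `|((f ^~ t)^`())%classic u| <= M * weight1 t.
  move=> _ _; rewrite d1E; apply: le_trans (HM t).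
  rewrite mulrCA normrM (ger0_norm (expR_ge0 _)) [leRHS]mulrC.
  apply: ler_wpM2l; first exact: expR_ge0.
  rewrite normrM normrM normrN (ger0_norm p2).
  apply: (@le_trans _ _ (2 * pi * `|t|)); first by rewrite ler_piMr// mulr_ge0.
  have := mulr_ge0 (mulr_ge0 p2 (ltW a_gt0)) (normr_ge0 t).
  by rewrite normr0 mulr0; lra.
have dC := derivable_under_integral measurableT sI intf derf G0 (wi M) Gub.
have eC := differentiation_under_integral measurableT sI intf derf G0 (wi M) Gub.
apply: DeriveDef => //; rewrite -derive1E eC.
by apply: eq_Rintegral => t _; exact: d1E.
Qed.

(* H' is the derivative in t of H; that its integral vanishes is the differential
   equation of C. *)
Let H s t := E t * sin (2 * pi * s * t).
Let H' s t := a * (- (2 * pi) * t * (E t * sin (2 * pi * s * t))) + 2 * pi * s * (E t * cos (2 * pi * s * t)).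

Let deriv_H s t : is_derive t 1 (H s) (H' s t).
Proof.
have h1 := is_derive1_comp (is_derive_sin _) (derivable_lin (2 * pi * s) t).
have h1' : is_derive t 1 (fun u => sin (2 * pi * s * u)) (cos (2 * pi * s * t) * (2 * pi * s)) := h1.
have h2 : is_derive t 1 (fun u : R => - (pi * a * u ^+ 2)) (- (pi * a * (2 * t))).
  apply: is_derive_eq; rewrite /GRing.scale /=.
  by generalize (@pi R) => P; ring.
have h3 : is_derive t 1 E (E t * - (pi * a * (2 * t))).
  exact: (is_derive1_comp (is_derive_expR _) h2).
apply: is_derive_eq; rewrite /GRing.scale /= /H'.
by generalize (sin (2 * pi * s * t)) (cos (2 * pi * s * t)) (E t) (@pi R) => S C0 E0 P; ring.
Qed.

Let H'_dom s : exists2 M : R, 0 < M & forall t, `|H' s t| <= M * weight1 t.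
Proof.
have [M M0 HM] := exists_dom s; exists M => // t; apply: le_trans (HM t).
have p2 : 0 <= 2 * pi :> R by rewrite mulr_ge0// ltW.
rewrite /H' (_ : _ + _ = E t * (- (2 * pi * a * t * sin (2 * pi * s * t)) + 2 * pi * s * cos (2 * pi * s * t))); last first.
  by generalize (sin (2 * pi * s * t)) (cos (2 * pi * s * t)) (E t) (@pi R) => S C0 E0 P; ring.
rewrite normrM (ger0_norm (expR_ge0 _)) [leRHS]mulrC; apply: ler_wpM2l; first exact: expR_ge0.
apply: (le_trans (ler_normD _ _)); rewrite normrN.
rewrite (normrM _ (sin _)) (normrM _ (cos _)) (normrM _ t) (normrM _ s) (normrM _ a) (ger0_norm p2) (ger0_norm (ltW a_gt0)).
have A1 : 2 * pi * a * `|t| * `|sin (2 * pi * s * t)| <= 2 * pi * a * `|t|.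
  by rewrite ler_piMr// !mulr_ge0 ?(ltW pi0) ?(ltW a_gt0).
have A2 : 2 * pi * `|s| * `|cos (2 * pi * s * t)| <= 2 * pi * `|s|.
  by rewrite ler_piMr// !mulr_ge0 ?(ltW pi0).
have := mulr_ge0 p2 (normr_ge0 t).
by lra.
Qed.

Let ode s : a * (\int[mu]_t (- (2 * pi) * t * (E t * sin (2 * pi * s * t)))) + 2 * pi * s * C s = 0.
Proof.
have [M M0 HM] := H'_dom s.
have [||H'i H0] := @Rintegral_derivative_eq0 _ _ _ mu tau mtau tauP (H s) (H' s)
   (fun t => (4 * M) * weight1 t) (Esin_i s) (wi (4 * M)).
- move=> t k; pose F u := H s (t + u).
  have dF (u : R) : is_derive u (1 : R) F (H' s (t + u)).
    have dg : is_derive u (1 : R) (fun u : R => t + u) 1 by apply: is_derive_eq; rewrite add0r mulr1.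
    by have := is_derive1_comp (deriv_H s (t + u)) dg; rewrite mulr1.
  have := @difference_quotient_le _ F (fun u => H' s (t + u)) (4 * M * weight1 t) k dF.
  rewrite /F addr0 /tau mul1r; apply => u /andP[u0 u1].
  apply: (le_trans (HM _)); rewrite -mulrA mulrCA; apply: ler_wpM2l; first exact: ltW.
  by apply: weight1_shift; rewrite addrAC subrr add0r ger0_norm.
- move=> t; have := @cvg_difference_quotient _ R^o (H s) t 1 _ (deriv_H s t).
  rewrite [X in X @ _ --> _ -> _](_ : _ = (fun k => k.+1%:R * (H s (tau k t) - H s t)))//.
  by apply/funext => k; rewrite /tau mul1r /GRing.scale /= mulr1.
move: H0; rewrite /H' RintegralD//; last 2 first.
- exact: (integrableZl measurableT a (tEsin_i s)).
- exact: (integrableZl measurableT (2 * pi * s) (Ecos_i s)).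
by rewrite RintegralZl// RintegralZl.
Qed.

Let C0 : C 0 = a `^ (- 2^-1).
Proof.
rewrite /C; under eq_Rintegral do rewrite mulr0 mul0r cos0 mulr1.
by rewrite /Rintegral integral_E.
Qed.

(** C satisfies a C' + 2 pi s C = 0, so C(s) exp(pi s^2 / a) is constant, with
    value C(0), the integral of E. *)
Lemma Rintegral_gauss_cos s : \int[mu]_t (E t * cos (2 * pi * s * t)) = gauss1 a s.
Proof.
pose K s := C s * expR (pi * s ^+ 2 / a).
have dK (u : R) : is_derive u (1 : R) K 0.
  have h1 := derivative_C u.
  have h2 : is_derive u (1 : R) (fun u : R => pi * u ^+ 2 / a) (pi * (2 * u) / a).
    apply: is_derive_eq; rewrite /GRing.scale /=.
    by generalize (@pi R) => P; ring.
  have h3 : is_derive u (1 : R) (fun u => expR (pi * u ^+ 2 / a)) (expR (pi * u ^+ 2 / a) * (pi * (2 * u) / a)).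
    exact: (is_derive1_comp (is_derive_expR _) h2).
  apply: is_derive_eq; rewrite /GRing.scale /=.
  have := ode u; set I := \int[_]_t _; generalize I (C u) (expR (pi * u ^+ 2 / a)) (@pi R) => {}I Cu X P o.
  have -> : I = - (2 * P * u * Cu) / a.
    by apply: (mulfI (lt0r_neq0 a_gt0)); rewrite mulrCA divff ?gt_eqF// mulr1; lra.
  by field; rewrite gt_eqF.
have := is_derive_0_is_cst s 0 dK; rewrite /K expr0n/= mulr0 mul0r expR0 mulr1 C0.
rewrite /gauss1 expRN => <-.
by rewrite mulfK// gt_eqF// expR_gt0.
Qed.

(** The integrand is odd. *)
Lemma Rintegral_gauss_sin s : \int[mu]_t (E t * sin (2 * pi * s * t)) = 0.
Proof.
pose nu (t : measurableTypeR R) : measurableTypeR R := -1 * t + 0.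
have mnu : measurable_fun setT nu by exact: measurable_affine1.
have n1 : -1 != 0 :> R by rewrite oppr_eq0 oner_eq0.
have nuP (f : measurableTypeR R -> \bar R) : measurable_fun setT f -> (forall x, 0 <= f x)%E ->
    (\int[mu]_x f x = 1%:E * \int[mu]_x f (nu x))%E.
  by move=> mf f0; rewrite (ge0_integral_affine1 0 n1 mf f0) normrN1.
have := Rintegral_change ltr01 mnu nuP (Esin_i s).
rewrite mul1r; under [in X in _ = X -> _]eq_Rintegral.
  move=> t _; rewrite /nu addr0 mulN1r mulrN sinN /E sqrrN mulrN -mulN1r; over.
by rewrite RintegralZl//; lra.
Qed.

Lemma cintegrable_gauss_expi s :
  cintegrable mu (fun t : measurableTypeR R => expi (2 * pi * (s * t)) * (E t)%:C).
Proof.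
have [M M0 HM] := exists_dom 0.
apply: (@cintegrable_le _ _ _ _ _ (fun t : measurableTypeR R => M * weight1 t)) => //.
  apply: cmeasurableM; last exact: cmeasurable_real.
  by apply: cmeasurable_expi; apply: measurable_funM => //; exact: measurable_funM.
move=> t; rewrite Normc.normcM normc_expi mul1r normc_real ger0_norm ?expR_ge0//.
apply: le_trans (HM t); rewrite normr0 mulr0 addr0 ler_peMl ?expR_ge0//.
by rewrite lerDr !addr_ge0 ?mulr_ge0 ?(ltW pi0) ?(ltW a_gt0).
Qed.

Lemma cintegral_gauss_expi s :
  cintegral mu (fun t : measurableTypeR R => expi (2 * pi * (s * t)) * (E t)%:C) = (gauss1 a s)%:C.
Proof.
apply: complex_eq => /=.
  rewrite -Rintegral_gauss_cos; apply: eq_Rintegral => t _.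
  by rewrite mulr0 subr0 mulrC mulrA.
rewrite -[RHS](Rintegral_gauss_sin s); apply: eq_Rintegral => t _.
by rewrite mulr0 add0r mulrC mulrA.
Qed.

End Gaussian1D.

(** * Complex integrals over spaces of matrices *)

Section GlueAny.
Context (R : realType) (m n : nat).
Context d1 d2 (T1 : measurableType d1) (T2 : measurableType d2).
Variables (mu1 : {sigma_finite_measure set T1 -> \bar R})
          (mu2 : {sigma_finite_measure set T2 -> \bar R}).
Variables (glue : T1 * T2 -> 'M[R]_(m, n)) (split : 'M[R]_(m, n) -> T1 * T2).
Hypotheses (mglue : measurable_fun [set: T1 * T2] glue)
           (msplit : measurable_fun [set: 'M[R]_(m, n)] split)
           (glueK : cancel glue split).
Notation normc := Normc.normc.

Lemma integral_glue_prod (f : 'M[R]_(m, n) -> \bar R) : measurable_fun setT f ->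
  (\int[glue_measure mu1 mu2 mglue msplit glueK]_x f x = \int[mu1 \x mu2]_z f (glue z))%E.
Proof.
move=> mf.
have ge0 (g : 'M[R]_(m, n) -> \bar R) : measurable_fun setT g -> (forall x, 0 <= g x)%E ->
    (\int[glue_measure mu1 mu2 mglue msplit glueK]_x g x = \int[mu1 \x mu2]_z g (glue z))%E.
  move=> mg g0; rewrite ge0_integral_glue// (fubini_tonelli1 (fun z => g (glue z)))//.
  exact: measurableT_comp mg mglue.
rewrite integralE [RHS]integralE.
rewrite (ge0 _ (measurable_funepos mf))// (ge0 _ (measurable_funeneg mf))//.
by congr (_ - _)%E; apply: eq_integral => z _; rewrite ?funeposE ?funenegE.
Qed.

Lemma cintegral_glue (f : 'M[R]_(m, n) -> R[i]) :
  cintegrable (glue_measure mu1 mu2 mglue msplit glueK) f ->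
  cintegral (glue_measure mu1 mu2 mglue msplit glueK) f =
  cintegral mu1 (fun x => cintegral mu2 (fun y => f (glue (x, y)))).
Proof.
move=> fi; have [[rf if_] oo] := fi.
have gi : cintegrable (mu1 \x mu2)%E (fun z => f (glue z)).
  split; first exact: cmeasurable_comp mglue.
  move: oo; rewrite integral_glue_prod//.
  by apply/measurable_EFinP; exact: measurable_normc.
rewrite (cintegral_prod_fst gi); apply: complex_eq => /=; congr fine;
  by rewrite integral_glue_prod//; exact/measurable_EFinP.
Qed.

End GlueAny.

Section ComplexProducts.
Context {R : realType}.
Notation normc := Normc.normc.
Implicit Types m n : nat.

Lemma normc_prod (I : Type) (r : seq I) (P : pred I) (F : I -> R[i]) :
  normc (\prod_(i <- r | P i) F i) = \prod_(i <- r | P i) normc (F i).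
Proof.
elim/big_rec2: _ => [|i y x _ <-]; first exact: Normc.normc1.
by rewrite Normc.normcM.
Qed.

Lemma cmeasurable_prod d (T : measurableType d) (I : eqType) (s : seq I) (h : I -> T -> R[i]) :
  (forall i, cmeasurable (h i)) -> cmeasurable (fun x => \prod_(i <- s) h i x).
Proof.
move=> mh; elim: s => [|i s ih].
  by under eq_fun do rewrite big_nil; exact: cmeasurable_cst.
by under eq_fun do rewrite big_cons; exact: cmeasurableM.
Qed.

Lemma cintegral_rV0 (f : 'rV[R]_0 -> R[i]) : cintegral (lebesgue_rV R 0) f = f 0.
Proof. by apply: complex_eq; rewrite /= /Rintegral integral_rV0. Qed.

Lemma cintegral_mx0 n (f : 'M[R]_(0, n) -> R[i]) : cintegral (lebesgue_mx R 0 n) f = f 0.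
Proof. by apply: complex_eq; rewrite /= /Rintegral integral_mx0. Qed.

Let cst_mul_fubini d1 d2 (T1 : measurableType d1) (T2 : measurableType d2)
  (m1 : {measure set T1 -> \bar R}) (m2 : {measure set T2 -> \bar R}) f g :
  cintegrable m1 f -> cintegrable m2 g ->
  cintegral m1 (fun x => cintegral m2 (fun y => f x * g y)) = cintegral m1 f * cintegral m2 g.
Proof.
move=> fi gi.
rewrite (_ : (fun x => _) = (fun x => cintegral m2 g * f x)); last first.
  by apply/funext => x; rewrite cintegralZl// mulrC.
by rewrite cintegralZl// mulrC.
Qed.

Lemma cintegrable_prod_rV n (F : 'I_n -> measurableTypeR R -> R[i]) :
  (forall j, cintegrable lebesgue_measure (F j)) ->
  cintegrable (lebesgue_rV R n) (fun x => \prod_(j < n) F j (x ord0 j)).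
Proof.
move=> iF; split.
  apply: cmeasurable_prod => j; have [mF _] := iF j.
  exact: (cmeasurable_comp mF (measurable_mx_coord _ _)).
under eq_integral do rewrite normc_prod -prodEFin.
rewrite (ge0_integral_prod_rV (F := fun j t => (normc (F j t))%:E)); last 2 first.
- by move=> j; apply/measurable_EFinP; apply: measurable_normc; case: (iF j).
- by move=> j t; rewrite lee_fin normc_ge0.
rewrite -ge0_fin_numE; last first.
  by apply: prode_ge0 => j _; apply: integral_ge0 => t _; rewrite lee_fin normc_ge0.
apply: prode_fin_num => j _; rewrite ge0_fin_numE; first by case: (iF j).
by apply: integral_ge0 => t _; rewrite lee_fin normc_ge0.
Qed.

Lemma cintegral_prod_rV n (F : 'I_n -> measurableTypeR R -> R[i]) :
  (forall j, cintegrable lebesgue_measure (F j)) ->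
  cintegral (lebesgue_rV R n) (fun x => \prod_(j < n) F j (x ord0 j)) =
  \prod_(j < n) cintegral lebesgue_measure (F j).
Proof.
elim: n F => [|n IH] F iF; first by rewrite cintegral_rV0 !big_ord0.
rewrite [LHS](cintegral_glue (cintegrable_prod_rV iF)).
rewrite big_ord_recl -(IH (fun j => F (lift ord0 j)) (fun j => iF _)).
rewrite -(cst_mul_fubini (iF ord0)
  (cintegrable_prod_rV (F := fun j => F (lift ord0 j)) (fun j => iF _))).
congr cintegral; apply/funext => t; congr cintegral; apply/funext => v.
rewrite big_ord_recl mxE unlift_none; congr (_ * _).
by apply: eq_bigr => j _; rewrite mxE liftK.
Qed.

Lemma cintegrable_prod_mx m n (F : 'I_m -> 'rV[R]_n -> R[i]) :
  (forall i, cintegrable (lebesgue_rV R n) (F i)) ->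
  cintegrable (lebesgue_mx R m n) (fun x => \prod_(i < m) F i (row i x)).
Proof.
move=> iF; split.
  apply: cmeasurable_prod => i; have [mF _] := iF i.
  exact: (cmeasurable_comp mF (measurable_row _)).
under eq_integral do rewrite normc_prod -prodEFin.
rewrite (ge0_integral_prod_mx (F := fun i t => (normc (F i t))%:E)); last 2 first.
- by move=> i; apply/measurable_EFinP; apply: measurable_normc; case: (iF i).
- by move=> i t; rewrite lee_fin normc_ge0.
rewrite -ge0_fin_numE; last first.
  by apply: prode_ge0 => j _; apply: integral_ge0 => t _; rewrite lee_fin normc_ge0.
apply: prode_fin_num => j _; rewrite ge0_fin_numE; first by case: (iF j).
by apply: integral_ge0 => t _; rewrite lee_fin normc_ge0.
Qed.

Lemma cintegral_prod_mx m n (F : 'I_m -> 'rV[R]_n -> R[i]) :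
  (forall i, cintegrable (lebesgue_rV R n) (F i)) ->
  cintegral (lebesgue_mx R m n) (fun x => \prod_(i < m) F i (row i x)) =
  \prod_(i < m) cintegral (lebesgue_rV R n) (F i).
Proof.
elim: m F => [|m IH] F iF; first by rewrite cintegral_mx0 !big_ord0.
rewrite [LHS](cintegral_glue (cintegrable_prod_mx iF)).
rewrite big_ord_recl -(IH (fun i => F (lift ord0 i)) (fun i => iF _)).
rewrite -(cst_mul_fubini (iF ord0)
  (cintegrable_prod_mx (F := fun i => F (lift ord0 i)) (fun i => iF _))).
congr cintegral; apply/funext => t; congr cintegral; apply/funext => v.
rewrite big_ord_recl; congr (_ * _).
  by congr (F _ _); apply/rowP => j; rewrite !mxE unlift_none.
by apply: eq_bigr => i _; congr (F _ _); apply/rowP => k; rewrite !mxE liftK.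
Qed.

Lemma cintegral_affine_mx m n (c : R) (v : 'M[R]_(m, n)) (f : 'M[R]_(m, n) -> R[i]) : c != 0 ->
  cintegrable (lebesgue_mx R m n) f ->
  cintegrable (lebesgue_mx R m n) (fun x => f (c *: x + v)) /\
  cintegral (lebesgue_mx R m n) f =
    (`|c| ^+ (m * n))%:C * cintegral (lebesgue_mx R m n) (fun x => f (c *: x + v)).
Proof.
move=> c0 fi; have [mf oo] := fi.
have a0 : 0 < `|c| ^+ (m * n) by rewrite exprn_gt0// normr_gt0.
have mt := @measurable_affine_mx R m n c v.
have P (g : 'M[R]_(m, n) -> \bar R) : measurable_fun setT g -> (forall x, 0 <= g x)%E ->
    (\int[lebesgue_mx R m n]_x g x = (`|c| ^+ (m * n))%:E * \int[lebesgue_mx R m n]_x g (c *: x + v)%R)%E.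
  by move=> mg g0; exact: ge0_integral_affine_mx.
split.
  split; first exact: cmeasurable_comp mt.
  have /integrableP[_] := integrable_change a0 mt P (cintegrable_norm fi).
  by under eq_integral do rewrite /= ger0_norm ?normc_ge0//.
apply: complex_eq; rewrite ?cReM ?cImM /= mul0r.
  by rewrite subr0; exact: (Rintegral_change a0 mt P (cintegrable_Re fi)).
by rewrite addr0; exact: (Rintegral_change a0 mt P (cintegrable_Im fi)).
Qed.

End ComplexProducts.

Section GaussianMatrix.
Context {R : realType} {m n : nat} (e : R).
Hypothesis e_gt0 : 0 < e.
Implicit Types x y xi : 'M[R]_(m, n).

Lemma expi_sum (I : Type) (r : seq I) (P : pred I) (F : I -> R) :
  expi (\sum_(i <- r | P i) F i) = \prod_(i <- r | P i) expi (F i).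
Proof.
elim/big_rec2: _ => [|i y x _ <-]; first exact: expi0.
by rewrite expiD.
Qed.

(** It is the Fourier transform of expgauss_mx d. *)
Definition gauss_mx (d : R) x : R := \prod_(i < m) gauss d (row i x).

Definition expgauss_mx xi : R := \prod_(i < m) \prod_(j < n) expR (- (pi * e * xi i j ^+ 2)).

Let F (i : 'I_m) y (v : 'rV[R]_n) : R[i] := \prod_(j < n)
  (expi (2 * pi * (y i j * v ord0 j)) * (expR (- (pi * e * v ord0 j ^+ 2)))%:C).

Let FE xi y : expi (2 * pi * mxdot xi y) * (expgauss_mx xi)%:C =
  \prod_(i < m) F i y (row i xi).
Proof.
rewrite /mxdot mulr_sumr expi_sum /expgauss_mx rmorph_prod -big_split/=.
apply: eq_bigr => i _; rewrite mulr_sumr expi_sum rmorph_prod -big_split/=.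
apply: eq_bigr => j _; rewrite !mxE; congr (expi (_ * _) * _).
by rewrite mulrC.
Qed.

Let iF i y : cintegrable (lebesgue_rV R n) (F i y).
Proof.
apply: (cintegrable_prod_rV (F := fun j t => expi (2 * pi * (y i j * t)) * (expR (- (pi * e * t ^+ 2)))%:C)).
by move=> j; exact: cintegrable_gauss_expi.
Qed.

Lemma cintegrable_expgauss_mx y : cintegrable (lebesgue_mx R m n)
  (fun xi => expi (2 * pi * mxdot xi y) * (expgauss_mx xi)%:C).
Proof.
apply: eq_cintegrable (cintegrable_prod_mx (F := fun i => F i y) (fun i => iF i y)) => xi.
by rewrite FE.
Qed.

Lemma cintegral_expgauss_mx y : cintegral (lebesgue_mx R m n)
  (fun xi => expi (2 * pi * mxdot xi y) * (expgauss_mx xi)%:C) = (gauss_mx e y)%:C.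
Proof.
rewrite (eq_cintegral _ (fun xi => FE xi y)).
rewrite (cintegral_prod_mx (F := fun i => F i y) (fun i => iF i y)).
rewrite /gauss_mx rmorph_prod; apply: eq_bigr => i _.
rewrite (cintegral_prod_rV (F := fun j t => expi (2 * pi * (y i j * t)) * (expR (- (pi * e * t ^+ 2)))%:C)); last first.
  by move=> j; exact: cintegrable_gauss_expi.
rewrite /gauss rmorph_prod; apply: eq_bigr => j _; rewrite mxE.
exact: cintegral_gauss_expi.
Qed.

End GaussianMatrix.

(** * The Fourier transform of the Bessel kernel *)

Section RintegralScale.
Context {R : realType} d (T : measurableType d) (mu : {measure set T -> \bar R}).

(** The convention fine +oo = 0 makes the real-valued integral homogeneous even on
    functions of infinite integral, such as the integrand of the Bessel potential
    at 0. *)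
Lemma ge0_RintegralZl (c : R) (f : T -> R) : measurable_fun setT f -> (forall x, 0 <= f x) ->
  \int[mu]_x (c * f x) = c * \int[mu]_x f x.
Proof.
move=> mf f0.
have me : measurable_fun setT (fun x => (f x)%:E) by exact/measurable_EFinP.
have pos (k : R) : 0 <= k -> \int[mu]_x (k * f x) = k * \int[mu]_x f x.
  move=> k0; rewrite /Rintegral; under eq_integral do rewrite EFinM.
  rewrite ge0_integralZl_EFin//; last by move=> x _; rewrite lee_fin.
  have := @integral_ge0 _ _ _ mu setT (fun x => (f x)%:E) (fun x _ => f0 x).
  case: (\int[mu]_x _)%E => [r _||] //=.
  move=> _; rewrite mulr0; have [->|/eqP k1] := eqVneq k 0; first by rewrite mul0e.
  by rewrite gt0_muley// lte_fin lt0r k0 andbT; apply/eqP.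
have [c0|c0] := leP 0 c; first exact: pos.
have -> : (\int[mu]_x (c * f x)) = - \int[mu]_x ((- c) * f x).
  rewrite /Rintegral -fineN; congr fine.
  rewrite -integral_ge0N; last by move=> x _; rewrite lee_fin mulr_ge0// oppr_ge0 ltW.
  by apply: eq_integral => x _; rewrite -EFinN mulNr opprK.
by rewrite pos ?oppr_ge0 ?ltW// mulNr opprK.
Qed.

Lemma ge0_cintegralZl (z : R[i]) (f : T -> R) : measurable_fun setT f -> (forall x, 0 <= f x) ->
  cintegral mu (fun x => z * (f x)%:C) = z * (\int[mu]_x f x)%:C.
Proof.
move=> mf f0; apply: complex_eq.
  rewrite cReM /= mulr0 subr0; under eq_Rintegral do rewrite cReM /= mulr0 subr0.
  exact: ge0_RintegralZl.
rewrite cImM /= mulr0 add0r; under eq_Rintegral do rewrite cImM /= mulr0 add0r.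
exact: ge0_RintegralZl.
Qed.

End RintegralScale.

Section GammaIntegral.
Context {R : realType}.
Notation mu := (@lebesgue_measure R).
Implicit Types (z b a : R).

Definition gamma_fun z b (t : R) : R := if 0 < t then t `^ (z - 1) * expR (- (b * t)) else 0.

Lemma gamma_fun_ge0 z b t : 0 <= gamma_fun z b t.
Proof. by rewrite /gamma_fun; case: ifP => // _; rewrite mulr_ge0 ?powR_ge0 ?expR_ge0. Qed.

Lemma measurable_gamma_fun z b : measurable_fun setT (gamma_fun z b : measurableTypeR R -> R).
Proof.
apply: measurable_fun_ifT => //; first exact: measurable_fun_ltr.
apply: (measurable_funM (f := fun t : R => t `^ (z - 1))); first exact: measurable_powR.
apply: (measurableT_comp (@measurable_expR R)).
by apply: (measurable_funN (f := fun d => b * d)); exact: measurable_funM.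
Qed.

(** Substitute t |-> b t in the Gamma integral. Its finiteness follows from a beta
    integral, its positivity from a lower bound on [1, 2]; both are needed for the
    normalizing constant of the Bessel potential to mean anything. *)
Lemma integral_gamma_fun z b : 0 < z -> 0 < b ->
  [/\ 0 < Gamma z & (\int[mu]_t (gamma_fun z b t)%:E = (b `^ (- z) * Gamma z)%:E)%E].
Proof.
move=> z0 b0.
have e0 : (\int[mu]_t (gamma_fun z 1 t)%:E =
    \int[mu]_(t in `]0%R, +oo[) (t `^ (z - 1) * expR (- t))%:E)%E.
  rewrite [RHS]integral_mkcond; apply: eq_integral => t _; rewrite patchE /gamma_fun.
  case: ifPn => t0.
    by rewrite mem_set ?mul1r//= in_itv/= t0.
  by rewrite memNset//= in_itv/= andbT; apply/negP.
have fin : (\int[mu]_t (gamma_fun z 1 t)%:E < +oo)%E.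
  have [C C0 HC] := @expRN_le_powR R (z + 1) (addr_ge0 (ltW z0) ler01).
  rewrite e0; apply: (@le_lt_trans _ _ (\int[mu]_(t in `]0%R, +oo[) (C%:E * (t `^ (z - 1) * (1 + t) `^ (- (z + 1)))%:E))%E).
    apply: ge0_le_integral => //.
    - by move=> t _; rewrite lee_fin mulr_ge0 ?powR_ge0 ?expR_ge0.
    - apply/measurable_EFinP/measurable_funTS; apply: measurable_funM; first exact: measurable_powR.
      by apply: (measurableT_comp (@measurable_expR R)); exact: measurable_funN.
    - apply/measurable_EFinP/measurable_funTS; apply: measurable_funM => //.
      exact: measurable_beta_integrand.
    - move=> t; rewrite /= in_itv/= andbT => t0; rewrite -EFinM lee_fin mulrCA.
      by apply: ler_wpM2l; [exact: powR_ge0|exact: HC (ltW t0)].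
  rewrite ge0_integralZl_EFin ?(ltW C0)//; last 2 first.
  - by move=> t _; rewrite lee_fin mulr_ge0 ?powR_ge0.
  - by apply/measurable_EFinP/measurable_funTS; exact: measurable_beta_integrand.
  have /(@lee_wpmul2l _ C%:E) H := @integral_beta_le R z (z + 1) 1 z0 (ltr_pwDr ltr01 (lexx z)) ltr01.
  by apply: le_lt_trans (H _) (ltry _); rewrite lee_fin ltW.
have GE : (\int[mu]_t (gamma_fun z 1 t)%:E = (Gamma z)%:E)%E.
  rewrite /Gamma /Rintegral -e0 fineK// ge0_fin_numE//.
  by apply: integral_ge0 => t _; rewrite lee_fin gamma_fun_ge0.
have Gpos : 0 < Gamma z.
  rewrite -lte_fin -GE.
  pose k : R := 2^-1 * expR (- 2).
  have k0 : 0 < k by rewrite mulr_gt0 ?expR_gt0 ?invr_gt0.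
  apply: (@lt_le_trans _ _ (\int[mu]_(t in `[1%R, 2%R]) k%:E)%E).
    rewrite integral_cst//= (lebesgue_measure_itv `[1, 2])/= lte_fin ltr1n/=.
    by rewrite -EFinB -EFinM lte_fin mulr_gt0// subr_gt0 ltr1n.
  apply: (@le_trans _ _ (\int[mu]_(t in `[1%R, 2%R]) (gamma_fun z 1 t)%:E)%E).
    apply: ge0_le_integral => //.
    - by move=> t _; rewrite lee_fin ltW.
    - by apply: measurable_funTS; apply/measurable_EFinP; exact: measurable_gamma_fun.
    - move=> t; rewrite /= in_itv/= => /andP[t1 t2].
      have t0 : 0 < t by lra.
      rewrite lee_fin /gamma_fun t0 mul1r /k; apply: ler_pM => //.
      + rewrite powRD_gt0// powR_inv1 ?(ltW t0)//.
        apply: (@le_trans _ _ (1 * t^-1)).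
          by rewrite mul1r lef_pV2 ?posrE.
        rewrite ler_wpM2r ?invr_ge0 ?(ltW t0)//.
        have := @ge0_ler_powR R z (ltW z0) 1 t; rewrite powR1; apply => //; rewrite nnegrE//.
        exact: ltW.
      + by rewrite ler_expR lerN2.
  apply: ge0_subset_integral => //.
  - by apply/measurable_EFinP; exact: measurable_gamma_fun.
  - by move=> t _; rewrite lee_fin gamma_fun_ge0.
split => //.
have mg := measurable_gamma_fun z 1; rewrite EFinM.
have := @ge0_integral_affine1 R b 0 (fun t => (gamma_fun z 1 t)%:E) (lt0r_neq0 b0).
rewrite GE gtr0_norm// => -> //; last 2 first.
- by apply/measurable_EFinP.
- by move=> x; rewrite lee_fin gamma_fun_ge0.
rewrite [X in (_ = _ * (_ * X))%E](_ : _ = (b `^ (z - 1))%:E * \int[mu]_t (gamma_fun z b t)%:E)%E; last first.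
  rewrite -ge0_integralZl_EFin ?powR_ge0//; last 2 first.
  - by move=> t _; rewrite lee_fin gamma_fun_ge0.
  - by apply/measurable_EFinP; exact: measurable_gamma_fun.
  apply: eq_integral => t _; rewrite addr0 -EFinM; congr EFin.
  rewrite /gamma_fun pmulr_rgt0//; case: ifPn => t0; last by rewrite mulr0.
  by rewrite mul1r powRM ?(ltW b0) ?(ltW t0)// mulrA.
rewrite !muleA -!EFinM (_ : b `^ (- z) * b * b `^ (z - 1) = 1) ?mul1e//.
by rewrite -{2}(powRr1 (ltW b0)) -!powRD_gt0// -(powRr0 b); congr (_ `^ _); ring.
Qed.

(** The Laplace transform of the Gamma law. At c = pi |eta|^2 it is the symbol of the
    Bessel potential, at c = 0 it shows that the mixing measure has mass 1. *)
Lemma integral_bweight_expR a (c : R) : 0 < a -> 0 <= c ->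
  (\int[mu]_d (bweight a d * expR (- (c * d)))%:E = ((1 + 4 * pi * c) `^ (- (a / 2)))%:E)%E.
Proof.
move=> a0 c0; have z0 : 0 < a / 2 by rewrite divr_gt0.
have p0 : 0 < 4 * pi :> R by rewrite mulr_gt0 ?pi_gt0.
pose b : R := c + (4 * pi)^-1.
have b0 : 0 < b by rewrite ltr_wpDl// invr_gt0.
have [G0 GI] := integral_gamma_fun z0 b0.
under eq_integral => d _.
  rewrite (_ : bweight a d * _ = bconst a * gamma_fun (a / 2) b d); last first.
    rewrite /bweight /gamma_fun -/(bconst a); case: ifPn => // d0; last by rewrite mul0r mulr0.
    rewrite -!mulrA -expRD; congr (_ * (_ * expR _)).
    by rewrite /b [in RHS]mulrDl opprD addrC [in RHS](mulrC (4 * pi)^-1).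
  rewrite EFinM; over.
rewrite /= ge0_integralZl_EFin ?bconst_ge0//; last 2 first.
- by move=> t _; rewrite lee_fin gamma_fun_ge0.
- by apply/measurable_EFinP; exact: measurable_gamma_fun.
rewrite GI -EFinM; congr EFin.
have -> : 1 + 4 * pi * c = (4 * pi) * b by rewrite /b [RHS]mulrDr mulfV ?gt_eqF// addrC.
rewrite powRM ?(ltW p0) ?(ltW b0)// /bconst [in RHS]powRN.
move: ((4 * pi) `^ (a / 2)) (powR_gt0 (a / 2) p0) (Gamma (a / 2)) G0 (b `^ (- (a / 2))) => u u0 g g0 v.
by field; rewrite !gt_eqF.
Qed.

End GammaIntegral.

Section BesselFourier.
Context {R : realType} (n : nat).
Notation mu := (@lebesgue_measure R).
Notation nu := (lebesgue_rV R n).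
Notation normc := Normc.normc.
Implicit Types (a d : R) (v eta : 'rV[R]_n).

Definition rvdot eta v : R := \sum_(j < n) eta ord0 j * v ord0 j.

(** gauss1 d is a multiple of exp(-pi a t^2) for a = 1/d. *)
Lemma cintegral_gauss1_expi d (s : R) : 0 < d ->
  cintegrable mu (fun t : measurableTypeR R => expi (2 * pi * (s * t)) * (gauss1 d t)%:C) /\
  cintegral mu (fun t : measurableTypeR R => expi (2 * pi * (s * t)) * (gauss1 d t)%:C) =
    (expR (- (pi * d * s ^+ 2)))%:C.
Proof.
move=> d0; have d1 : 0 < d^-1 by rewrite invr_gt0.
have E (t : measurableTypeR R) : expi (2 * pi * (s * t)) * (gauss1 d t)%:C =
    (d `^ (- 2^-1))%:C * (expi (2 * pi * (s * t)) * (expR (- (pi * d^-1 * t ^+ 2)))%:C).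
  by rewrite /gauss1 rmorphM mulrCA; congr (_ * (_ * (expR (- _))%:C)); rewrite mulrAC.
split.
  apply: (eq_cintegrable (fun t => esym (E t))); apply: cintegrableZl.
  exact: cintegrable_gauss_expi.
rewrite (eq_cintegral _ E) cintegralZl ?cintegral_gauss_expi//; last exact: cintegrable_gauss_expi.
rewrite -rmorphM /gauss1 mulrA -powRM ?(ltW d0) ?(ltW d1)// mulfV ?gt_eqF// powR1 mul1r.
by rewrite invrK mulrAC.
Qed.

Let F d eta (j : 'I_n) (t : measurableTypeR R) : R[i] :=
  expi (2 * pi * (eta ord0 j * t)) * (gauss1 d t)%:C.

Let FE d eta v : expi (2 * pi * rvdot eta v) * (gauss d v)%:C = \prod_(j < n) F d eta j (v ord0 j).
Proof. by rewrite /rvdot mulr_sumr expi_sum /gauss rmorph_prod -big_split. Qed.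

Lemma cintegral_gauss_rV d eta : 0 < d ->
  cintegrable nu (fun v => expi (2 * pi * rvdot eta v) * (gauss d v)%:C) /\
  cintegral nu (fun v => expi (2 * pi * rvdot eta v) * (gauss d v)%:C) =
    (expR (- (pi * sqr_norm2 eta * d)))%:C.
Proof.
move=> d0; have H j := cintegral_gauss1_expi (eta ord0 j) d0.
split.
  apply: (eq_cintegrable (fun v => esym (FE d eta v))); apply: cintegrable_prod_rV => j.
  by case: (H j).
rewrite (eq_cintegral _ (FE d eta)) cintegral_prod_rV; last by move=> j; case: (H j).
under eq_bigr => j _ do rewrite (H j).2.
rewrite -rmorph_prod -expR_sum; congr (expR _)%:C.
by rewrite /sqr_norm2 sumrN mulr_sumr mulr_suml; congr (- _); apply: eq_bigr => j _; rewrite mulrAC.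
Qed.

Lemma integral_bessel_potential a : 0 < a -> (\int[nu]_v bessel_potential a v = 1)%E.
Proof.
move=> a0; under eq_integral do rewrite bessel_potentialE.
rewrite (fubini_tonelli (fun vd : 'rV[R]_n * measurableTypeR R => (bweight a vd.2 * gauss vd.2 vd.1)%:E))//=; last 2 first.
- by apply/measurable_EFinP; exact: measurable_bessel_integrand.
- by move=> vd; rewrite lee_fin mulr_ge0 ?bweight_ge0 ?gauss_ge0.
rewrite [RHS](_ : _ = \int[mu]_d (bweight a d * expR (- (0 * d)))%:E)%E; last first.
  by rewrite integral_bweight_expR// mulr0 addr0 powR1.
apply: eq_integral => d _; under eq_integral do rewrite EFinM.
rewrite mul0r oppr0 expR0 mulr1 ge0_integralZl_EFin ?bweight_ge0//; last 2 first.
- by move=> v _; rewrite lee_fin gauss_ge0.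
- by apply/measurable_EFinP; exact: measurable_gauss.
have [d0|d0] := ltP 0 d; first by rewrite integral_gauss// mule1.
by rewrite /bweight ltNge d0 mul0e.
Qed.

(** Real-valued version, differing from the Bessel potential only where the latter
    is +oo, that is at most at 0. *)
Definition bessel_kernel a v : R := fine (bessel_potential a v).

Lemma bessel_kernel_ge0 a v : 0 <= bessel_kernel a v.
Proof. exact/fine_ge0/bessel_potential_ge0. Qed.

Lemma measurable_bessel_kernel a : measurable_fun setT (bessel_kernel a).
Proof. by apply: measurableT_comp => //; exact: measurable_bessel_potential. Qed.

Lemma bessel_kernel_le a v : ((bessel_kernel a v)%:E <= bessel_potential a v)%E.
Proof.
rewrite /bessel_kernel; have := bessel_potential_ge0 a v.
by case: (bessel_potential a v) => //= _; rewrite leey.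
Qed.

Lemma cintegrable_bessel_kernel a (h : 'rV[R]_n -> R[i]) : 0 < a -> cmeasurable h ->
  (forall v, normc (h v) = 1) -> cintegrable nu (fun v => h v * (bessel_kernel a v)%:C).
Proof.
move=> a0 mh h1; split.
  by apply: cmeasurableM => //; apply: cmeasurable_real; exact: measurable_bessel_kernel.
apply: (@le_lt_trans _ _ (\int[nu]_v bessel_potential a v)%E); last by rewrite integral_bessel_potential// ltry.
apply: ge0_le_integral => //.
- by move=> v _; rewrite lee_fin normc_ge0.
- apply/measurable_EFinP; apply: measurable_normc; apply: cmeasurableM => //.
  by apply: cmeasurable_real; exact: measurable_bessel_kernel.
- exact: measurable_bessel_potential.
- move=> v _; rewrite Normc.normcM h1 mul1r normc_real ger0_norm ?bessel_kernel_ge0//.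
  exact: bessel_kernel_le.
Qed.

Lemma measurable_rvdot eta : measurable_fun setT (rvdot eta).
Proof.
apply: measurable_sum => j; apply: measurable_funM => //; exact: measurable_mx_coord.
Qed.

(** Exchange the mixture with the Fourier integral: the transform of gauss d at eta is
    exp(-pi d |eta|^2), and the mixture of these is a Laplace transform. *)
Lemma fourier_bessel_kernel a eta : 0 < a ->
  cintegral nu (fun v => expi (2 * pi * rvdot eta v) * (bessel_kernel a v)%:C) =
  ((1 + 4 * pi ^+ 2 * sqr_norm2 eta) `^ (- (a / 2)))%:C.
Proof.
move=> a0.
pose f (vd : 'rV[R]_n * measurableTypeR R) : R[i] :=
  expi (2 * pi * rvdot eta vd.1) * (bweight a vd.2 * gauss vd.2 vd.1)%:C.
have bg0 d v : 0 <= bweight a d * gauss d v by rewrite mulr_ge0 ?bweight_ge0 ?gauss_ge0.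
have me : cmeasurable (fun v => expi (2 * pi * rvdot eta v)).
  by apply: cmeasurable_expi; apply: measurable_funM => //; exact: measurable_rvdot.
have mf : cmeasurable f.
  apply: cmeasurableM; first exact: (cmeasurable_comp me measurable_fst).
  by apply: cmeasurable_real; exact: measurable_bessel_integrand.
have fi : cintegrable (nu \x mu)%E f.
  apply: cintegrable_prod => //.
  apply: (@le_lt_trans _ _ (\int[nu]_v bessel_potential a v)%E); last by rewrite integral_bessel_potential// ltry.
  rewrite le_eqVlt; apply/orP; left; apply/eqP; apply: eq_integral => v _.
  rewrite bessel_potentialE; apply: eq_integral => d _.
  by rewrite /f Normc.normcM normc_expi mul1r normc_real ger0_norm.
have E v : expi (2 * pi * rvdot eta v) * (bessel_kernel a v)%:C = cintegral mu (fun d => f (v, d)).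
  rewrite /f/= (@ge0_cintegralZl _ _ _ mu (expi (2 * pi * rvdot eta v)) (fun d => bweight a d * gauss d v))//.
    by rewrite /bessel_kernel bessel_potentialE.
  exact: (measurableT_comp (measurable_bessel_integrand a) (measurable_pair1 v)).
rewrite (eq_cintegral _ E) (cintegral_swap fi).
have E2 (d : measurableTypeR R) : cintegral nu (fun v => f (v, d)) = (bweight a d * expR (- (pi * sqr_norm2 eta * d)))%:C.
  have [d0|d0] := ltP 0 d; last first.
    rewrite /f /bweight ltNge d0 /= mul0r.
    rewrite (@eq_cintegral _ _ _ _ _ (fun v => (0 : R)%:C)); last first.
      by move=> v; rewrite mul0r mulr0.
    by rewrite cintegral_real /Rintegral integral0_eq//= mul0r.
  have [i1 i2] := cintegral_gauss_rV eta d0.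
  transitivity ((bweight a d)%:C * cintegral nu (fun v => expi (2 * pi * rvdot eta v) * (gauss d v)%:C)); last first.
    by rewrite i2 -rmorphM.
  rewrite -cintegralZl//; apply: eq_cintegral => v.
  by rewrite /f rmorphM mulrCA.
rewrite (eq_cintegral _ E2) cintegral_real /Rintegral integral_bweight_expR//; last first.
  by rewrite mulr_ge0 ?pi_ge0 ?sqr_norm2_ge0.
congr (_ `^ _)%:C; rewrite /=; congr (1 + _).
by move: (sqr_norm2 eta) (pi : R) => s p; ring.
Qed.

End BesselFourier.

(** * Fourier inversion *)

Section NiceFunctions.
Context {R : realType} (m n : nat).
Notation normc := Normc.normc.
Notation E := 'M[R]_(m, n).
Notation L := (lebesgue_mx R m n).
Implicit Types (phi : E -> R[i]) (x y u xi : E).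

(** A class of functions for which Fourier inversion holds at every point, which
    contains the Schwartz functions and is stable under convolution with integrable
    kernels. Continuity along rays is all that the inversion argument uses, and it
    is easier to propagate than continuity. *)
Definition nice phi :=
  [/\ cintegrable L phi, exists M : R, forall x, normc (phi x) <= M
    & forall x u, ccvg (fun k => phi (x + (k.+1%:R)^-1 *: u)) (phi x)].

Lemma measurable_mxdot d (T : measurableType d) (f g : T -> E) :
  measurable_fun setT f -> measurable_fun setT g -> measurable_fun setT (fun t => mxdot (f t) (g t)).
Proof.
move=> mf mg; apply: measurable_sum => i; apply: measurable_sum => j.
apply: measurable_funM.
  exact: (measurableT_comp (measurable_mx_coord _ _) mf).
exact: (measurableT_comp (measurable_mx_coord _ _) mg).
Qed.

Lemma mxdotC x y : mxdot x y = mxdot y x.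
Proof. by apply: eq_bigr => i _; apply: eq_bigr => j _; rewrite mulrC. Qed.

Lemma mxdotDr xi x y : mxdot xi (x + y) = mxdot xi x + mxdot xi y.
Proof.
rewrite /mxdot -big_split/=; apply: eq_bigr => i _; rewrite -big_split/=.
by apply: eq_bigr => j _; rewrite mxE mulrDr.
Qed.

Lemma mxdotNr xi x : mxdot xi (- x) = - mxdot xi x.
Proof.
rewrite /mxdot -sumrN; apply: eq_bigr => i _; rewrite -sumrN.
by apply: eq_bigr => j _; rewrite mxE mulrN.
Qed.

Lemma mxdotZr xi (c : R) x : mxdot xi (c *: x) = c * mxdot xi x.
Proof.
rewrite /mxdot mulr_sumr; apply: eq_bigr => i _; rewrite mulr_sumr.
by apply: eq_bigr => j _; rewrite mxE mulrCA.
Qed.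

Let cmeasurable_integrand phi : cmeasurable phi ->
  cmeasurable (fun z : E * E => expi (2 * pi * mxdot z.1 z.2) * phi z.2).
Proof.
move=> mphi; apply: cmeasurableM; last exact: (cmeasurable_comp mphi measurable_snd).
apply: cmeasurable_expi; apply: measurable_funM => //.
by apply: measurable_mxdot; [exact: measurable_fst|exact: measurable_snd].
Qed.

Lemma cmeasurable_fourier phi : cmeasurable phi -> cmeasurable (fourier phi).
Proof. by move=> /cmeasurable_integrand; exact: cmeasurable_cintegral_fst. Qed.

Lemma cmeasurable_expi_mxdot xi : cmeasurable (fun y => expi (2 * pi * mxdot xi y)).
Proof.
by apply: cmeasurable_expi; apply: measurable_funM => //; exact: measurable_mxdot.
Qed.

Lemma cintegrable_unimodular phi (h : E -> R[i]) : cintegrable L phi -> cmeasurable h ->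
  (forall y, normc (h y) = 1) -> cintegrable L (fun y => h y * phi y).
Proof.
move=> [mphi oo] mh h1; split; first exact: cmeasurableM.
by under eq_integral do rewrite Normc.normcM h1 mul1r.
Qed.

Lemma cintegrable_fourier_integrand phi xi : cintegrable L phi ->
  cintegrable L (fun y => expi (2 * pi * mxdot xi y) * phi y).
Proof.
move=> iphi; apply: cintegrable_unimodular => //; first exact: cmeasurable_expi_mxdot.
by move=> y; rewrite normc_expi.
Qed.

Lemma expgauss_mxE (e : R) xi : expgauss_mx e xi = expR (- (e * (pi * mxdot xi xi))).
Proof.
rewrite /expgauss_mx; under eq_bigr do rewrite -expR_sum.
rewrite -expR_sum; congr expR; rewrite /mxdot !mulr_sumr -sumrN; apply: eq_bigr => i _.
rewrite !mulr_sumr -sumrN; apply: eq_bigr => j _.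
by move: (pi : R) => p; ring.
Qed.

Lemma mxdot_ge0 xi : 0 <= mxdot xi xi.
Proof. by apply: sumr_ge0 => i _; apply: sumr_ge0 => j _; rewrite -expr2 sqr_ge0. Qed.

Lemma measurable_expgauss_mx (e : R) : measurable_fun setT (expgauss_mx e : E -> R).
Proof.
rewrite (_ : expgauss_mx e = fun xi => expR (- (e * (pi * mxdot xi xi)))); last first.
  by apply/funext => xi; rewrite expgauss_mxE.
apply: (measurableT_comp (@measurable_expR R)).
apply: (measurable_funN (f := fun xi => e * (pi * mxdot xi xi))).
by apply: measurable_funM => //; apply: measurable_funM => //; exact: measurable_mxdot.
Qed.

Lemma cintegrable_gaussian (e : R) : 0 < e -> cintegrable L (fun y => (expgauss_mx e y)%:C).
Proof.
move=> e0; apply: eq_cintegrable (cintegrable_expgauss_mx e0 (0 : E)) => y.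
rewrite (_ : mxdot y 0 = 0) ?mulr0 ?expi0 ?mul1r//.
by rewrite -(scale0r 0) mxdotZr mul0r.
Qed.

Lemma gauss_mx1 : gauss_mx 1 = expgauss_mx 1 :> (E -> R).
Proof.
apply/funext => x; apply: eq_bigr => i _; apply: eq_bigr => j _.
by rewrite /gauss1 powR1 mul1r divr1 mulr1 mxE.
Qed.

Lemma gauss_mx_scale (c : R) x : 0 < c -> `|c| ^+ (m * n) * gauss_mx (c ^+ 2) (c *: x) = gauss_mx 1 x.
Proof.
move=> c0; rewrite /gauss_mx /gauss.
have -> : `|c| ^+ (m * n) = \prod_(i < m) \prod_(j < n) c.
  by rewrite prod_cst_mx gtr0_norm.
rewrite -big_split/=; apply: eq_bigr => i _; rewrite -big_split/=; apply: eq_bigr => j _.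
rewrite !mxE /gauss1 mulrA powR1; congr (_ * expR (- _)).
  by rewrite powRN -powR_mulrn ?(ltW c0)// -powRrM mulfV// powRr1 ?(ltW c0)// mulfV// gt_eqF.
by move: (pi : R) (x i j) => p t; field; rewrite gt_eqF.
Qed.

(** The Gaussian of parameter c^2 is the dilate by c of the standard one. *)
Lemma gauss_mxE (c : R) x : 0 < c ->
  gauss_mx (c ^+ 2) x = (c ^+ (m * n))^-1 * expgauss_mx 1 (c^-1 *: x).
Proof.
move=> c0; rewrite -gauss_mx1 -(gauss_mx_scale _ c0) scalerA mulfV ?gt_eqF// scale1r.
by rewrite gtr0_norm// mulKf// expf_neq0// gt_eqF.
Qed.

Lemma expgauss_mx_le1 (e : R) xi : 0 <= e -> 0 <= expgauss_mx e xi <= 1.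
Proof.
move=> e0; rewrite expgauss_mxE expR_ge0/= -expR0 ler_expR oppr_le0.
by rewrite !mulr_ge0 ?pi_ge0 ?mxdot_ge0.
Qed.

Lemma cintegral_gauss_mx1 : cintegral L (fun u : E => (gauss_mx 1 u)%:C) = 1.
Proof.
transitivity ((gauss_mx 1 (0 : E))%:C : R[i]).
  rewrite -(cintegral_expgauss_mx ltr01 (0 : E)); apply: eq_cintegral => y.
  rewrite (_ : mxdot y 0 = 0) ?mulr0 ?expi0 ?mul1r ?gauss_mx1//.
  by rewrite -(scale0r 0) mxdotZr mul0r.
rewrite /gauss_mx big1// => i _; apply: big1 => j _.
by rewrite !mxE /gauss1 powR1 mul1r expr0n/= mulr0 mul0r oppr0 expR0.
Qed.

(* the scale of the k-th Gaussian regularization *)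
Let c_ k : R := (k.+1%:R)^-1.

Let c_gt0 k : 0 < c_ k. Proof. by rewrite /c_ invr_gt0. Qed.

(* Damping the inversion integral by a Gaussian amounts to averaging phi around x
   against a concentrated Gaussian, by Fubini's theorem; rescaling the variable by
   c_ k turns the latter into the fixed Gaussian gauss_mx 1. *)
Let approx phi x k : cintegrable L phi ->
  cintegral L (fun xi => (expi (- (2 * pi * mxdot x xi)) * fourier phi xi) * (expgauss_mx (c_ k ^+ 2) xi)%:C) =
  cintegral L (fun u => phi (x + c_ k *: u) * (gauss_mx 1 u)%:C).
Proof.
move=> iphi; have [mphi oo] := iphi; have e0 : 0 < c_ k ^+ 2 by rewrite exprn_gt0.
pose g xi := expgauss_mx (c_ k ^+ 2) xi.
have g0 xi : 0 <= g xi by rewrite /g expgauss_mxE expR_ge0.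
pose F (z : E * E) : R[i] := (expi (- (2 * pi * mxdot x z.1)) * (g z.1)%:C) *
   (expi (2 * pi * mxdot z.1 z.2) * phi z.2).
have mF : cmeasurable F.
  apply: cmeasurableM; last exact: cmeasurable_integrand.
  apply: (@cmeasurable_comp _ _ _ _ _ (fun xi => expi (- (2 * pi * mxdot x xi)) * (g xi)%:C)) => //.
  apply: cmeasurableM; last by apply: cmeasurable_real; exact: measurable_expgauss_mx.
  apply: cmeasurable_expi; apply: (measurable_funN (f := fun xi => 2 * pi * mxdot x xi)).
  by apply: measurable_funM => //; exact: measurable_mxdot.
have nF z : normc (F z) = g z.1 * normc (phi z.2).
  by rewrite /F !Normc.normcM !normc_expi !mul1r normc_real ger0_norm.
have mphi' : measurable_fun setT (fun y => (normc (phi y))%:E).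
  by apply/measurable_EFinP; exact: measurable_normc.
have iF : cintegrable (L \x L)%E F.
  apply: cintegrable_prod => //.
  have [_ goo] := cintegrable_gaussian e0.
  have H xi : (\int[L]_y (normc (F (xi, y)))%:E = (g xi)%:E * \int[L]_y (normc (phi y))%:E)%E.
    rewrite -ge0_integralZl_EFin//; last by move=> y _; rewrite lee_fin normc_ge0.
    by apply: eq_integral => y _; rewrite nF EFinM.
  under eq_integral do rewrite H.
  rewrite ge0_integralZr//; last 3 first.
  - by apply/measurable_EFinP; exact: measurable_expgauss_mx.
  - by move=> xi _; rewrite lee_fin.
  - by apply: integral_ge0 => y _; rewrite lee_fin normc_ge0.
  apply: lte_mul_pinfty => //.
  - by apply: integral_ge0 => xi _; rewrite lee_fin.
  - rewrite ge0_fin_numE//; last by apply: integral_ge0 => xi _; rewrite lee_fin.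
    by move: goo; under eq_integral do rewrite normc_real ger0_norm ?g0//.
transitivity (cintegral L (fun xi => cintegral L (fun y => F (xi, y)))).
  apply: eq_cintegral => xi; rewrite mulrAC -cintegralZl//.
  exact: cintegrable_fourier_integrand.
rewrite (cintegral_swap iF).
pose f y := phi y * (gauss_mx (c_ k ^+ 2) (y - x))%:C.
transitivity (cintegral L f).
  apply: eq_cintegral => y; rewrite /f -cintegral_expgauss_mx// -cintegralZl; last exact: cintegrable_expgauss_mx.
  apply: eq_cintegral => xi.
  rewrite /F/= mulrA mulrC; congr (_ * _).
  rewrite mulrAC; congr (_ * _).
  rewrite -expiD; congr expi; rewrite mxdotDr mxdotNr (mxdotC x) mulrBr addrC.
  by [].
have fi : cintegrable L f.
  apply: (@cintegrable_le _ _ _ _ _ (fun y => (c_ k ^+ (m * n))^-1 * normc (phi y))).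
  - apply: cmeasurableM => //; apply: cmeasurable_real.
    under eq_fun do rewrite gauss_mxE//.
    apply: measurable_funM => //; apply: (measurableT_comp (measurable_expgauss_mx 1)).
    rewrite (_ : (fun y => _) = fun y => (c_ k)^-1 *: y + (- ((c_ k)^-1 *: x))); last first.
      by apply/funext => y; rewrite scalerBr.
    exact: measurable_affine_mx.
  - move=> y; rewrite Normc.normcM mulrC; apply: ler_wpM2r; first exact: normc_ge0.
    have /andP[h0 h1] := expgauss_mx_le1 ((c_ k)^-1 *: (y - x)) ler01.
    have k0 : 0 <= (c_ k ^+ (m * n))^-1 by rewrite invr_ge0 exprn_ge0 ?(ltW (c_gt0 k)).
    by rewrite normc_real gauss_mxE// ger0_norm ?mulr_ge0// ler_piMr.
  - rewrite (_ : EFin \o _ = (fun y => (c_ k ^+ (m * n))^-1%:E * (normc (phi y))%:E)%E) //.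
    by apply: integrableZl => //; exact: cintegrable_norm.
have [_ ->] := cintegral_affine_mx x (lt0r_neq0 (c_gt0 k)) fi.
rewrite -cintegralZl; last by have [] := cintegral_affine_mx x (lt0r_neq0 (c_gt0 k)) fi.
apply: eq_cintegral => u; rewrite /f addrK mulrCA -rmorphM gauss_mx_scale//.
by rewrite addrC.
Qed.

Let c_cvg0 : c_ k @[k --> \oo] --> (0 : R).
Proof. exact: cvg_harmonic. Qed.

(** Let the damping tend to 0 in the previous identity. On the left, the integrands
    are dominated by |fourier phi|; on the right, by a multiple of the standard
    Gaussian, of integral 1, and they converge by continuity along rays. *)
Theorem fourier_inversion phi x : nice phi -> cintegrable L (fourier phi) ->
  inv_fourier (fourier phi) x = phi x.
Proof.
move=> [iphi [M HM] cphi] ifou.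
have mphi : cmeasurable phi by case: iphi.
pose G xi := expi (- (2 * pi * mxdot x xi)) * fourier phi xi.
have iG : cintegrable L G.
  apply: cintegrable_unimodular => //; last by move=> y; rewrite normc_expi.
  apply: cmeasurable_expi; apply: (measurable_funN (f := fun xi => 2 * pi * mxdot x xi)).
  by apply: measurable_funM => //; exact: measurable_mxdot.
have lim1 : ccvg (fun k => cintegral L (fun xi => G xi * (expgauss_mx (c_ k ^+ 2) xi)%:C)) (cintegral L G).
  apply: (@cdominated_cvg _ _ _ _ _ _ (fun xi => normc (G xi))).
  - move=> k; apply: cmeasurableM; first by case: iG.
    by apply: cmeasurable_real; exact: measurable_expgauss_mx.
  - exact: cintegrable_norm.
  - move=> xi k; rewrite Normc.normcM normc_real.
    have /andP[h0 h1] := expgauss_mx_le1 xi (sqr_ge0 (c_ k)).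
    by rewrite ger0_norm// ler_piMr// normc_ge0.
  - move=> xi; rewrite -[X in ccvg _ X]mulr1; apply: ccvgM; first exact: ccvg_cst.
    apply: (ccvg_real (l := 1)); under eq_fun do rewrite expgauss_mxE.
    have h : expR (- (c_ k ^+ 2 * (pi * mxdot xi xi))) @[k --> \oo] -->
        expR (- (0 ^+ 2 * (pi * mxdot xi xi))).
      apply: (@continuous_cvg _ _ _ _ _ _ (@expR R)); first exact: continuous_expR.
      apply: cvgN; apply: cvgM; last exact: cvg_cst.
      by rewrite expr2; under eq_fun do rewrite expr2; exact: cvgM.
    by move: h; rewrite expr0n/= mul0r oppr0 expR0.
have lim2 : ccvg (fun k => cintegral L (fun u => phi (x + c_ k *: u) * (gauss_mx 1 u)%:C))
   (cintegral L (fun u : E => phi x * (gauss_mx 1 u)%:C)).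
  have mg : measurable_fun setT (gauss_mx 1 : E -> R) by rewrite gauss_mx1; exact: measurable_expgauss_mx.
  have g0 u : 0 <= gauss_mx 1 u by rewrite gauss_mx1 expgauss_mxE expR_ge0.
  apply: (@cdominated_cvg _ _ _ _ _ _ (fun u => M * gauss_mx 1 u)).
  - move=> k; apply: cmeasurableM; last exact: cmeasurable_real.
    apply: (cmeasurable_comp mphi); under eq_fun do rewrite addrC.
    exact: measurable_affine_mx.
  - rewrite (_ : EFin \o _ = (fun u => M%:E * (gauss_mx 1 u)%:E)%E) //.
    apply: integrableZl => //.
    have := cintegrable_norm (cintegrable_gaussian ltr01); rewrite -gauss_mx1.
    by apply: eq_integrable => // u _; rewrite normc_real ger0_norm.
  - move=> u k; rewrite Normc.normcM normc_real ger0_norm//.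
    by apply: ler_wpM2r.
  - by move=> u; apply: ccvgM; [exact: cphi|exact: ccvg_cst].
have -> : phi x = cintegral L (fun u : E => phi x * (gauss_mx 1 u)%:C).
  rewrite cintegralZl ?cintegral_gauss_mx1 ?mulr1//.
  by rewrite gauss_mx1; exact: cintegrable_gaussian.
apply: ccvg_unique lim2; rewrite -[cintegral _ _]/(inv_fourier (fourier phi) x) in lim1.
by move: lim1; under eq_fun do rewrite approx//.
Qed.

End NiceFunctions.

(** * Convolution with a nonnegative integrable kernel *)

Section Convolution.
Context {R : realType} (m n : nat).
Notation normc := Normc.normc.
Notation E := 'M[R]_(m, n).
Notation L := (lebesgue_mx R m n).
Implicit Types (phi psi : E -> R[i]) (x y u xi : E).

Lemma ge0_integral_translate (f : E -> \bar R) u : measurable_fun setT f -> (forall x, 0 <= f x)%E ->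
  (\int[L]_x f (x - u)%R = \int[L]_x f x)%E.
Proof.
move=> mf f0; rewrite [RHS](ge0_integral_affine_mx (- u) (oner_neq0 R))//.
by rewrite normr1 expr1n mul1e; under [in RHS]eq_integral do rewrite scale1r.
Qed.

Lemma ge0_integral_reflect (f : E -> \bar R) u : measurable_fun setT f -> (forall x, 0 <= f x)%E ->
  (\int[L]_x f (u - x)%R = \int[L]_x f x)%E.
Proof.
move=> mf f0; have n1 : -1 != 0 :> R by rewrite oppr_eq0 oner_eq0.
rewrite [RHS](ge0_integral_affine_mx u n1)// normrN normr1 expr1n mul1e.
by under [in RHS]eq_integral do rewrite scaleN1r addrC.
Qed.

Lemma nice_fourier_inj phi psi : nice phi -> nice psi -> cintegrable L (fourier phi) ->
  fourier phi =1 fourier psi -> phi =1 psi.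
Proof.
move=> nphi npsi ifou /funext e x.
rewrite -(fourier_inversion x nphi ifou) e; apply: (fourier_inversion x npsi).
by rewrite -e.
Qed.

Variable B : E -> R.
Hypotheses (mB : measurable_fun setT B) (B0 : forall u, 0 <= B u)
  (IB : (\int[L]_u (B u)%:E < +oo)%E).

Definition convolution phi x : R[i] := cintegral L (fun u => (B u)%:C * phi (x - u)).

Let iB : L.-integrable setT (EFin \o B).
Proof.
apply/integrableP; split; first exact/measurable_EFinP.
by under eq_integral do rewrite /= ger0_norm//.
Qed.

Let IB0 : (0 <= \int[L]_u (B u)%:E)%E.
Proof. by apply: integral_ge0 => u _; rewrite lee_fin. Qed.

Let IBfin : (\int[L]_u (B u)%:E)%E \is a fin_num.
Proof. by rewrite ge0_fin_numE. Qed.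

Let normcBM (r : R) (z : R[i]) : 0 <= r -> normc (r%:C * z) = r * normc z.
Proof. by move=> r0; rewrite Normc.normcM normc_real ger0_norm. Qed.

Variable phi : E -> R[i].
Hypothesis nphi : nice phi.

Let iphi : cintegrable L phi. Proof. by case: nphi. Qed.
Let mphi : cmeasurable phi. Proof. by case: iphi. Qed.

Let Nphi0 : (0 <= \int[L]_u (normc (phi u))%:E)%E.
Proof. by apply: integral_ge0 => u _; rewrite lee_fin normc_ge0. Qed.

Let mnphi : measurable_fun setT (fun y => (normc (phi y))%:E).
Proof. by apply/measurable_EFinP; exact: measurable_normc. Qed.

Lemma cintegrable_conv_integrand x : cintegrable L (fun u => (B u)%:C * phi (x - u)).
Proof.
have [_ [M HM] _] := nphi.
apply: (@cintegrable_le _ _ _ _ _ (fun u => M * B u)).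
- by apply: cmeasurableM; [exact: cmeasurable_real|exact: (cmeasurable_comp mphi (measurable_funB_mx _ _))].
- by move=> u; rewrite normcBM// mulrC; exact: ler_wpM2r.
- by rewrite (_ : EFin \o _ = (fun u => M%:E * (B u)%:E)%E) //; exact: integrableZl.
Qed.

Lemma normc_conv_le x : ((normc (convolution phi x))%:E <=
  2%:E * \int[L]_u (B u * normc (phi (x - u)))%:E)%E.
Proof.
apply: le_trans (normc_cintegral_le (cintegrable_conv_integrand x)) _.
by under eq_integral do rewrite normcBM//.
Qed.

Let mBphi : measurable_fun setT (fun z : E * E => (B z.2 * normc (phi (z.1 - z.2)))%:E).
Proof.
apply/measurable_EFinP; apply: measurable_funM; first exact: (measurableT_comp mB measurable_snd).
by apply: measurable_normc; exact: (cmeasurable_comp mphi (measurable_funB_mx measurable_fst measurable_snd)).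
Qed.

Let Bphi0 (z : E * E) : (0 <= (B z.2 * normc (phi (z.1 - z.2)))%:E)%E.
Proof. by rewrite lee_fin mulr_ge0 ?normc_ge0. Qed.

(* By Tonelli's theorem and translation invariance. *)
Let double : (\int[L]_x \int[L]_u (B u * normc (phi (x - u)))%:E < +oo)%E.
Proof.
rewrite (fubini_tonelli (fun z : E * E => (B z.2 * normc (phi (z.1 - z.2)))%:E))//=.
have H u : (\int[L]_x (B u * normc (phi (x - u)))%:E = (B u)%:E * \int[L]_x (normc (phi x))%:E)%E.
  rewrite -(ge0_integral_translate u mnphi); last by move=> x; rewrite lee_fin normc_ge0.
  rewrite -ge0_integralZl_EFin//.
  - by move=> x _; rewrite lee_fin normc_ge0.
  - exact: (measurableT_comp mnphi (measurable_funB_mx _ _)).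
under eq_integral do rewrite H.
rewrite ge0_integralZr//; last 2 first.
- exact/measurable_EFinP.
- by move=> u _; rewrite lee_fin.
by apply: lte_mul_pinfty => //; case: iphi.
Qed.

Lemma nice_conv : nice (convolution phi).
Proof.
have [_ [M HM] cphi] := nphi.
have mc : cmeasurable (fun z : E * E => (B z.2)%:C * phi (z.1 - z.2)).
  apply: cmeasurableM; last exact: (cmeasurable_comp mphi (measurable_funB_mx measurable_fst measurable_snd)).
  by apply: cmeasurable_real; exact: (measurableT_comp mB measurable_snd).
split.
- split; first exact: (cmeasurable_cintegral_fst _ mc).
  apply: (@le_lt_trans _ _ (\int[L]_x (2%:E * \int[L]_u (B u * normc (phi (x - u)))%:E))%E).
    apply: ge0_le_integral => //.
    + by move=> x _; rewrite lee_fin normc_ge0.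
    + by apply/measurable_EFinP; apply: measurable_normc; exact: (cmeasurable_cintegral_fst _ mc).
    + by apply: emeasurable_funM => //; exact: (measurable_fun_fubini_tonelli_F _ mBphi).
    + by move=> x _; exact: normc_conv_le.
  rewrite ge0_integralZl_EFin//; last 2 first.
  + by move=> x _; apply: integral_ge0 => u _; exact: (Bphi0 (x, u)).
  + exact: (measurable_fun_fubini_tonelli_F _ mBphi).
  by apply: lte_mul_pinfty => //; rewrite ?lee_fin.
- exists (2 * (M * fine (\int[L]_u (B u)%:E))) => x.
  have M0 : 0 <= M by apply: le_trans (HM 0); exact: normc_ge0.
  rewrite -lee_fin; apply: le_trans (normc_conv_le x) _.
  rewrite EFinM; apply: lee_wpmul2l; first by rewrite lee_fin.
  rewrite EFinM fineK// -ge0_integralZl_EFin//; last exact/measurable_EFinP.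
    apply: ge0_le_integral => //.
    + by move=> u _; exact: (Bphi0 (x, u)).
    + exact: (measurableT_comp mBphi (measurable_pair1 x)).
    + by apply: emeasurable_funM => //; exact/measurable_EFinP.
    + by move=> u _; rewrite -EFinM lee_fin mulrC; apply: ler_wpM2r.
  by move=> u _; rewrite lee_fin.
- move=> x v; apply: (@cdominated_cvg _ _ _ _ _ _ (fun u => M * B u)).
  + by move=> k; case: (cintegrable_conv_integrand (x + (k.+1%:R)^-1 *: v)).
  + by rewrite (_ : EFin \o _ = (fun u => M%:E * (B u)%:E)%E) //; exact: integrableZl.
  + by move=> u k; rewrite normcBM// mulrC; exact: ler_wpM2r.
  + move=> u; apply: ccvgM; first exact: ccvg_cst.
    by under eq_fun do rewrite addrAC; exact: cphi.
Qed.

(** Fubini's theorem, then the translation x |-> x + u in the inner integral. *)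
Lemma fourier_conv xi : fourier (convolution phi) xi =
  cintegral L (fun u => expi (2 * pi * mxdot xi u) * (B u)%:C) * fourier phi xi.
Proof.
pose F (z : E * E) : R[i] := expi (2 * pi * mxdot xi z.1) * ((B z.2)%:C * phi (z.1 - z.2)).
have mF : cmeasurable F.
  apply: cmeasurableM.
    exact: (cmeasurable_comp (cmeasurable_expi_mxdot xi) measurable_fst).
  apply: cmeasurableM; last exact: (cmeasurable_comp mphi (measurable_funB_mx measurable_fst measurable_snd)).
  by apply: cmeasurable_real; exact: (measurableT_comp mB measurable_snd).
have iF : cintegrable (L \x L)%E F.
  apply: (cintegrable_prod mF); move: double.
  apply: le_lt_trans; rewrite le_eqVlt; apply/orP; left; apply/eqP.
  apply: eq_integral => x _; apply: eq_integral => u _.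
  by rewrite /F Normc.normcM normc_expi mul1r normcBM.
transitivity (cintegral L (fun x => cintegral L (fun u => F (x, u)))).
  apply: eq_cintegral => x; rewrite -cintegralZl//.
  exact: cintegrable_conv_integrand.
rewrite (cintegral_swap iF).
have H u : cintegral L (fun x => F (x, u)) =
    fourier phi xi * (expi (2 * pi * mxdot xi u) * (B u)%:C).
  pose f x := expi (2 * pi * mxdot xi x) * ((B u)%:C * phi (x - u)).
  have fi : cintegrable L f.
    apply: cintegrable_unimodular => //.
    - apply: cintegrableZl; have [+ _] := cintegral_affine_mx (- u) (oner_neq0 R) iphi.
      by apply: eq_cintegrable => x; rewrite scale1r.
    - exact: cmeasurable_expi_mxdot.
    - by move=> y; rewrite normc_expi.
  have [_ E1] := cintegral_affine_mx u (oner_neq0 R) fi.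
  rewrite [LHS]E1 normr1 expr1n mul1r mulrC -cintegralZl//; last exact: cintegrable_fourier_integrand.
  apply: eq_cintegral => x; rewrite /f scale1r addrK mxdotDr mulrDr expiD.
  by rewrite [X in X * _]mulrC mulrACA.
rewrite (eq_cintegral _ H) cintegralZl; first by rewrite mulrC.
apply: cintegrable_unimodular.
- split; first exact: cmeasurable_real.
  by under eq_integral do rewrite normc_real ger0_norm//.
- exact: cmeasurable_expi_mxdot.
- by move=> y; rewrite normc_expi.
Qed.

End Convolution.

(** * Schwartz functions *)

Section ContinuousMeasurable.
Context {R : realType} (m n : nat).
Notation E := 'M[R]_(m, n).

(* Rounding down to the grid of step 1/(k+1) is measurable with countable range. *)
Let grid (k : nat) (z : 'M[int]_(m, n)) : E := \matrix_(i, j) ((z i j)%:~R / k.+1%:R).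
Let cell (k : nat) (x : E) : 'M[int]_(m, n) := \matrix_(i, j) Num.floor (k.+1%:R * x i j).

Let measurable_cell k z : measurable (cell k @^-1` [set z]).
Proof.
rewrite (_ : _ @^-1` _ = \bigcap_(ij in [set: 'I_m * 'I_n])
    ((fun x : E => k.+1%:R * x ij.1 ij.2) @^-1` `[(z ij.1 ij.2)%:~R, (z ij.1 ij.2 + 1)%:~R[)).
  apply: fin_bigcap_measurable => // -[i j] _ /=.
  rewrite -[X in measurable X]setTI.
  have mg : measurable_fun setT (fun x : E => k.+1%:R * x i j : measurableTypeR R).
    by apply: measurable_funM => //; exact: measurable_mx_coord.
  exact: mg.
apply/seteqP; split => x /=.
  by move=> <- [i j] _ /=; rewrite in_itv/= mxE floor_itv.
move=> H; apply/matrixP => i j; rewrite mxE; apply/eqP; rewrite floor_eq.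
by have := H (i, j) Logic.I; rewrite /= in_itv.
Qed.

Lemma cvg_mx_coord (u : nat -> E) (x : E) :
  (forall i j, u k i j @[k --> \oo] --> x i j) -> u @ \oo --> x.
Proof.
move=> ux; apply/cvg_ballP => e e0.
have h : \forall k \near \oo, forall i j, `|x i j - u k i j| < e.
  apply: filter_forall => i; apply: filter_forall => j.
  by have /cvgrPdist_lt/(_ _ e0) := ux i j.
by apply: filterS h => k H; split.
Qed.

(** The topology of matrices is that of the sup norm while their sigma-algebra is
    generated by the coordinates; a continuous function is the pointwise limit of its
    compositions with the roundings to finer and finer grids, which are measurable. *)
Lemma continuous_measurable_mx (f : E -> R) : continuous f ->
  measurable_fun setT (f : E -> measurableTypeR R).
Proof.
move=> cf; apply: (@measurable_fun_cvg _ _ _ _ (fun k x => f (grid k (cell k x)))).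
  move=> k _ A mA; rewrite setTI.
  rewrite (_ : _ @^-1` A = \bigcup_z (if f (grid k z) \in A then cell k @^-1` [set z] else set0)).
    by apply: countable_bigcupT_measurable => // z; case: ifP => // _; exact: measurable_cell.
  apply/seteqP; split => x /=.
    by move=> Ax; exists (cell k x) => //; rewrite mem_set.
  by move=> [z _]; case: ifPn => //; rewrite inE => Az /= ->.
move=> x _; apply: continuous_cvg; first exact: cf.
apply: cvg_mx_coord => i j; rewrite /grid /cell.
under eq_fun do rewrite !mxE.
apply/cvgrPdist_lt => e e0.
have /cvgrPdist_lt/(_ _ e0) := @cvg_harmonic R.
apply: filterS => k; rewrite sub0r normrN /= /harmonic => h.
apply: le_lt_trans h; rewrite [leRHS]ger0_norm ?invr_ge0//.
have /andP[h1 h2] := floor_itv (k.+1%:R * x i j).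
have k0 : 0 < k.+1%:R :> R by [].
rewrite -(ler_pM2l k0) mulfV ?gt_eqF// -{1}(gtr0_norm k0) -normrM mulrBr.
rewrite mulrCA mulfV ?gt_eqF// mulr1 ger0_norm ?subr_ge0//.
by rewrite intrD in h2; rewrite lerBlDl ltW.
Qed.

End ContinuousMeasurable.

Section Schwartz.
Context {R : realType} (m n : nat).
Notation normc := Normc.normc.
Notation Re := complex.Re.
Notation Im := complex.Im.
Notation E := 'M[R]_(m, n).
Notation L := (lebesgue_mx R m n).
Implicit Types (f g : E -> R[i]) (x y u xi : E) (ij : 'I_m * 'I_n).

Lemma schwartz_pderiv ij f : schwartz f -> schwartz (pderiv ij f).
Proof.
have e s : pderivs s (pderiv ij f) = pderivs (rcons s ij) f by rewrite /pderivs foldr_rcons.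
by move=> [df bf]; split => [s|b s]; rewrite e.
Qed.

Lemma cdifferentiableDZ f g (c : R) x : cdifferentiable f x -> cdifferentiable g x ->
  cdifferentiable (fun y => f y + c%:C * g y) x.
Proof.
move=> [rf if_] [rg ig]; split.
  under eq_fun do rewrite cReD cReM /= mul0r subr0.
  by apply: differentiableD => //; exact: differentiableZ.
under eq_fun do rewrite cImD cImM /= mul0r addr0.
by apply: differentiableD => //; exact: differentiableZ.
Qed.

Lemma pderivDZ ij f g (c : R) : (forall x, cdifferentiable f x) -> (forall x, cdifferentiable g x) ->
  pderiv ij (fun y => f y + c%:C * g y) = fun x => pderiv ij f x + c%:C * pderiv ij g x.
Proof.
move=> df dg; apply/funext => x; have [rf if_] := df x; have [rg ig] := dg x.
apply: complex_eq; rewrite ?(cReD, cImD) ?(cReM, cImM) /= mul0r ?subr0 ?addr0.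
  under eq_fun do rewrite cReD cReM /= mul0r subr0.
  rewrite deriveD ?deriveZ//; by [exact: diff_derivable|apply: derivableZ; exact: diff_derivable].
under eq_fun do rewrite cImD cImM /= mul0r addr0.
rewrite deriveD ?deriveZ//; by [exact: diff_derivable|apply: derivableZ; exact: diff_derivable].
Qed.

Lemma schwartzDZ f g (c : R) : schwartz f -> schwartz g -> schwartz (fun x => f x + c%:C * g x).
Proof.
move=> [df bf] [dg bg].
have e s : pderivs s (fun x => f x + c%:C * g x) = fun x => pderivs s f x + c%:C * pderivs s g x.
  elim: s => [|ij s IH] //=; rewrite IH pderivDZ//.
split => [s x|b s]; first by rewrite e; exact: cdifferentiableDZ.
have [M1 H1] := bf b s; have [M2 H2] := bg b s.
exists (M1 + `|c| * M2) => x; rewrite e.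
apply: (@le_trans _ _ (`|monomial b x| * (normc (pderivs s f x) + `|c| * normc (pderivs s g x)))).
  by apply: ler_wpM2l => //; apply: le_trans (le_normcD _ _) _; rewrite Normc.normcM normc_real.
by rewrite mulrDr mulrCA lerD// ler_wpM2l.
Qed.

Lemma schwartz_continuous f : schwartz f ->
  continuous (fun x => Re (f x)) /\ continuous (fun x => Im (f x)).
Proof.
by move=> [df _]; split => x; have [h1 h2] := df [::] x; apply: differentiable_continuous.
Qed.

Lemma cmeasurable_schwartz f : schwartz f -> cmeasurable f.
Proof. by move=> /schwartz_continuous[c1 c2]; split; exact: continuous_measurable_mx. Qed.

Lemma weight1_le1 (t : R) : weight1 t <= 1.
Proof.
apply: (@le_trans _ _ (1 `^ (- 2))); last by rewrite powR1.
by apply: ler_powRN => //; rewrite lerDl.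
Qed.

Lemma inv1Dsqr_le_weight1 (t : R) : (1 + t ^+ 2)^-1 <= 2 * weight1 t.
Proof.
have t0 : 0 < 1 + `|t| by rewrite ltr_pwDl.
rewrite /weight1 powRN (powR_mulrn 2 (ltW t0)) -[2 / _]invrK invf_div.
rewrite lef_pV2 ?posrE ?divr_gt0 ?exprn_gt0//; last by rewrite ltr_pwDl// sqr_ge0.
rewrite ler_pdivrMr// -(real_normK (num_real t)); move: `|t| => s.
by have := sqr_ge0 (1 - s); rewrite sqrrB sqrrD; lra.
Qed.

Lemma integral_prod_weight1_lty :
  (\int[lebesgue_rV R n]_v (\prod_(j < n) weight1 (v ord0 j))%:E < +oo)%E.
Proof.
have w0 (t : R) : (0 <= (weight1 t)%:E)%E by rewrite lee_fin ltW// weight1_gt0.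
under eq_integral do rewrite -prodEFin.
rewrite (ge0_integral_prod_rV (F := fun _ t => (weight1 t)%:E))//; last first.
  by move=> _; apply/measurable_EFinP; exact: measurable_weight1.
rewrite -ge0_fin_numE; last by apply: prode_ge0 => j _; exact: integral_ge0.
apply: prode_fin_num => j _; rewrite ge0_fin_numE ?integral_weight1_lty//.
exact: integral_ge0.
Qed.

Definition weight x : R := \prod_(i < m) \prod_(j < n) weight1 (x i j).

Lemma weight_gt0 x : 0 < weight x.
Proof. by apply: prodr_gt0 => i _; apply: prodr_gt0 => j _; exact: weight1_gt0. Qed.

Lemma weight_le1 x : weight x <= 1.
Proof.
apply: prodr_ile1 => i _; rewrite prodr_ge0/=; last by move=> j _; exact: ltW (weight1_gt0 _).
by apply: prodr_ile1 => j _; rewrite (ltW (weight1_gt0 _))/= weight1_le1.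
Qed.

Lemma measurable_weight : measurable_fun setT weight.
Proof.
apply: measurable_prod => i _; apply: measurable_prod => j _.
exact: (measurableT_comp measurable_weight1 (measurable_mx_coord _ _)).
Qed.

Lemma integral_weight_lty : (\int[L]_x (weight x)%:E < +oo)%E.
Proof.
pose F (i : 'I_m) (v : 'rV[R]_n) : \bar R := (\prod_(j < n) weight1 (v ord0 j))%:E.
under eq_integral do rewrite /weight -prodEFin.
rewrite (_ : (\int[L]_x _ = \int[L]_x \prod_(i < m) F i (row i x))%E); last first.
  apply: eq_integral => x _; apply: eq_bigr => i _; congr EFin; apply: eq_bigr => j _.
  by rewrite mxE.
have F0 i v : (0 <= F i v)%E.
  by rewrite lee_fin prodr_ge0// => j _; exact: ltW (weight1_gt0 _).
rewrite (ge0_integral_prod_mx (F := F))//; last first.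
  move=> i; apply/measurable_EFinP; apply: measurable_prod => j _.
  exact: (measurableT_comp measurable_weight1 (measurable_mx_coord _ _)).
rewrite -ge0_fin_numE; last first.
  by apply: prode_ge0 => i _; apply: integral_ge0 => v _.
apply: prode_fin_num => i _; rewrite ge0_fin_numE; last exact: integral_ge0.
exact: integral_prod_weight1_lty.
Qed.

Lemma integrable_weight (M : R) : L.-integrable setT (EFin \o (fun x => M * weight x)).
Proof.
rewrite (_ : EFin \o _ = (fun x => M%:E * (weight x)%:E)%E)//; apply: integrableZl => //.
apply/integrableP; split; first by apply/measurable_EFinP; exact: measurable_weight.
under eq_integral do rewrite /= ger0_norm ?(ltW (weight_gt0 _))//.
exact: integral_weight_lty.
Qed.

Lemma weight_shift x u : (forall i j, `|u i j| <= 1) -> weight (x + u) <= 4 ^+ (m * n) * weight x.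
Proof.
move=> u1; rewrite -prod_cst_mx.
have w0 (t : R) : 0 <= weight1 t by rewrite ltW// weight1_gt0.
rewrite -big_split/=; apply: ler_prod => i _; rewrite prodr_ge0//= -big_split/=.
apply: ler_prod => j _; rewrite w0/=; apply: weight1_shift; rewrite mxE [x i j + _]addrC addrK.
exact: u1.
Qed.

(** Expanding the product of the 1 + x_ij^2 gives a sum of monomials; the induction
    adds one factor at a time, by changing an exponent by 2. *)
Lemma schwartz_decay f : schwartz f ->
  exists2 M : R, 0 <= M & forall x, normc (f x) <= M * weight x.
Proof.
move=> [_ bf].
pose sq ij : 'M[nat]_(m, n) := \matrix_(i, j) (if (i, j) == ij then 2 else 0)%N.
have mon (b : 'M[nat]_(m, n)) ij x : monomial (\matrix_(i, j) (b i j + sq ij i j)%N) x = monomial b x * x ij.1 ij.2 ^+ 2.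
  rewrite /monomial; under eq_bigr do under eq_bigr do rewrite mxE exprD.
  under eq_bigr do rewrite big_split/=.
  rewrite big_split/=; congr (_ * _); rewrite pair_big/= (bigD1 ij)//= big1 ?mulr1; last first.
    by move=> [i j] ne; rewrite mxE (negbTE ne).
  by rewrite mxE -surjective_pairing eqxx.
pose q (t : R) := 1 + t ^+ 2.
have step (l : seq ('I_m * 'I_n)) : forall b, exists M : R, forall x,
    `|monomial b x| * \prod_(ij <- l) q (x ij.1 ij.2) * normc (f x) <= M.
  elim: l => [|ij l IH] b.
    by have [M HM] := bf b [::]; exists M => x; rewrite big_nil mulr1; exact: HM.
  have [M1 H1] := IH b; have [M2 H2] := IH (\matrix_(i, j) (b i j + sq ij i j)%N).
  exists (M1 + M2) => x; rewrite big_cons; apply: le_trans (lerD (H1 x) (H2 x)).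
  rewrite mon normrM [`|x _ _ ^+ 2|]ger0_norm ?sqr_ge0// le_eqVlt; apply/orP; left; apply/eqP.
  by rewrite /q; ring.
have [M HM] := step (enum {: 'I_m * 'I_n}) (\matrix_(i, j) 0%N).
have m0 x : monomial (\matrix_(i, j) 0%N) x = 1.
  by rewrite /monomial big1// => i _; rewrite big1// => j _; rewrite mxE.
have M0 : 0 <= M.
  apply: le_trans (HM 0); rewrite m0 normr1 mul1r mulr_ge0 ?normc_ge0//.
  by apply: prodr_ge0 => ij _; rewrite addr_ge0 ?sqr_ge0.
exists (M * 2 ^+ (m * n)); first by rewrite mulr_ge0// exprn_ge0.
move=> x; have := HM x; rewrite m0 normr1 mul1r big_enum/=.
rewrite -(pair_big xpredT xpredT (fun i j => q (x i j)))/=.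
set Q := \prod_i _ => H.
have Q0 : 0 < Q by apply: prodr_gt0 => i _; apply: prodr_gt0 => j _; rewrite ltr_pwDl// sqr_ge0.
apply: (@le_trans _ _ (M / Q)); first by rewrite ler_pdivlMr// mulrC.
rewrite -mulrA; apply: ler_wpM2l => //.
rewrite -prod_cst_mx.
rewrite -prodfV -big_split/=; apply: ler_prod => i _.
rewrite invr_ge0 prodr_ge0/=; last by move=> j _; rewrite addr_ge0 ?sqr_ge0.
rewrite -prodfV -big_split/=; apply: ler_prod => j _.
rewrite invr_ge0 addr_ge0 ?sqr_ge0//=; exact: inv1Dsqr_le_weight1.
Qed.

Lemma nice_schwartz f : schwartz f -> nice f.
Proof.
move=> sf; have [M M0 HM] := schwartz_decay sf; split.
- by apply: cintegrable_le (cmeasurable_schwartz sf) HM _; exact: integrable_weight.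
- by exists M => x; apply: le_trans (HM x) _; rewrite ler_piMr// weight_le1.
- move=> x u; have [cr ci] := schwartz_continuous sf.
  have xu : (x + (k.+1%:R)^-1 *: u) @[k --> \oo] --> x.
    apply: cvg_mx_coord => i j; under eq_fun do rewrite !mxE.
    have : x i j + (k.+1%:R)^-1 * u i j @[k --> \oo] --> x i j + 0 * u i j.
      apply: cvgD; first exact: cvg_cst.
      by apply: cvgM; [exact: cvg_harmonic|exact: cvg_cst].
    by rewrite mul0r addr0.
  split.
    exact: (@continuous_cvg _ _ _ _ _ _ (fun x => Re (f x)) _ (cr x) xu).
  exact: (@continuous_cvg _ _ _ _ _ _ (fun x => Im (f x)) _ (ci x) xu).
Qed.

End Schwartz.

(** * The Fourier transform of derivatives *)

Section DirectionalDerivative.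
Context {R : realType} {V : normedModType R}.
Notation Re := complex.Re.
Notation Im := complex.Im.
Implicit Types (x v : V).

(** Derivatives along v are derivatives of functions of one real variable; together
    with its converse below, this makes the one-variable calculus available. *)
Lemma is_derive_line (g : V -> R) x v (u : R) l : is_derive (x + u *: v) v g l ->
  is_derive u (1 : R) (fun t : R => g (x + t *: v)) l.
Proof.
have e : (fun h : R => h^-1 *: (((fun t : R => g (x + t *: v)) \o shift u) (h *: (1 : R)) -
      g (x + u *: v))) =
    (fun h : R => h^-1 *: ((g \o shift (x + u *: v)) (h *: v) - g (x + u *: v))).
  apply/funext => h; congr (_ *: (g _ - _)) => /=.
  by rewrite [h *: 1]mulr1 scalerDl addrCA.
by move=> [dg <-]; split; [rewrite /derivable e|rewrite /derive e].
Qed.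

Lemma is_derive_of_line (g : V -> R) x v l :
  is_derive (0 : R) (1 : R) (fun t : R => g (x + t *: v)) l -> is_derive x v g l.
Proof.
have e : (fun h : R => h^-1 *: (((fun t : R => g (x + t *: v)) \o shift 0) (h *: (1 : R)) -
      g (x + 0 *: v))) =
    (fun h : R => h^-1 *: ((g \o shift x) (h *: v) - g x)).
  apply/funext => h; rewrite scale0r addr0; congr (_ *: (g _ - _)) => /=.
  by rewrite [h *: 1]mulr1 addr0 addrC.
by move=> [dg <-]; split; [move: dg; rewrite /derivable e|rewrite /derive e].
Qed.

(** Componentwise, in accordance with pderiv. *)
Definition is_cderive x v (f : V -> R[i]) (l : R[i]) :=
  is_derive x v (fun y => Re (f y)) (Re l) /\ is_derive x v (fun y => Im (f y)) (Im l).

Lemma is_cderiveM x v (f g : V -> R[i]) k l : is_cderive x v f k -> is_cderive x v g l ->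
  is_cderive x v (fun y => f y * g y) (k * g x + f x * l).
Proof.
move=> [rf if_] [rg ig]; split.
  under eq_fun do rewrite cReM.
  apply: is_derive_eq; rewrite /GRing.scale /= cReD !cReM; ring.
under eq_fun do rewrite cImM.
apply: is_derive_eq; rewrite /GRing.scale /= cImD !cImM; ring.
Qed.

End DirectionalDerivative.

Section FourierDerivative.
Context {R : realType} (m n : nat).
Notation normc := Normc.normc.
Notation Re := complex.Re.
Notation Im := complex.Im.
Notation E := 'M[R]_(m, n).
Notation L := (lebesgue_mx R m n).
Implicit Types (f g : E -> R[i]) (x y u xi : E) (ij : 'I_m * 'I_n).

Let delta ij : E := delta_mx ij.1 ij.2.

Lemma is_cderive_pderiv f ij x : cdifferentiable f x ->
  is_cderive x (delta ij) f (pderiv ij f x).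
Proof. by move=> [rf if_]; split; apply: derivableP; exact: diff_derivable. Qed.

Lemma mxdot_delta xi ij : mxdot xi (delta ij) = xi ij.1 ij.2.
Proof.
rewrite /mxdot pair_big/= (bigD1 ij)//= /delta mxE !eqxx mulr1 big1 ?addr0// => -[i j] ne.
rewrite mxE; case: eqP => [e1|]; case: eqP => [e2|]; rewrite ?mulr0//.
by case/eqP: ne; rewrite [ij]surjective_pairing/= -e1 -e2.
Qed.

Lemma is_cderive_expi xi x v :
  is_cderive x v (fun y => expi (2 * pi * mxdot xi y))
    ((0 +i* (2 * pi * mxdot xi v)) * expi (2 * pi * mxdot xi x)).
Proof.
set b := 2 * pi * mxdot xi v; set a := 2 * pi * mxdot xi x.
have e t : 2 * pi * mxdot xi (x + t *: v) = a + t * b.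
  by rewrite mxdotDr mxdotZr mulrDr mulrCA.
have da : is_derive (0 : R) (1 : R) (fun t : R => a + t * b) b.
  by apply: is_derive_eq; rewrite /GRing.scale /= ; ring.
split; apply: is_derive_of_line => /=.
  under eq_fun do rewrite e.
  apply: is_derive_eq; rewrite /GRing.scale /= mul0r addr0; ring.
under eq_fun do rewrite e.
apply: is_derive_eq; rewrite /GRing.scale /= mul0r addr0; ring.
Qed.

(** By the mean value theorem, the difference quotients of F at x are bounded by the
    values of F' within distance 1 from x, hence by a multiple of the weight at x. *)
Lemma cintegral_derivative_eq0 ij (F F' : E -> R[i]) (K : R) : cmeasurable F ->
  (forall x, is_cderive x (delta ij) F (F' x)) ->
  (forall x, normc (F x) <= K * weight x) -> (forall x, normc (F' x) <= K * weight x) ->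
  cintegral L F' = 0.
Proof.
move=> mF dF FK F'K.
have [K0|K0] := leP 0 K; last first.
  have /negP[] : ~~ (K * weight (0 : E) < 0).
    by rewrite -leNgt; apply: le_trans (FK 0); exact: normc_ge0.
  by rewrite nmulr_rlt0// weight_gt0.
pose tau (k : nat) (x : E) := 1 *: x + (k.+1%:R)^-1 *: delta ij.
have mtau k : measurable_fun setT (tau k) by exact: measurable_affine_mx.
have tauP k (f : E -> \bar R) : measurable_fun setT f -> (forall x, 0 <= f x)%E ->
    (\int[L]_x f x = 1%:E * \int[L]_x f (tau k x))%E.
  move=> mf f0; rewrite (ge0_integral_affine_mx ((k.+1%:R)^-1 *: delta ij) (oner_neq0 R))//.
  by rewrite normr1 expr1n.
pose G x := K * 4 ^+ (m * n) * weight x.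
have iG : L.-integrable setT (EFin \o G) by exact: integrable_weight.
have main (g g' : E -> R) : measurable_fun setT g -> (forall x, `|g x| <= K * weight x) ->
    (forall x, is_derive x (delta ij) g (g' x)) -> (forall x, `|g' x| <= K * weight x) ->
    \int[L]_x g' x = 0.
  move=> mg gK dg g'K.
  have [] // := @Rintegral_derivative_eq0 R _ _ L tau mtau tauP g g' G.
  - have mge : measurable_fun setT (EFin \o g) by exact/measurable_EFinP.
    have iK : L.-integrable setT (EFin \o (fun x : E => K * weight x)) by exact: integrable_weight.
    apply: (le_integrable measurableT mge _ iK) => x _.
    rewrite lee_fin /= [leRHS]ger0_norm//.
    by rewrite mulr_ge0// ltW// weight_gt0.
  - move=> x k; rewrite /tau scale1r.
    have := @difference_quotient_le R (fun t => g (x + t *: delta ij))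
      (fun t => g' (x + t *: delta ij)) (G x) k.
    rewrite scale0r addr0; apply.
      by move=> u; apply: is_derive_line; exact: dg.
    move=> u /andP[u0 u1]; apply: le_trans (g'K _) _; rewrite /G -mulrA; apply: ler_wpM2l => //.
    apply: weight_shift => i j; rewrite !mxE normrM (ger0_norm u0).
    by case: (_ && _); rewrite ?normr1 ?normr0 ?mulr1 ?mulr0.
  - by move=> x; rewrite /tau scale1r; exact: cvg_difference_quotient.
have [mr mi] := mF.
apply: complex_eq => /=.
  apply: (main (fun x => Re (F x))) => // x.
  - exact: le_trans (Re_le_normc _) (FK x).
  - by case: (dF x).
  - exact: le_trans (Re_le_normc _) (F'K x).
apply: (main (fun x => Im (F x))) => // x.
- exact: le_trans (Im_le_normc _) (FK x).
- by case: (dF x).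
- exact: le_trans (Im_le_normc _) (F'K x).
Qed.

(** The derivative of y |-> expi (2 pi xi . y) * f y has integral 0; expand it by the
    product rule. *)
Lemma fourier_pderiv f ij xi : schwartz f ->
  fourier (pderiv ij f) xi = - ((0 +i* (2 * pi * xi ij.1 ij.2)) * fourier f xi).
Proof.
move=> sf; have sdf := schwartz_pderiv ij sf.
have [M1 M10 H1] := schwartz_decay sf; have [M2 M20 H2] := schwartz_decay sdf.
set c : R[i] := 0 +i* _.
pose e y := expi (2 * pi * mxdot xi y).
pose F y := e y * f y.
pose F' y := c * e y * f y + e y * pderiv ij f y.
have if1 := cintegrable_fourier_integrand xi (let: And3 h _ _ := nice_schwartz sf in h).
have if2 := cintegrable_fourier_integrand xi (let: And3 h _ _ := nice_schwartz sdf in h).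
have w0 x : 0 <= weight x by rewrite ltW// weight_gt0.
have E0 : cintegral L F' = 0.
  apply: (@cintegral_derivative_eq0 ij F F' (M1 + normc c * M1 + M2)).
  - by apply: cmeasurableM; [exact: cmeasurable_expi_mxdot|exact: cmeasurable_schwartz].
  - move=> x; apply: is_cderiveM.
      by have := is_cderive_expi xi x (delta ij); rewrite mxdot_delta.
    by apply: is_cderive_pderiv; case: sf => /(_ [::] x).
  - move=> x; rewrite Normc.normcM normc_expi mul1r; apply: le_trans (H1 x) _.
    by apply: ler_wpM2r => //; rewrite -addrA lerDl addr_ge0// mulr_ge0// normc_ge0.
  - move=> x; apply: le_trans (le_normcD _ _) _.
    rewrite !Normc.normcM normc_expi mulr1 mul1r.
    apply: (@le_trans _ _ ((normc c * M1 + M2) * weight x)).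
      by rewrite mulrDl -mulrA lerD// ler_wpM2l// normc_ge0.
    by apply: ler_wpM2r => //; rewrite -addrA lerDr.
apply/eqP; rewrite -addr_eq0 addrC; apply/eqP; rewrite -E0.
rewrite /fourier -cintegralZl// -cintegralD//; last exact: cintegrableZl.
by apply: eq_cintegral => y; rewrite /F' mulrA.
Qed.

Lemma fourierDZ f g (c : R) xi : cintegrable L f -> cintegrable L g ->
  fourier (fun x => f x + c%:C * g x) xi = fourier f xi + c%:C * fourier g xi.
Proof.
move=> fi gi; have f1 := cintegrable_fourier_integrand xi fi.
have g1 := cintegrable_fourier_integrand xi gi.
rewrite /fourier -cintegralZl// -cintegralD//; last exact: cintegrableZl.
by apply: eq_cintegral => y; rewrite mulrDr [in X in _ + X]mulrCA.
Qed.

(** 1 - Delta_k, with the second derivatives subtracted one after the other so that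
    each step is of the form to which schwartzDZ applies. *)
Definition one_sub_laplacian (k : 'I_m) f : E -> R[i] :=
  foldr (fun j g x => g x + (-1)%:C * pderiv (k, j) (pderiv (k, j) f) x) f (enum 'I_n).

Definition symbol (k : 'I_m) xi : R := 1 + 4 * pi ^+ 2 * sqr_norm2 (row k xi).

Lemma one_sub_laplacianP k f : schwartz f -> schwartz (one_sub_laplacian k f) /\
  forall xi, fourier (one_sub_laplacian k f) xi = (symbol k xi)%:C * fourier f xi.
Proof.
move=> sf; have ni g : schwartz g -> cintegrable L g by move=> /nice_schwartz[].
have H (s : seq 'I_n) :
    let h := foldr (fun j g x => g x + (-1)%:C * pderiv (k, j) (pderiv (k, j) f) x) f s in
    schwartz h /\ forall xi, fourier h xi =
      (1 + \sum_(j <- s) 4 * pi ^+ 2 * xi k j ^+ 2)%:C * fourier f xi.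
  elim: s => [|j s [IH1 IH2]] /=.
    by split => // xi; rewrite big_nil addr0 mul1r.
  have sd1 := schwartz_pderiv (k, j) sf; have sd2 := schwartz_pderiv (k, j) sd1.
  split; first exact: schwartzDZ.
  move=> xi; rewrite fourierDZ; [|exact: ni|exact: ni].
  rewrite IH2 fourier_pderiv// fourier_pderiv//= big_cons [_ * - (_ * fourier f xi)]mulrN opprK.
  set S := \sum_(_ <- _) _; set z := fourier f xi.
  rewrite !mulrA -mulrDl; congr (_ * z).
  apply: complex_eq; rewrite ?(cReD, cImD, cReM, cImM) /=; move: (pi : R) => p; ring.
have [H1 H2] := H (enum 'I_n); split => // xi.
rewrite H2 /symbol big_enum /= /sqr_norm2 mulr_sumr; congr ((1 + _)%:C * _).
by apply: eq_bigr => j _; rewrite mxE.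
Qed.

Lemma symbol_ge1 k xi : 1 <= symbol k xi.
Proof. by rewrite /symbol lerDl !mulr_ge0 ?sqr_norm2_ge0 ?exprn_ge0 ?pi_ge0. Qed.

Lemma symbol_gt0 k xi : 0 < symbol k xi.
Proof. exact: lt_le_trans (symbol_ge1 k xi). Qed.

(** Apply each 1 - Delta_k exactly r times. *)
Lemma schwartz_symbol_power f (r : nat) : schwartz f -> exists2 g, schwartz g &
  forall xi, fourier g xi = (\prod_(k < m) symbol k xi ^+ r)%:C * fourier f xi.
Proof.
move=> sf.
have one k g : schwartz g -> exists2 h, schwartz h &
    forall xi, fourier h xi = (symbol k xi ^+ r)%:C * fourier g xi.
  move=> sg; elim: r => [|r' [h sh H]].
    by exists g => // xi; rewrite expr0 mul1r.
  have [s1 s2] := one_sub_laplacianP k sh; exists (one_sub_laplacian k h) => // xi.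
  by rewrite s2 H mulrA -rmorphM -exprS.
have [g sg H] : exists2 g, schwartz g &
    forall xi, fourier g xi = (\prod_(k <- enum 'I_m) symbol k xi ^+ r)%:C * fourier f xi.
  elim: (enum 'I_m) => [|k s [h sh H]].
    by exists f => // xi; rewrite big_nil mul1r.
  have [h' sh' H'] := one k h sh; exists h' => // xi.
  by rewrite H' H mulrA -rmorphM big_cons.
by exists g => // xi; rewrite H big_enum.
Qed.

End FourierDerivative.

(** * Fractional powers of 1 - Delta_k on Schwartz functions *)

Section BesselOperatorsTheory.
Context {R : realType} (m n : nat).
Notation normc := Normc.normc.
Notation E := 'M[R]_(m, n).
Notation L := (lebesgue_mx R m n).
Implicit Types (f g : E -> R[i]) (x y u xi : E) (a t : 'I_m -> R).

(** The kernel of the product over k of the operators (1 - Delta_k)^(- a_k / 2). *)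
Definition bessel_kernel_mx a u : R := \prod_(i < m) bessel_kernel (a i) (row i u).

Lemma bessel_kernel_mx_ge0 a u : 0 <= bessel_kernel_mx a u.
Proof. by apply: prodr_ge0 => i _; exact: bessel_kernel_ge0. Qed.

Lemma measurable_bessel_kernel_mx a : measurable_fun setT (bessel_kernel_mx a).
Proof.
apply: measurable_prod => i _.
exact: (measurableT_comp (measurable_bessel_kernel (a i)) (@measurable_row R m n i)).
Qed.

Let F a xi (i : 'I_m) (v : 'rV[R]_n) : R[i] :=
  expi (2 * pi * rvdot (row i xi) v) * (bessel_kernel (a i) v)%:C.

Let FE a xi u : expi (2 * pi * mxdot xi u) * (bessel_kernel_mx a u)%:C =
  \prod_(i < m) F a xi i (row i u).
Proof.
rewrite /mxdot mulr_sumr expi_sum /bessel_kernel_mx rmorph_prod -big_split/=.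
apply: eq_bigr => i _; congr (expi (_ * _) * _).
by apply: eq_bigr => j _; rewrite !mxE.
Qed.

Let iF a xi i : (forall k, 0 < a k) -> cintegrable (lebesgue_rV R n) (F a xi i).
Proof.
move=> a0; apply: cintegrable_bessel_kernel => //.
  apply: cmeasurable_expi; apply: measurable_funM => //; exact: measurable_rvdot.
by move=> v; rewrite normc_expi.
Qed.

Lemma integral_bessel_kernel_mx_lty a : (forall k, 0 < a k) ->
  (\int[L]_u (bessel_kernel_mx a u)%:E < +oo)%E.
Proof.
move=> a0; have [_] := cintegrable_prod_mx (fun i => iF (0 : E) i a0).
apply: le_lt_trans; rewrite le_eqVlt; apply/orP; left; apply/eqP.
apply: eq_integral => u _; rewrite -FE Normc.normcM normc_expi mul1r normc_real ger0_norm//.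
exact: bessel_kernel_mx_ge0.
Qed.

Lemma fourier_bessel_kernel_mx a xi : (forall k, 0 < a k) ->
  cintegral L (fun u => expi (2 * pi * mxdot xi u) * (bessel_kernel_mx a u)%:C) =
  (\prod_(k < m) symbol k xi `^ (- (a k / 2)))%:C.
Proof.
move=> a0; rewrite (eq_cintegral _ (FE a xi)) (cintegral_prod_mx (fun i => iF xi i a0)).
rewrite rmorph_prod; apply: eq_bigr => k _.
exact: fourier_bessel_kernel.
Qed.

(** g is the product over k of the (1 - Delta_k)^(t_k) applied to f. As bessel_ops
    composes Fourier multipliers through successive inversions, this relation is
    used to follow the intermediate functions, which are in general not known to be
    Schwartz functions. *)
Definition has_symbol f t g :=
  nice g /\ forall xi, fourier g xi = (\prod_(k < m) symbol k xi `^ t k)%:C * fourier f xi.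

Lemma has_symbol_conv f t g a : (forall k, 0 < a k) -> has_symbol f t g ->
  has_symbol f (fun k => t k - a k / 2) (convolution (bessel_kernel_mx a) g).
Proof.
move=> a0 [ng fg].
have mB := measurable_bessel_kernel_mx a; have B0 := bessel_kernel_mx_ge0 a.
have IB := integral_bessel_kernel_mx_lty a0.
split; first exact: nice_conv.
move=> xi; rewrite fourier_conv// fourier_bessel_kernel_mx// fg mulrA -rmorphM; congr (_%:C * _).
rewrite -big_split/=; apply: eq_bigr => k _.
by rewrite -powRD_gt0 ?symbol_gt0// addrC.
Qed.

Lemma has_symbol_eq f t t' g : t =1 t' -> has_symbol f t g -> has_symbol f t' g.
Proof.
move=> tt' [ng fg]; split => // xi; rewrite fg; congr (_%:C * _).
by apply: eq_bigr => k _; rewrite tt'.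
Qed.

(** Overshoot with an integer r above all t_k, which only takes derivatives of f, and
    come back by convolution with the Bessel kernel of orders 2 (r - t_k) > 0. *)
Lemma has_symbol_exists f t : schwartz f -> exists g, has_symbol f t g.
Proof.
move=> sf; pose r := Num.bound (\sum_k `|t k|).
have tr k : t k < r%:R.
  apply: le_lt_trans (ler_norm _) _.
  apply: le_lt_trans (archi_boundP _); last by apply: sumr_ge0.
  by rewrite (bigD1 k)//= lerDl sumr_ge0.
have [h sh fh] := schwartz_symbol_power r sf.
pose a k := 2 * (r%:R - t k).
have a0 k : 0 < a k by rewrite mulr_gt0// subr_gt0.
have hh : has_symbol f (fun=> r%:R) h.
  split; first exact: nice_schwartz.
  move=> xi; rewrite fh; congr (_%:C * _); apply: eq_bigr => k _.
  by rewrite powR_mulrn// ltW// symbol_gt0.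
exists (convolution (bessel_kernel_mx a) h); apply: has_symbol_eq (has_symbol_conv a0 hh) => k /=.
by rewrite /a; field.
Qed.

Let symbol_weight xi : \prod_(k < m) symbol k xi `^ (- n%:R) <= 2 ^+ (m * n) * weight xi.
Proof.
rewrite -prod_cst_mx.
rewrite -big_split/=; apply: ler_prod => k _; rewrite powR_ge0/= -big_split/=.
have -> : symbol k xi `^ (- n%:R) = \prod_(j < n) (symbol k xi)^-1.
  by rewrite powRN powR_mulrn ?(ltW (symbol_gt0 _ _))// prodr_const card_ord exprVn.
apply: ler_prod => j _; have s0 := symbol_gt0 k xi; rewrite invr_ge0 (ltW s0)/=.
apply: le_trans (inv1Dsqr_le_weight1 _); rewrite lef_pV2 ?posrE//; last by rewrite ltr_pwDl// sqr_ge0.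
rewrite /symbol lerD2l; apply: (@le_trans _ _ (1 * sqr_norm2 (row k xi))).
  by rewrite mul1r /sqr_norm2 (bigD1 j)//= mxE lerDl sumr_ge0// => i _; rewrite sqr_ge0.
apply: ler_wpM2r; first exact: sqr_norm2_ge0.
have := pi_ge2 R; move: (pi : R) => p p2; rewrite expr2.
have : 2 * 2 <= p * p by apply: ler_pM.
lra.
Qed.

(** Compare with the exponents t_k + n: that Fourier transform is bounded, being that
    of an integrable function, and the product of the symbols to the power -n is
    integrable. *)
Lemma has_symbol_integrable f t g : schwartz f -> has_symbol f t g -> cintegrable L (fourier g).
Proof.
move=> sf [ng fg]; have [g' [ng' fg']] := has_symbol_exists (fun k => t k + n%:R) sf.
have [i1 _ _] := ng; have [i2 _ _] := ng'.
pose C := 2 * fine (\int[L]_y (normc (g' y))%:E)%E.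
have I0 : (0 <= \int[L]_y (normc (g' y))%:E)%E by apply: integral_ge0 => y _; rewrite lee_fin normc_ge0.
have Cle xi : normc (fourier g' xi) <= C.
  rewrite -lee_fin; apply: le_trans (normc_cintegral_le (cintegrable_fourier_integrand xi i2)) _.
  under eq_integral do rewrite Normc.normcM normc_expi mul1r.
  by rewrite /C EFinM fineK// ge0_fin_numE//; case: i2.
apply: (@cintegrable_le _ _ _ _ _ (fun xi => C * 2 ^+ (m * n) * weight xi)).
- by apply: cmeasurable_fourier; case: i1.
- move=> xi; have -> : fourier g xi = (\prod_(k < m) symbol k xi `^ (- n%:R))%:C * fourier g' xi.
    rewrite fg fg' mulrA -rmorphM -big_split/=; congr (_%:C * _); apply: eq_bigr => k _.
    by rewrite -powRD_gt0 ?symbol_gt0//; congr (_ `^ _); ring.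
  rewrite Normc.normcM normc_real ger0_norm; last by apply: prodr_ge0 => k _; exact: powR_ge0.
  rewrite mulrC -mulrA; apply: ler_pM => //.
  + exact: normc_ge0.
  + by apply: prodr_ge0 => k _; exact: powR_ge0.
- exact: integrable_weight.
Qed.

(** bessel_op inverts a Fourier transform that is already known to be the one of some
    nice g', so that it returns g' by Fourier inversion. *)
Lemma bessel_op_has_symbol f t g k (s : R) : schwartz f -> has_symbol f t g ->
  has_symbol f (fun i => t i + (if i == k then s else 0)) (bessel_op k s g).
Proof.
move=> sf [ng fg]; set t' := fun i => _.
have [g' hg'] := has_symbol_exists t' sf; have [ng' fg'] := hg'.
suff -> : bessel_op k s g = g' by [].
apply/funext => x; rewrite -(fourier_inversion x ng' (has_symbol_integrable sf hg')).
rewrite /bessel_op; congr (inv_fourier _ x); apply/funext => xi.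
rewrite -/(symbol k xi) fg fg' mulrA -rmorphM; congr (_%:C * _).
rewrite [LHS](_ : _ = \prod_(i < m) (symbol i xi `^ (if i == k then s else 0) * symbol i xi `^ t i)).
  by apply: eq_bigr => i _; rewrite /t' -powRD_gt0 ?symbol_gt0// addrC.
rewrite big_split/=; congr (_ * _); rewrite (bigD1 k)//= eqxx big1 ?mulr1// => i /negbTE ->.
by rewrite powRr0.
Qed.

Lemma has_symbol0 f : schwartz f -> has_symbol f (fun=> 0) f.
Proof.
move=> sf; split; first exact: nice_schwartz.
by move=> xi; rewrite big1 ?mul1r// => k _; rewrite powRr0.
Qed.

Lemma bessel_ops_has_symbol f (alpha : 'I_m -> R) : schwartz f ->
  has_symbol f (fun k => alpha k / 4) (bessel_ops alpha f).
Proof.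
move=> sf.
have H (s : seq 'I_m) : uniq s -> has_symbol f (fun k => if k \in s then alpha k / 4 else 0)
    (foldr (fun k => bessel_op k (alpha k / 4)) f s).
  elim: s => [_|k s IH] /=; first exact: has_symbol0.
  move=> /andP[ks us]; apply: has_symbol_eq (bessel_op_has_symbol _ _ sf (IH us)) => i /=.
  rewrite in_cons; have [->|] := eqVneq i k; first by rewrite (negbTE ks) add0r.
  by rewrite addr0.
apply: has_symbol_eq (H _ (enum_uniq _)) => k /=.
by rewrite mem_enum.
Qed.

(** Both sides are nice with the same Fourier transform, since the symbols
    (1 + 4 pi^2 |xi_k|^2)^(alpha_k / 4) and their inverses cancel. *)
Lemma bessel_ops_conv f (alpha : 'I_m -> R) x : schwartz f -> (forall k, 0 < alpha k) ->
  f x = convolution (bessel_kernel_mx (fun k => alpha k / 2)) (bessel_ops alpha f) x.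
Proof.
move=> sf a0; have a20 k : 0 < alpha k / 2 by rewrite divr_gt0.
have [n2 h2] := has_symbol_conv a20 (bessel_ops_has_symbol alpha sf).
have h1 := has_symbol0 sf; have [n1 _] := h1.
apply: (nice_fourier_inj n1 n2 (has_symbol_integrable sf h1)) => xi.
rewrite h2 big1 ?mul1r// => k _; rewrite (_ : _ - _ = 0) ?powRr0//.
by field.
Qed.

End BesselOperatorsTheory.

(** * Restriction to the diagonal and its adjoint *)

Section Diagonal.
Context {R : realType} (m n : nat).
Notation normc := Normc.normc.
Notation V := 'rV[R]_n.
Notation E := 'M[R]_(m, n).
Notation nu := (lebesgue_rV R n).
Notation L := (lebesgue_mx R m n).
Implicit Types (x w v : V) (y : E) (f : E -> R[i]).

Lemma row_repeat_pointB x y k : row k (repeat_point m x - y) = x - row k y.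
Proof. by apply/rowP => j; rewrite !mxE. Qed.

Lemma measurable_repeat_point : measurable_fun setT (@repeat_point R m n).
Proof.
by apply: measurable_fun_mx => i j; under eq_fun do rewrite mxE; exact: measurable_mx_coord.
Qed.

(** The final step divides by a power of this integral, hence the need for its
    finiteness. A single row suffices for the decay, which uses m > 0. *)
Lemma integral_trace_lty f (q : R) : (0 < m)%N -> 1 <= q -> schwartz f ->
  (\int[nu]_x (normc (f (repeat_point m x)) `^ q)%:E < +oo)%E.
Proof.
move=> m0 q1 sf; have [M M0 HM] := schwartz_decay sf.
pose w x : R := \prod_(j < n) weight1 (x ord0 j).
have w0 x : 0 <= w x by apply: prodr_ge0 => j _; rewrite ltW// weight1_gt0.
have w1 x : w x <= 1.
  by apply: prodr_ile1 => j _; rewrite weight1_le1 ltW// weight1_gt0.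
have mw : measurable_fun setT w.
  by apply: measurable_prod => j _; exact: (measurableT_comp measurable_weight1 (measurable_mx_coord _ _)).
have ww x : weight (repeat_point m x) <= w x.
  have e i : \prod_(j < n) weight1 (repeat_point m x i j) = w x.
    by apply: eq_bigr => j _; rewrite mxE.
  rewrite /weight (bigD1 (Ordinal m0))//= e ler_piMr//.
  by apply: prodr_ile1 => i _; rewrite e w0 w1.
have mf : measurable_fun setT (fun x => normc (f (repeat_point m x))).
  apply: measurable_normc; exact: (cmeasurable_comp (cmeasurable_schwartz sf) measurable_repeat_point).
have q0 : 0 <= q - 1 by rewrite subr_ge0.
apply: (@le_lt_trans _ _ (\int[nu]_x ((M `^ q)%:E * (w x)%:E))%E).
  apply: ge0_le_integral => //.
  - by move=> x _; rewrite lee_fin powR_ge0.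
  - by apply/measurable_EFinP; exact: (measurableT_comp (measurable_powR _) mf).
  - by apply: emeasurable_funM => //; exact/measurable_EFinP.
  - move=> x _; rewrite -EFinM lee_fin.
    apply: (@le_trans _ _ ((M * w x) `^ q)).
      apply: ge0_ler_powR; rewrite ?nnegrE ?normc_ge0 ?mulr_ge0//.
        exact: le_trans q1.
      by apply: le_trans (HM _) _; exact: ler_wpM2l.
    rewrite powRM//; apply: ler_wpM2l; first exact: powR_ge0.
    have [->|wx] := eqVneq (w x) 0; first by rewrite powR0// gt_eqF// (lt_le_trans _ q1).
    have wp : 0 < w x by rewrite lt0r wx w0.
    rewrite -[q in leLHS](subrK 1) powRD_gt0// powRr1// ler_piMl//.
    apply: (@le_trans _ _ (1 `^ (q - 1))); last by rewrite powR1.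
    by apply: ge0_ler_powR; rewrite ?nnegrE.
rewrite ge0_integralZl_EFin ?powR_ge0//; last 2 first.
- by move=> x _; rewrite lee_fin.
- exact/measurable_EFinP.
apply: lte_mul_pinfty => //; first by rewrite lee_fin powR_ge0.
exact: integral_prod_weight1_lty.
Qed.

Variable a : 'I_m -> R.
Let B := @bessel_kernel_mx R m n a.
Variable h : V -> R.
Hypotheses (mh : measurable_fun setT h) (h0 : forall x, 0 <= h x).

Let mB : measurable_fun setT B. Proof. exact: measurable_bessel_kernel_mx. Qed.
Let B0 u : 0 <= B u. Proof. exact: bessel_kernel_mx_ge0. Qed.

(** The adjoint, applied to h, of the operator that convolves with B and restricts
    the result to the diagonal. *)
Definition diag_adjoint y : \bar R := (\int[nu]_x (h x * B (repeat_point m x - y))%:E)%E.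

Let measurable_kernelB k (d : measure_display) (T : measurableType d) (X Y : T -> V) :
  measurable_fun setT X -> measurable_fun setT Y ->
  measurable_fun setT (fun z => bessel_kernel (a k) (X z - Y z)).
Proof.
move=> mX mY; apply: (measurableT_comp (measurable_bessel_kernel (a k))).
exact: measurable_funB_mx.
Qed.

Definition kernel_square (k : 'I_m) (t : V * V) : \bar R :=
  (\int[nu]_v (bessel_kernel (a k) (t.1 - v) * bessel_kernel (a k) (t.2 - v))%:E)%E.

Let mker (d : measure_display) (T : measurableType d) (X : T -> V) (Y : T -> E) : measurable_fun setT X -> measurable_fun setT Y ->
  measurable_fun setT (fun z => B (repeat_point m (X z) - Y z)).
Proof.
move=> mX mY; apply: (measurableT_comp mB).
by apply: measurable_funB_mx => //; exact: (measurableT_comp measurable_repeat_point).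
Qed.

Lemma measurable_diag_adjoint : measurable_fun setT diag_adjoint.
Proof.
apply: (measurable_fun_fubini_tonelli_F (fun z : E * V => (h z.2 * B (repeat_point m z.2 - z.1))%:E)).
  apply/measurable_EFinP; apply: measurable_funM; first exact: (measurableT_comp mh measurable_snd).
  by apply: mker; [exact: measurable_snd|exact: measurable_fst].
by move=> z; rewrite lee_fin mulr_ge0.
Qed.

Lemma diag_adjoint_ge0 y : (0 <= diag_adjoint y)%E.
Proof. by apply: integral_ge0 => x _; rewrite lee_fin mulr_ge0. Qed.

Lemma kernel_square_ge0 k t : (0 <= kernel_square k t)%E.
Proof. by apply: integral_ge0 => v _; rewrite lee_fin mulr_ge0 ?bessel_kernel_ge0. Qed.

Lemma measurable_kernel_square k : measurable_fun setT (kernel_square k).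
Proof.
apply: (measurable_fun_fubini_tonelli_F (fun z : (V * V) * V =>
  (bessel_kernel (a k) (z.1.1 - z.2) * bessel_kernel (a k) (z.1.2 - z.2))%:E)).
  have m1 : measurable_fun setT (fun z : (V * V) * V => z.1.1).
    exact: (measurableT_comp measurable_fst measurable_fst).
  have m2 : measurable_fun setT (fun z : (V * V) * V => z.1.2).
    exact: (measurableT_comp measurable_snd measurable_fst).
  apply/measurable_EFinP; apply: measurable_funM; apply: measurable_kernelB => //;
    exact: measurable_snd.
by move=> z; rewrite lee_fin mulr_ge0 ?bessel_kernel_ge0.
Qed.

(** B is a product over rows and all rows of a diagonal point are equal, so that the
    integral factors. *)
Lemma integral_prod_kernel x w :
  (\int[L]_y (B (repeat_point m x - y) * B (repeat_point m w - y))%:E =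
   \prod_(k < m) kernel_square k (x, w))%E.
Proof.
rewrite -(ge0_integral_prod_mx (F := fun k v =>
  (bessel_kernel (a k) (x - v) * bessel_kernel (a k) (w - v))%:E)).
- apply: eq_integral => y _; rewrite prodEFin; congr EFin; rewrite -big_split/=.
  by apply: eq_bigr => k _; rewrite !row_repeat_pointB.
- by move=> k; apply/measurable_EFinP; apply: measurable_funM; exact: measurable_kernelB.
- by move=> k v; rewrite lee_fin mulr_ge0 ?bessel_kernel_ge0.
Qed.

(** The T T* argument: the square of the norm of the adjoint is a quadratic form in h,
    with kernel the product of the self-convolutions of the Bessel kernels. *)
Lemma integral_diag_adjoint_sqr :
  (\int[L]_y (diag_adjoint y * diag_adjoint y) =
   \int[nu]_x \int[nu]_w ((h x)%:E * (\prod_(k < m) kernel_square k (x, w)) * (h w)%:E))%E.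
Proof.
pose K x y := h x * B (repeat_point m x - y).
have K0 x y : 0 <= K x y by rewrite mulr_ge0.
have mK (d : measure_display) (T : measurableType d) (X : T -> V) (Y : T -> E) :
    measurable_fun setT X -> measurable_fun setT Y -> measurable_fun setT (fun z => K (X z) (Y z)).
  by move=> mX mY; apply: measurable_funM; [exact: (measurableT_comp mh)|exact: mker].
have e1 y : (diag_adjoint y * diag_adjoint y = \int[nu]_x \int[nu]_w (K x y * K w y)%:E)%E.
  have mKy : measurable_fun setT (fun x => (K x y)%:E) by apply/measurable_EFinP; exact: mK.
  rewrite {1}/diag_adjoint -ge0_integralZr//; last 2 first.
  - by move=> x _; rewrite lee_fin K0.
  - exact: diag_adjoint_ge0.
  apply: eq_integral => x _; rewrite /diag_adjoint -ge0_integralZl_EFin//; last 2 first.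
  - by move=> w _; rewrite lee_fin K0.
  - exact: K0.
under eq_integral do rewrite e1.
rewrite (fubini_tonelli (fun z : E * V => (\int[nu]_w (K z.2 z.1 * K w z.1)%:E)%E))/=; last 2 first.
- apply: (measurable_fun_fubini_tonelli_F (fun z : (E * V) * V => (K z.1.2 z.1.1 * K z.2 z.1.1)%:E)).
    have m1 : measurable_fun setT (fun z : (E * V) * V => z.1.1).
      exact: (measurableT_comp measurable_fst measurable_fst).
    have m2 : measurable_fun setT (fun z : (E * V) * V => z.1.2).
      exact: (measurableT_comp measurable_snd measurable_fst).
    by apply/measurable_EFinP; apply: measurable_funM; apply: mK => //; exact: measurable_snd.
  by move=> z; rewrite lee_fin mulr_ge0.
- by move=> z; apply: integral_ge0 => w _; rewrite lee_fin mulr_ge0.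
apply: eq_integral => x _.
rewrite (fubini_tonelli (fun z : E * V => (K x z.1 * K z.2 z.1)%:E))/=; last 2 first.
- apply/measurable_EFinP; apply: measurable_funM; apply: mK => //.
- by move=> z; rewrite lee_fin mulr_ge0.
apply: eq_integral => w _.
rewrite -integral_prod_kernel muleAC -EFinM -ge0_integralZl_EFin ?mulr_ge0//; last 2 first.
- by move=> y _; rewrite lee_fin mulr_ge0.
- apply/measurable_EFinP; apply: measurable_funM.
    exact: (mker (X := fun=> x)).
  exact: (mker (X := fun=> w)).
by apply: eq_integral => y _; rewrite -EFinM /K mulrACA.
Qed.

Lemma kernel_square_le (k : 'I_m) (mu : R) : 0 < a k -> 0 < mu -> n%:R - 2 * a k <= mu ->
  exists2 C : R, 0 <= C & forall t, t.1 - t.2 != 0 ->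
    (kernel_square k t <= (C * enorm (t.1 - t.2) `^ (- mu))%:E)%E.
Proof.
move=> a0 mu0 hmu.
have [||C C0 HC] := @bessel_selfconv_le R n (a k) (mu + 2 * a k) a0; [lra|lra|].
exists C => // -[x w] /= xw; rewrite subr_eq0 in xw.
have := HC x w xw; rewrite addrK; apply: le_trans.
have mp (X : V) : measurable_fun setT (fun v => bessel_potential (a k) (X - v)).
  apply: (measurableT_comp (measurable_bessel_potential (a k))).
  exact: measurable_funB_mx.
apply: ge0_le_integral => //.
- by move=> v _; rewrite lee_fin mulr_ge0 ?bessel_kernel_ge0.
- by apply/measurable_EFinP; apply: measurable_funM; exact: measurable_kernelB.
- by apply: emeasurable_funM; exact: mp.
- by move=> v _; rewrite EFinM; apply: lee_pmul; rewrite ?lee_fin ?bessel_kernel_ge0 ?bessel_kernel_le.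
Qed.

End Diagonal.

(** * The trace inequality by duality *)

Section TraceInequality.
Context {R : realType} (m n : nat) (alpha : 'I_m -> R) (p q : R).
Notation normc := Normc.normc.
Notation V := 'rV[R]_n.
Notation E := 'M[R]_(m, n).
Notation nu := (lebesgue_rV R n).
Notation L := (lebesgue_mx R m n).
Hypotheses (n_gt0 : (0 < n)%N) (m_gt0 : (0 < m)%N).
Hypothesis halpha : forall k, 0 < alpha k < n%:R.
Let lam : R := (m * n)%:R - \sum_(k < m) alpha k.
Hypothesis lam_lt : lam < n%:R.
Hypotheses (q_ge2 : 2 <= q) (hq : q <= 2 * n%:R / lam) (pq : p^-1 + q^-1 = 1).

Let a (k : 'I_m) : R := alpha k / 2.

Lemma integral_diag_adjoint_sqr_le : exists2 C : R, 0 < C & forall h : V -> R,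
  measurable_fun setT h -> (forall x, 0 <= h x) ->
  (\int[L]_y (diag_adjoint a h y * diag_adjoint a h y) <=
   C%:E * (\int[nu]_x (h x `^ p)%:E) `^ (2 / p))%E.
Proof.
have [|C C0 H] := prod_form_le n_gt0 m_gt0 halpha lam_lt q_ge2 hq pq
  (measurable_kernel_square a) (kernel_square_ge0 a).
  move=> k mu hmu; have /andP[a0 an] := halpha k.
  apply: kernel_square_le; first by rewrite /a divr_gt0.
    by apply: lt_le_trans hmu; rewrite subr_gt0.
  by rewrite /a; lra.
by exists C => // h mh h0; rewrite integral_diag_adjoint_sqr//; exact: H.
Qed.

(* The arithmetic-geometric inequality with a free parameter t, in extended reals. *)
Let young (N t : R) (Y : \bar R) : 0 <= N -> 0 < t -> (0 <= Y)%E ->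
  (2%:E * (N%:E * Y) <= t%:E * (N ^+ 2)%:E + t^-1%:E * (Y * Y))%E.
Proof.
move=> N0 t0; case: Y => [y||] // y0; last first.
  by rewrite mulyy [X in (_ <= _ + X)%E]gt0_muley ?lte_fin ?invr_gt0// addey ?leey.
rewrite -!EFinM -EFinD lee_fin.
have -> : 2 * (N * y) = t * N ^+ 2 + t^-1 * (y * y) - t * (N - t^-1 * y) ^+ 2.
  by field; rewrite gt_eqF.
by rewrite gerBl mulr_ge0 ?sqr_ge0// ltW.
Qed.

(** Move h to the other side of the pairing, where it becomes its image under the
    adjoint, and split the product with g by the arithmetic-geometric inequality.
    The free parameter t replaces the Cauchy-Schwarz inequality and avoids square
    roots of integrals that may be infinite. *)
Lemma trace_duality (f g : E -> R[i]) (h : V -> R) (t : R) : nice g ->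
  (forall x, f x = convolution (bessel_kernel_mx a) g x) -> (forall k, 0 < alpha k) ->
  measurable_fun setT (fun x => normc (f (repeat_point m x))) ->
  measurable_fun setT h -> (forall x, 0 <= h x) -> 0 < t ->
  (\int[nu]_x (h x * normc (f (repeat_point m x)))%:E <=
   t%:E * \int[L]_y (normc (g y) ^+ 2)%:E +
   t^-1%:E * \int[L]_y (diag_adjoint a h y * diag_adjoint a h y))%E.
Proof.
move=> ng fg alpha0 mf mh h0 t0.
have a0 k : 0 < a k by rewrite divr_gt0.
pose B := @bessel_kernel_mx R m n a.
have mB : measurable_fun setT B by exact: measurable_bessel_kernel_mx.
have B0 u : 0 <= B u by exact: bessel_kernel_mx_ge0.
have IB := @integral_bessel_kernel_mx_lty R m n a a0.
have [[mg goo] _ _] := ng.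
pose N y := normc (g y).
have N0 y : 0 <= N y by exact: normc_ge0.
have mN : measurable_fun setT N by exact: measurable_normc.
have mK : measurable_fun setT (fun z : V * E => h z.1 * (B (repeat_point m z.1 - z.2) * N z.2)).
  apply: measurable_funM; first exact: (measurableT_comp mh measurable_fst).
  apply: measurable_funM; last exact: (measurableT_comp mN measurable_snd).
  apply: (measurableT_comp mB); apply: measurable_funB_mx; last exact: measurable_snd.
  exact: (measurableT_comp (@measurable_repeat_point R m n) measurable_fst).
have K0 x y : 0 <= h x * (B (repeat_point m x - y) * N y) by rewrite !mulr_ge0.
have mKe : measurable_fun setT (fun z : V * E => (h z.1 * (B (repeat_point m z.1 - z.2) * N z.2))%:E).
  exact/measurable_EFinP.
have Ke0 (z : V * E) : (0 <= (h z.1 * (B (repeat_point m z.1 - z.2) * N z.2))%:E)%E by rewrite lee_fin.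
have step x : ((h x * normc (f (repeat_point m x)))%:E <=
    2%:E * \int[L]_y (h x * (B (repeat_point m x - y) * N y))%:E)%E.
  have mBN : measurable_fun setT (fun u => (B u * N (repeat_point m x - u))%:E).
    apply/measurable_EFinP; apply: measurable_funM => //; apply: (measurableT_comp mN).
    exact: measurable_funB_mx.
  have BN0 u : (0 <= (B u * N (repeat_point m x - u))%:E)%E by rewrite lee_fin mulr_ge0.
  have := normc_conv_le mB B0 IB ng (repeat_point m x); rewrite -fg.
  rewrite -(ge0_integral_reflect (repeat_point m x) mBN BN0).
  move=> /(@lee_wpmul2l _ (h x)%:E); rewrite lee_fin => /(_ (h0 x)).
  rewrite -EFinM => /le_trans; apply.
  rewrite muleCA; apply: lee_wpmul2l; first by rewrite lee_fin.
  rewrite -ge0_integralZl_EFin//.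
  - apply: ge0_le_integral => //.
    + by move=> y _; rewrite -EFinM lee_fin mulr_ge0// mulr_ge0.
    + apply: emeasurable_funM => //; apply: (measurableT_comp mBN); exact: measurable_funB_mx.
    + exact: (measurableT_comp mKe (measurable_pair1 x)).
    + by move=> y _; rewrite -EFinM subKr.
  - by apply: (measurableT_comp mBN); exact: measurable_funB_mx.
apply: (@le_trans _ _ (\int[nu]_x (2%:E * \int[L]_y (h x * (B (repeat_point m x - y) * N y))%:E))%E).
  apply: ge0_le_integral => //.
  - by move=> x _; rewrite lee_fin mulr_ge0// normc_ge0.
  - by apply/measurable_EFinP; exact: measurable_funM.
  - by apply: emeasurable_funM => //; exact: (measurable_fun_fubini_tonelli_F _ mKe Ke0).
rewrite ge0_integralZl_EFin//; last 2 first.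
- by move=> x _; apply: integral_ge0 => y _; exact: (Ke0 (x, y)).
- exact: (measurable_fun_fubini_tonelli_F _ mKe Ke0).
rewrite (fubini_tonelli _ mKe Ke0)/=.
have inner y : (\int[nu]_x (h x * (B (repeat_point m x - y) * N y))%:E = (N y)%:E * diag_adjoint a h y)%E.
  rewrite /diag_adjoint -ge0_integralZl_EFin//; last 2 first.
  - by move=> x _; rewrite lee_fin mulr_ge0.
  - apply/measurable_EFinP; apply: (measurable_funM mh); apply: (measurableT_comp mB).
    by apply: measurable_funB_mx => //; exact: measurable_repeat_point.
  by apply: eq_integral => x _; rewrite -EFinM mulrA mulrC.
under eq_integral do rewrite inner.
have mPsi := measurable_diag_adjoint a mh h0.
have Psi0 := diag_adjoint_ge0 a h0.
have mNe : measurable_fun setT (fun y => (N y)%:E) by exact/measurable_EFinP.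
have mN2 : measurable_fun setT (fun y => (N y ^+ 2)%:E) by apply/measurable_EFinP; exact: measurable_funX.
have mP2 : measurable_fun setT (fun y => diag_adjoint a h y * diag_adjoint a h y)%E by exact: emeasurable_funM.
rewrite -ge0_integralZl_EFin//; last 2 first.
- by move=> y _; rewrite mule_ge0 ?lee_fin.
- exact: emeasurable_funM.
apply: (@le_trans _ _ (\int[L]_y (t%:E * (N y ^+ 2)%:E +
    t^-1%:E * (diag_adjoint a h y * diag_adjoint a h y)))%E).
  apply: ge0_le_integral => //.
  - by move=> y _; rewrite !mule_ge0 ?lee_fin.
  - by apply: emeasurable_funM => //; exact: emeasurable_funM.
  - by apply: emeasurable_funD; exact: emeasurable_funM.
  - by move=> y _; exact: young.
have ti0 : 0 <= t^-1 by rewrite invr_ge0 ltW.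
rewrite ge0_integralD//; last 4 first.
- by move=> y _; rewrite -EFinM lee_fin mulr_ge0 ?sqr_ge0// ltW.
- exact: emeasurable_funM.
- by move=> y _; rewrite !mule_ge0 ?lee_fin.
- exact: emeasurable_funM.
rewrite ge0_integralZl_EFin ?(ltW t0)//; last by move=> y _; rewrite lee_fin sqr_ge0.
rewrite ge0_integralZl_EFin//.
by move=> y _; rewrite !mule_ge0 ?lee_fin.
Qed.

Let q_gt0 : 0 < q. Proof. exact: lt_le_trans q_ge2. Qed.

(** Duality with h = phi^(q-1), where phi is the restriction of |f| to the diagonal:
    then h phi = h^p = phi^q. Writing A for the integral of phi^q, which is finite,
    and l for Lambda_star, one gets A <= t l + C A^(2/p) / t for all t > 0, and the
    choice of t that makes the last term equal to A / 2 gives A^(2/q) <= 4 C l. *)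
Lemma trace_inequality : exists2 C : R, 0 < C & forall f : E -> R[i], schwartz f ->
  ((\int[nu]_x (normc (f (repeat_point m x)) `^ q)%:E) `^ (2 / q) <=
   C%:E * Lambda_star f alpha)%E.
Proof.
have [C C0 HC] := integral_diag_adjoint_sqr_le.
have alpha0 k : 0 < alpha k by case/andP: (halpha k).
exists (4 * C); first by rewrite mulr_gt0.
move=> f sf; have q1 : 1 <= q by apply: le_trans q_ge2; rewrite ler1n.
have Afin := integral_trace_lty m_gt0 q1 sf.
pose phi (x : V) := normc (f (repeat_point m x)).
have phi0 x : 0 <= phi x by exact: normc_ge0.
have mphi : measurable_fun setT phi.
  apply: measurable_normc; exact: (cmeasurable_comp (cmeasurable_schwartz sf) (@measurable_repeat_point R m n)).
pose h x := phi x `^ (q - 1).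
have h0 x : 0 <= h x by exact: powR_ge0.
have mh : measurable_fun setT h by exact: (measurableT_comp (measurable_powR _) mphi).
have p1q : (q - 1) * p = q.
  have p0 : p != 0.
    apply/eqP => p0; have := pq; rewrite p0 invr0 add0r => /eqP.
    by rewrite invr_eq1 => /eqP; have := q_ge2; lra.
  have := pq; move=> /(congr1 (fun z => z * (p * q))).
  rewrite mul1r mulrDl mulrA mulVf// mul1r mulrCA mulVf ?gt_eqF// mulr1; lra.
have [ng _] := bessel_ops_has_symbol alpha sf.
have fg x := bessel_ops_conv x sf alpha0.
have A0 : (0 <= \int[nu]_x (phi x `^ q)%:E)%E by apply: integral_ge0 => x _; rewrite lee_fin powR_ge0.
have hp x : h x `^ p = phi x `^ q by rewrite /h -powRrM p1q.
have hphi x : h x * phi x = phi x `^ q.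
  have [e|ne] := eqVneq (phi x) 0; first by rewrite e mulr0 powR0// gt_eqF.
  have pp : 0 < phi x by rewrite lt0r ne phi0.
  by rewrite /h -[X in _ * X](powRr1 (phi0 x)) -powRD_gt0// subrK.
have D t : 0 < t -> (\int[nu]_x (phi x `^ q)%:E <= t%:E * Lambda_star f alpha +
    t^-1%:E * (C%:E * (\int[nu]_x (phi x `^ q)%:E) `^ (2 / p)))%E.
  move=> t0; have := trace_duality ng fg alpha0 mphi mh h0 t0.
  under eq_integral do rewrite hphi.
  move=> /le_trans; apply; rewrite leeD2l//; apply: lee_wpmul2l.
    by rewrite lee_fin invr_ge0 ltW.
  by have := HC h mh h0; under [in leRHS]eq_integral do rewrite hp.
have L0 : (0 <= Lambda_star f alpha)%E by apply: integral_ge0 => y _; rewrite lee_fin sqr_ge0.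
rewrite -/phi in Afin *.
move: A0 Afin D L0; case: (\int[nu]_x _)%E => [A||] // A0 _ D.
case: (Lambda_star f alpha) D => [l||] // D l0; last by rewrite gt0_muley ?leey// lte_fin mulr_gt0.
rewrite poweR_EFin -EFinM lee_fin; rewrite lee_fin in A0; rewrite lee_fin in l0.
have [->|A1] := eqVneq A 0.
  by rewrite powR0 ?mulf_neq0 ?invr_eq0 ?gt_eqF// !mulr_ge0// ltW.
have Ap : 0 < A by rewrite lt0r A1.
pose b := A `^ (2 / p); have b0 : 0 < b by exact: powR_gt0.
have t0 : 0 < 2 * C * b / A by rewrite divr_gt0 ?mulr_gt0.
have := D _ t0; rewrite poweR_EFin -!EFinM -EFinD lee_fin -/b => H.
have e1 : (2 * C * b / A)^-1 * (C * b) = A / 2 by field; rewrite !gt_eqF.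
rewrite e1 in H.
have H2 : A / 2 <= 2 * C * b / A * l by lra.
have H3 : A * A <= 4 * C * l * b.
  have /(ler_wpM2r (ltW Ap)) := H2.
  by rewrite (_ : _ / A * l * A = 2 * C * b * l); [lra|field].
have e2 : A `^ (2 / q) * b = A * A.
  rewrite /b -powRD_gt0// (_ : _ + _ = 1 + 1); first by rewrite powRD_gt0// powRr1.
  by rewrite -mulrDr [_ + p^-1]addrC pq; lra.
by rewrite -(ler_pM2r b0) e2.
Qed.

End TraceInequality.

Unset Implicit Arguments.
Local Close Scope complex_scope.

Theorem theorem5 (R : realType) (n m : nat) (alpha : 'I_m -> R) (q p : R)
    (hn : (1 <= n)%N) (hm : (1 <= m)%N)
    (halpha : forall k, 0 < alpha k < n%:R)
    (hsum : (m * n)%:R - \sum_(k < m) alpha k < n%:R)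
    (hq2 : 2 <= q)
    (hq : q <= 2 * n%:R / ((m * n)%:R - \sum_(k < m) alpha k))
    (hpq : p^-1 + q^-1 = 1) :
  exists C : R,
    (forall f : 'M[R]_(m, n) -> complex R, schwartz f ->
       ((\int[lebesgue_rV R n]_x (Normc.normc (f (repeat_point m x)) `^ q)%:E)
          `^ (2 / q) <= C%:E * Lambda_star f alpha)%E) /\
    (forall h : 'rV[R]_n -> R, h \in Lfun (lebesgue_rV R n) p%:E ->
       (\int[lebesgue_rV R n \x lebesgue_rV R n]_z
          ((h z.1)%:E *
           (\prod_(k < m) bessel_potential (alpha k) (z.1 - z.2)) *
           (h z.2)%:E)
        <= C%:E * ('N[lebesgue_rV R n]_p%:E[EFin \o h]) ^+ 2)%E).
Proof.
have [C1 C10 H1] := trace_inequality hn hm halpha hsum hq2 hq hpq.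
have [C2 C20 H2] := bessel_product_form_le hn hm halpha hsum hq2 hq hpq.
exists (C1 + C2); split => [f sf|h hL].
  apply: le_trans (H1 f sf) _; apply: lee_wpmul2r; last by rewrite lee_fin lerDl ltW.
  by apply: integral_ge0 => y _; rewrite lee_fin sqr_ge0.
apply: le_trans (H2 h hL) _; apply: lee_wpmul2r; last by rewrite lee_fin lerDr ltW.
by rewrite expe2 mule_ge0 ?Lnorm_ge0.
Qed.
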